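(* Let $\tau$ be a genuine smooth admissible irreducible representation of $\widetilde{H(F)}$, and write $\tau\simeq i(\chi_{\varpi,\psi})$ for some character $\chi$ of $F_d^*$, extended to a character of $F^*$ (the character $\chi^n$ of $F^*$ is independent of the choices and is an invariant of $\tau$). Let $\mu(\tau,s)$ be the rational function in $q^{-s}$ defined by $$A_{w^{-1}}(\tau^w,-s)\circ A_w(\tau,s)=\mu^{-1}(\tau,s)\,\mathrm{Id}.$$ Then $$\mu^{-1}(\tau,s)=q^{\,e(\psi)-e(\chi^n)}\;\frac{L(ns,\chi^n)\,L(-ns,\chi^{-n})}{L(1-ns,\chi^{-n})\,L(1+ns,\chi^{n})}.$$
   Context: Setting. $n\ge 1$ is an integer, $F$ is a $p$-adic field of residual characteristic $p$ with $\gcd(p,n)=1$, and $F^*$ contains the full group $\mu_n$ of $n$-th roots of unity, identified with the $n$-th roots of unity in $\mathbb C^*$. $\mathbb O_F$ is the ring of integers, $\mathbb P_F$ its maximal ideal, $\varpi$ a fixed generator of $\mathbb P_F$, $q$ the cardinality of the residue field, $\|\cdot\|$ the absolute value with $\|\varpi\|=q^{-1}$. $(\cdot,\cdot):F^*\times F^*\to\mu_n$ is the $n$-th power Hilbert symbol, $(\cdot,\cdot)_2$ the quadratic one. Put $d=n/\gcd(n,2)$. Characters. $\psi$ is a non-trivial character of $F$; $e(\psi)$ is its conductor (the smallest integer $m$ such that $\psi$ is trivial on $\mathbb P_F^m$). For a character $\chi$ of $F^*$ (not necessarily unitary), $e(\chi)$ is its conductor ($0$ if $\chi$ is unramified, otherwise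 the least $m\ge1$ such that $\chi$ is trivial on $1+\mathbb P_F^m$). $L(s,\chi)=(1-\chi(\varpi)q^{-s})^{-1}$ if $\chi$ is unramified and $L(s,\chi)=1$ otherwise. $d_\psi x$ is the Haar measure on $F$ that is self dual with respect to $\psi$. For $a\in F^*$, $\psi_a(x)=\psi(ax)$; the Weil index is $\gamma_F(\psi)=\lim_{r\to\infty}\int_{\mathbb P_F^{-r}}\psi(x^2)\,d_\psi x$ and $\gamma_\psi(a)=\gamma_F(\psi_a)/\gamma_F(\psi)$ (used only for $n$ even, in which case $p$ is odd). The cover. $SL_2(F)$; $n(x)=\begin{pmatrix}1&x\\0&1\end{pmatrix}$, $h(a)=\begin{pmatrix}a&0\\0&a^{-1}\end{pmatrix}$, $w=\begin{pmatrix}0&1\\-1&0\end{pmatrix}$; $N(F)=\{n(x)\}$, $H(F)=\{h(a)\}$, $B(F)=H(F)\ltimes N(F)$. $\widetilde{SL_2(F)}$ is the set $SL_2(F)\times\mu_n$ with multiplication $(g,\epsilon)(g',\epsilon')=(gg',c(g,g')\epsilon\epsilon')$, where $c(g_1,g_2)=\bigl(x(g_1g_2)x(g_1)^{-1},\,x(g_1g_2)x(g_2)^{-1}\bigr)$ and $x\begin{pmatrix}a&b\\c&d\end{pmatrix}=c$ if $c\ne0$, $=d$ if $c=0$. Put $\mathbf s(g)=(g,1)$; for $A\subseteq SL_2(F)$, $\widetilde A$ is its preimage in $\widetilde{SL_2(F)}$. A representation of $\widetilde{SL_2(F)}$ or a subgroup is genuine if $(I_2,\epsilon)$ acts by $\epsilon$.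 Representations of $\widetilde{H(F)}$. $F_d^*$ is the group of elements of $F^*$ with valuation in $d\mathbb Z$, $H_d(F)=\{h(a): a\in F_d^*\}$; $\widetilde{H_d(F)}$ is a maximal abelian subgroup of $\widetilde{H(F)}$. Let $\beta_\varpi:F_d^*\to F^*$, $\beta_\varpi(u\varpi^{md})=u\varpi^m$ ($u\in\mathbb O_F^*$), and let $\xi_{\varpi,\psi}:F_d^*\to\mathbb C^*$ be trivial if $n$ is odd and $\gamma_\psi^{-1}\circ\beta_\varpi$ if $n$ is even. For a character $\chi$ of $F_d^*$, $\chi_{\varpi,\psi}(h(a),\epsilon)=\epsilon\,\chi(a)\,\xi_{\varpi,\psi}(a)$ is a genuine character of $\widetilde{H_d(F)}$, and $i(\chi_{\varpi,\psi})=\mathrm{Ind}_{\widetilde{H_d(F)}}^{\widetilde{H(F)}}\chi_{\varpi,\psi}$. Every genuine smooth admissible irreducible representation $\tau$ of $\widetilde{H(F)}$ is of this form. For $s\in\mathbb C$, $\tau_s$ is the genuine irreducible representation of $\widetilde{H(F)}$ whose central character is that of $\tau$ multiplied by $(h(a),\epsilon)\mapsto\|a\|^s$ (concretely the twist of $\tau$ by $(h(a),\epsilon)\mapsto\|a\|^s$). $\tau_s$ is extended to $\widetilde{B(F)}$ trivially on $\mathbf s(N(F))$, and $I(\tau,s)=\mathrm{Ind}_{\widetilde{B(F)}}^{\widetilde{SL_2(F)}}\tau_s$ (normalized induction). $\tau^w(h)=\tau(\mathbf s(w)h\,\mathbf s(w)^{-1})$. $A_w(\tau,s):I(\tau,s)\to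 I(\tau^w,-s)$ is the meromorphic continuation of $f\mapsto\bigl(g\mapsto\int_F f(\mathbf s(w)\mathbf s(n(x))g)\,d_\psi x\bigr)$, and $A_{w^{-1}}(\tau^w,-s):I(\tau^w,-s)\to I(\tau,s)$ is defined in the same way with $w^{-1}$ in place of $w$ (same measure $d_\psi x$). For all but finitely many values of $q^s$, $\mathrm{Hom}_{\widetilde{SL_2(F)}}(I(\tau,s),I(\tau,s))$ is one dimensional, so $\mu(\tau,s)$ is well defined. *)

(* Defs.v *)
From HB Require Import structures.
From mathcomp Require Import all_boot all_order all_algebra.
From mathcomp Require Import all_classical all_reals all_analysis.
From mathcomp Require Import complex.

Set Implicit Arguments.
Unset Strict Implicit.
Unset Printing Implicit Defensive.

Import Order.TTheory GRing.Theory Num.Theory.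
Import numFieldNormedType.Exports.

Local Open Scope classical_set_scope.
Local Open Scope ring_scope.

(** * p-adic fields *)

(* Valuations are [int]-valued; their value at [0] is never used.
   [in_ball v m x] says that [x] lies in the [m]-th power of the maximal
   ideal. *)
Definition in_ball (K : fieldType) (v : K -> int) (m : int) (x : K) : bool :=
  (x == 0) || (m <= v x).

Record padicField := PadicField {
  pf_sort :> fieldType;
  pf_v : pf_sort -> int;
  res_char : nat;
  res_card : nat;
  pf_char0 : [pchar pf_sort] =i pred0;
  pf_valM : forall x y, x != 0 -> y != 0 -> pf_v (x * y) = pf_v x + pf_v y;
  pf_valD : forall x y, x != 0 -> y != 0 -> x + y != 0 ->
    Num.min (pf_v x) (pf_v y) <= pf_v (x + y);
  pf_val_onto : exists2 x, x != 0 & pf_v x = 1;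
  pf_complete : forall u : nat -> pf_sort,
    (forall m, exists N, forall i j, (N <= i)%N -> (N <= j)%N ->
       in_ball pf_v m (u i - u j)) ->
    exists l, forall m, exists N, forall i, (N <= i)%N ->
       in_ball pf_v m (u i - l);
  pf_res_char_prime : prime res_char;
  pf_res_char : 0 < pf_v (res_char%:R);
  (* a complete system of [res_card] residues modulo the maximal ideal *)
  pf_res_card : exists r : seq pf_sort,
    [/\ size r = res_card, all (in_ball pf_v 0) r &
        forall x, in_ball pf_v 0 x ->
          count (fun y => in_ball pf_v 1 (x - y)) r = 1%N]
}.

Notation inP := (in_ball (@pf_v _)).

(* The identification of the n-th roots of unity of [F] with those of the
   complex numbers is the isomorphism carrying [rootF] to [rootC]. *)
Record root_ident (R : realType) (F : padicField) (n : nat) := RootIdent {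
  rootF : F;
  rootC : R[i];
  rootF_prim : n.-primitive_root rootF;
  rootC_prim : n.-primitive_root rootC
}.

(* [x ^ s] for a positive real [x] *)
Definition cpow (R : realType) (x : R) (s : R[i]) : R[i] :=
  Complex (x `^ complex.Re s * cos (complex.Im s * ln x))
          (x `^ complex.Re s * sin (complex.Im s * ln x)).

Definition is_least (P : set int) (m : int) : Prop :=
  P m /\ forall m', P m' -> m <= m'.

Section Analysis.
Context (R : realType) (F : padicField).
Local Notation C := R[i].
Local Notation q := (res_card F).

Definition absF (x : F) : R := if x == 0 then 0 else q%:R ^ (- pf_v x).

(** ** Measure and integration on [F] *)

(* The field with a distinguished point, as required by the library's
   generated sigma-algebras. *)
Definition ptF : Type := F.
HB.instance Definition _ := Choice.on ptF.
HB.instance Definition _ := isPointed.Build ptF (0 : F).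

Definition balls : set (set ptF) :=
  [set B | exists a m, B = [set x : F | inP m (x - a)]].

(* [F] with its Borel sigma-algebra *)
Definition borelF := g_sigma_algebraType balls.

Definition is_haar (mu : {measure set borelF -> \bar R}) : Prop :=
  (forall (A : set borelF) (a : F), measurable A ->
     mu [set (a + x : F) | x in (A : set F)] = mu A) /\
  (0 < mu [set x : F | inP 0 x] < +oo)%E.

Definition cintegrable (mu : {measure set borelF -> \bar R})
    (phi : F -> C) : Prop :=
  mu.-integrable setT (fun x : borelF => (complex.Re (phi x))%:E) /\
  mu.-integrable setT (fun x : borelF => (complex.Im (phi x))%:E).

Definition cintegral (mu : {measure set borelF -> \bar R})
    (D : set F) (phi : F -> C) : C :=
  Complex (Rintegral mu (D : set borelF) (fun x => complex.Re (phi x)))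
          (Rintegral mu (D : set borelF) (fun x => complex.Im (phi x))).

(* [I] is the (weak) integral over [F] of the vector-valued function [phi] *)
Definition has_integral (V : lmodType C)
    (mu : {measure set borelF -> \bar R}) (phi : F -> V) (I : V) : Prop :=
  forall l : {scalar V},
    cintegrable mu (fun x => l (phi x)) /\
    cintegral mu setT (fun x => l (phi x)) = l I.

(** ** Characters *)

Definition add_char (psi : F -> C) : Prop :=
  [/\ forall x y, psi (x + y) = psi x * psi y,
      psi 0 = 1 &
      exists m, forall x, inP m x -> psi x = 1].

Definition nontrivial_add_char (psi : F -> C) : Prop :=
  add_char psi /\ exists x, psi x <> 1.

(* Values at [0] are irrelevant. *)
Definition mul_char (chi : F -> C) : Prop :=
  [/\ forall x y, x != 0 -> y != 0 -> chi (x * y) = chi x * chi y,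
      forall x, x != 0 -> chi x != 0 &
      exists2 m : int, 1 <= m & forall x, inP m (x - 1) -> chi x = 1].

Definition unramified (chi : F -> C) : Prop :=
  forall x, x != 0 -> pf_v x = 0 -> chi x = 1.

Definition cond_add (psi : F -> C) : int :=
  xget 0 (is_least [set m | forall x, inP m x -> psi x = 1]).

Definition cond_mul (chi : F -> C) : int :=
  if `[< unramified chi >] then 0
  else xget 0 (is_least
    [set m | 1 <= m /\ forall x, inP m (x - 1) -> chi x = 1]).

Definition chiX (chi : F -> C) (k : int) : F -> C := fun x => chi x ^ k.

Definition L_factor (varpi : F) (s : C) (chi : F -> C) : C :=
  if `[< unramified chi >] then (1 - chi varpi * cpow q%:R (- s))^-1 else 1.

(** ** Self-dual measures and the Weil index *)

Definition schwartz_bruhat (phi : F -> C) : Prop :=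
  exists m r : int,
    (forall x y, inP m y -> phi (x + y) = phi x) /\
    (forall x, ~~ inP r x -> phi x = 0).

Definition self_dual (psi : F -> C) (mu : {measure set borelF -> \bar R}) :
    Prop :=
  is_haar mu /\
  forall phi, schwartz_bruhat phi -> forall z,
    cintegral mu setT (fun x =>
      cintegral mu setT (fun y => phi y * psi (y * x)) * psi (x * z))
    = phi (- z).

Definition self_dual_family
    (dx : (F -> C) -> {measure set borelF -> \bar R}) : Prop :=
  forall psi, nontrivial_add_char psi -> self_dual psi (dx psi).

Variable dx : (F -> C) -> {measure set borelF -> \bar R}.

Definition weil_index (psi : F -> C) : C :=
  let I (r : nat) := cintegral (dx psi) [set x | inP (- r%:Z) x]
                       (fun x => psi (x ^+ 2)) in
  Complex (lim ((fun r => complex.Re (I r)) @ \oo))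
          (lim ((fun r => complex.Im (I r)) @ \oo)).

Definition weil_gamma (psi : F -> C) (a : F) : C :=
  weil_index (fun x => psi (a * x)) / weil_index psi.

(* [a = u varpi^(m d)] is sent to [u varpi^m] *)
Definition beta_varpi (d : nat) (varpi a : F) : F :=
  a * varpi ^ ((pf_v a %/ d%:Z)%Z - pf_v a).

Definition xi (n : nat) (varpi : F) (psi : F -> C) (a : F) : C :=
  if odd n then 1 else (weil_gamma psi (beta_varpi (n %/ gcdn n 2) varpi a))^-1.

End Analysis.

(** * The cover of SL_2 *)

Section Cover.
Context (R : realType) (F : padicField) (n : nat) (iota : root_ident R F n).
Local Notation C := R[i].
Local Notation q := (res_card F).

Definition mu_n := {z : C | z ^+ n == 1}.

Lemma root_pow_subproof (k : nat) : (rootC iota ^+ k) ^+ n == 1.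
Proof. by rewrite exprAC (prim_expr_order (rootC_prim iota)) expr1n. Qed.
Definition root_pow k : mu_n := exist _ (rootC iota ^+ k) (root_pow_subproof k).

Lemma mu_mul_subproof (e e' : mu_n) : (sval e * sval e') ^+ n == 1.
Proof. by rewrite exprMn (eqP (svalP e)) (eqP (svalP e')) mulr1. Qed.
Definition mu_mul (e e' : mu_n) : mu_n :=
  exist _ (sval e * sval e') (mu_mul_subproof e e').

Lemma mu_inv_subproof (e : mu_n) : (sval e)^-1 ^+ n == 1.
Proof. by rewrite exprVn (eqP (svalP e)) invr1. Qed.
Definition mu_inv (e : mu_n) : mu_n := exist _ (sval e)^-1 (mu_inv_subproof e).

(* As the residual characteristic is prime to [n], the Hilbert symbol (a, b)
   is the tame symbol: the n-th root of unity congruent, modulo the maximal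
   ideal, to the power (q-1)/n of the unit
   (-1)^(v(a)v(b)) a^v(b) b^(-v(a)). *)
Definition hilbert (a b : F) : mu_n :=
  let t := (-1) ^ (pf_v a * pf_v b) * a ^ (pf_v b) * b ^ (- pf_v a) in
  if [pick k : 'I_n | inP 1 (rootF iota ^+ k - t ^+ ((q - 1) %/ n))] is Some k
  then root_pow k else root_pow 0.

Definition mat2 (a b c d : F) : 'M[F]_2 :=
  \matrix_(i, j) if i == 0 then (if j == 0 then a else b)
                 else (if j == 0 then c else d).

Lemma det_mat2 a b c d : \det (mat2 a b c d) = a * d - b * c.
Proof.
rewrite (expand_det_row _ 0) !big_ord_recl big_ord0 addr0 /cofactor.
by rewrite !det_mx11 !mxE /= expr0 expr1 mul1r mulN1r mulrN.
Qed.

Definition SL2 := {g : 'M[F]_2 | \det g == 1}.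

Lemma SL2_mul_subproof (g g' : SL2) : \det (sval g *m sval g') == 1.
Proof. by rewrite det_mulmx (eqP (svalP g)) (eqP (svalP g')) mulr1. Qed.
Definition SL2_mul (g g' : SL2) : SL2 :=
  exist _ (sval g *m sval g') (SL2_mul_subproof g g').

Lemma SL2_inv_subproof (g : SL2) : \det (invmx (sval g)) == 1.
Proof. by rewrite det_inv (eqP (svalP g)) invr1. Qed.
Definition SL2_inv (g : SL2) : SL2 :=
  exist _ (invmx (sval g)) (SL2_inv_subproof g).

Lemma SL2_one_subproof : \det (1%:M : 'M[F]_2) == 1.
Proof. by rewrite det1. Qed.
Definition SL2_one : SL2 := exist _ 1%:M SL2_one_subproof.

Lemma SL2_n_subproof (x : F) : \det (mat2 1 x 0 1) == 1.
Proof. by rewrite det_mat2 mulr0 subr0 mulr1. Qed.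
Definition SL2_n (x : F) : SL2 := exist _ (mat2 1 x 0 1) (SL2_n_subproof x).

Lemma SL2_h_subproof (a : F) (a0 : a != 0) : \det (mat2 a 0 0 a^-1) == 1.
Proof. by rewrite det_mat2 mulr0 subr0 divff. Qed.
Definition SL2_h (a : F) (a0 : a != 0) : SL2 :=
  exist _ (mat2 a 0 0 a^-1) (SL2_h_subproof a0).

Lemma SL2_w_subproof : \det (mat2 0 1 (-1) 0) == 1.
Proof. by rewrite det_mat2 mulr0 sub0r mulrN1 opprK. Qed.
Definition SL2_w : SL2 := exist _ (mat2 0 1 (-1) 0) SL2_w_subproof.

Definition xSL (g : SL2) : F :=
  if sval g 1 0 != 0 then sval g 1 0 else sval g 1 1.

Definition cocycle (g g' : SL2) : mu_n :=
  hilbert (xSL (SL2_mul g g') * (xSL g)^-1) (xSL (SL2_mul g g') * (xSL g')^-1).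

Definition coverSL2 := (SL2 * mu_n)%type.

Definition cmul (x y : coverSL2) : coverSL2 :=
  (SL2_mul x.1 y.1, mu_mul (mu_mul (cocycle x.1 y.1) x.2) y.2).

Definition sec (g : SL2) : coverSL2 := (g, root_pow 0).

Definition cone : coverSL2 := sec SL2_one.

Definition cinv (x : coverSL2) : coverSL2 :=
  (SL2_inv x.1, mu_mul (mu_inv (cocycle x.1 (SL2_inv x.1))) (mu_inv x.2)).

(* Principal congruence subgroups. As [p] is prime to [n], the cocycle is
   trivial on [congrK m] for [1 <= m], and the subgroups [sec (congrK m)] form a
   basis of neighbourhoods of the identity of the cover. *)
Definition congrK (m : nat) (k : SL2) : Prop :=
  forall i j, inP m%:Z (sval k i j - (1%:M : 'M[F]_2) i j).

Definition cover_K : set coverSL2 :=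
  [set k : coverSL2 | forall i j, inP 0 (sval k.1 i j)].

Definition cover_H : set coverSL2 :=
  [set g : coverSL2 | exists (a : F) (a0 : a != 0), g.1 = SL2_h a0].

Definition cover_Hd : set coverSL2 :=
  [set g : coverSL2 | exists (a : F) (a0 : a != 0),
     ((n %/ gcdn n 2)%:Z %| pf_v a)%Z /\ g.1 = SL2_h a0].

(** * Representations *)

(* A representation of a subgroup [A] of the cover is a function on the whole
   cover whose values outside [A] are irrelevant. *)
Section Rep.
Context (V : lmodType C).
Implicit Types (A : set coverSL2) (tau : coverSL2 -> V -> V).

Definition is_rep A tau : Prop :=
  [/\ forall g, A g -> forall (a : C) u v,
        tau g (a *: u + v) = a *: tau g u + tau g v,
      forall v, tau cone v = v &
      forall g g', A g -> A g' -> forall v,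
        tau (cmul g g') v = tau g (tau g' v)].

Definition genuine tau : Prop :=
  forall e v, tau (SL2_one, e) v = sval e *: v.

Definition fixed_by A tau (m : nat) : set V :=
  [set v | forall k, congrK m k -> A (sec k) -> tau (sec k) v = v].

Definition smooth A tau : Prop :=
  forall v, exists2 m, (0 < m)%N & fixed_by A tau m v.

Definition admissible A tau : Prop :=
  forall m, (0 < m)%N -> exists B : seq V, forall v, fixed_by A tau m v ->
    exists c : nat -> C, v = \sum_(i < size B) c i *: B`_i.

Definition irreducible A tau : Prop :=
  (exists v : V, v != 0) /\
  forall W : set V, W 0 -> (forall (a : C) u v, W u -> W v -> W (a *: u + v)) ->
    (forall g v, A g -> W v -> W (tau g v)) ->
    (forall v, W v -> v = 0) \/ (forall v, W v).

(* The space of the representation of [A] induced from the character [eta] of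
   [B]; its functions are extended by zero to the whole cover. *)
Definition ind_space A (B : set coverSL2) (eta : coverSL2 -> C) :
    set (coverSL2 -> C) :=
  [set f | [/\ forall g, ~ A g -> f g = 0,
               forall b g, B b -> A g -> f (cmul b g) = eta b * f g &
               exists2 m, (0 < m)%N & forall k g, congrK m k -> A (sec k) ->
                 A g -> f (cmul g (sec k)) = f g]].

Definition iso_to_ind A tau (B : set coverSL2) (eta : coverSL2 -> C) : Prop :=
  exists T : V -> coverSL2 -> C,
    [/\ forall (a : C) u v g, T (a *: u + v) g = a * T u g + T v g,
        injective T,
        range T = ind_space A B eta &
        forall g h v, A g -> A h -> T (tau h v) g = T v (cmul g h)].

Definition tau_w tau : coverSL2 -> V -> V :=
  fun h => tau (cmul (cmul (sec SL2_w) h) (cinv (sec SL2_w))).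

(** ** Normalized induction and intertwining operators *)

(* The factor [absF a] is the square root of the modulus character of the
   Borel subgroup, and [cpow (absF a) s] is the twist defining tau_s. *)
Definition in_I tau (s : C) (f : coverSL2 -> V) : Prop :=
  (forall (x a : F) (a0 : a != 0) (e : mu_n) g,
     f (cmul (cmul (sec (SL2_n x)) (SL2_h a0, e)) g) =
     ((absF R a)%:C%C * cpow (absF R a) s) *: tau (SL2_h a0, e) (f g)) /\
  exists2 m, (0 < m)%N &
    forall k g, congrK m k -> f (cmul g (sec k)) = f g.

Definition flat_section tau (phi : C -> coverSL2 -> V) : Prop :=
  (forall s, in_I tau s (phi s)) /\
  (forall s s' k, cover_K k -> phi s k = phi s' k).

Definition qs (s : C) : C := cpow q%:R (- s).

(* [v] is the value at [s] of the continuation, as a rational function of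
   q^(-s'), of the function sending [s'] to the integral of [Phi s'], which
   converges for Re s' large. The rational function is
   (\sum_i qs s' ^ i num_i) / den(qs s'). *)
Definition continuation_value (mu : {measure set (borelF F) -> \bar R})
    (Phi : C -> F -> V) (s : C) (v : V) : Prop :=
  exists (num : seq V) (den : {poly C}),
    let r s' := den.[qs s']^-1 *: (\sum_(i < size num) qs s' ^+ i *: num`_i) in
    [/\ exists s0 : R, forall s', s0 < complex.Re s' ->
          has_integral mu (Phi s') (r s'),
        den.[qs s] != 0 & v = r s].

(* The operator A_w(tau, s) on I(tau, s), for [w] a representative of the
   Weyl element: [f] is put in a flat section and the integral is continued
   in s.
   The value is [0] at the poles and for [f] outside I(tau, s). *)
Definition intertwining (mu : {measure set (borelF F) -> \bar R}) (w : SL2)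
    tau (s : C) (f : coverSL2 -> V) : coverSL2 -> V :=
  fun g => xget 0 [set v | exists phi,
    [/\ flat_section tau phi, phi s = f &
        continuation_value mu
          (fun s' x => phi s' (cmul (cmul (sec w) (sec (SL2_n x))) g)) s v]].

End Rep.

Definition chi_gen (dx : (F -> C) -> {measure set (borelF F) -> \bar R})
    (varpi : F) (psi chi : F -> C) : coverSL2 -> C :=
  fun g => let a := sval g.1 0 0 in sval g.2 * chi a * xi dx n varpi psi a.

(* tau is isomorphic to i(chi_{varpi, psi}) *)
Definition is_i_chi (dx : (F -> C) -> {measure set (borelF F) -> \bar R})
    (varpi : F) (psi chi : F -> C) (V : lmodType C)
    (tau : coverSL2 -> V -> V) : Prop :=
  iso_to_ind cover_H tau cover_Hd (chi_gen dx varpi psi chi).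

(* [P s] for all but finitely many values of q^-s *)
Definition almost_all_s (P : C -> Prop) : Prop :=
  exists S : seq C, forall s, qs s \notin S -> P s.

Definition rational_in_qs (f : C -> C) : Prop :=
  exists2 N : {poly C}, N != 0 & exists2 D : {poly C}, D != 0 &
    forall s, D.[qs s] != 0 -> f s = N.[qs s] / D.[qs s].

(* mu is the rational function with
   A_{w^-1}(tau^w, -s) o A_w(tau, s) = mu(tau, s)^-1 Id *)
Definition is_mu (meas : {measure set (borelF F) -> \bar R})
    (V : lmodType C) (tau : coverSL2 -> V -> V) (mu : C -> C) : Prop :=
  rational_in_qs mu /\
  almost_all_s (fun s => forall f, in_I tau s f -> forall g,
    intertwining meas (SL2_inv SL2_w) (tau_w tau) (- s)
      (intertwining meas SL2_w tau s f) g = (mu s)^-1 *: f g).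

End Cover.

Arguments cover_H R F n : clear implicits.
Arguments cover_Hd R F n : clear implicits.

(* Main.v *)
(* Since Hom(I(tau, s), I(tau, s)) is generically a line, mu(tau, s) is read off
   one section at one point. Let v0 in V be an eigenvector of the maximal abelian
   subgroup of the torus and f the section with value v0 at w supported on the
   matrices whose bottom row (c, d) satisfies v(c) <= v(d). Unfolding the cocycle,
   A_w f is again a section of this kind: on that support it is a shell integral
   over F of a function t |-> rho(t)^-1 v0 which, by the formula for the Hilbert symbol of a unit,
   transforms under units by chi0 omega^-i on the shells of valuation
   congruent to -i mod n, omega being the tame character. Hence at most one class
   of shells contributes, and only if chi0 = omega^i0 on units, that is if chi^n is
   unramified; the geometric series gives 1 / (1 - chi^n(varpi) q^(-ns)). The second
   integral is treated in the same way and yields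
     vol(O)^2 (q^-a + (1 - 1/q)^2 / ((1 - Y)(1 - 1/Y))),  Y = chi^n(varpi) q^(-ns),
   with a = 1, or vol(O)^2 q^-a with a = e(chi^n) in the ramified case. Finally
   vol(O)^2 = q^e(psi) for the self-dual measure. The Weil factor xi is trivial on
   n-th powers since the Weil index is unchanged under dilation by a square. *)

Require Import Defs.
From HB Require Import structures.
From mathcomp Require Import all_boot all_order all_algebra cyclic.
From mathcomp Require Import all_classical all_reals all_analysis measurable_realfun.
From mathcomp Require Import complex.
From mathcomp Require Import ring zify.

Set Implicit Arguments.
Unset Strict Implicit.
Unset Printing Implicit Defensive.

Import Order.TTheory GRing.Theory Num.Theory.
Import numFieldNormedType.Exports.

Local Open Scope classical_set_scope.
Local Open Scope ring_scope.

(** * Valuations and residues *)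

(** Three obstacles shape the proof. Integrals of vector-valued functions are tested on linear
    functionals, so a continued value is unique only if functionals separate the points of [V]; the
    evaluations f -> f(g) on the induced model provide enough of them. A value of [intertwining] is
    a choice over all flat sections and all rational continuations, so both must be shown unique
    before any value can be computed. Finally, that chi xi is a genuine character on the preimage of
    H_d, usually a property of the Weil index, is read off from a non-zero function in the space
    induced from it; for even [n] this also gives the non-vanishing of the Weil index. The sections
    carry a second vector near the identity because A_w of a section supported on the big cell is
    non-zero there: the integral is that of a character over a ball 1 + P^j, equal to the volume for
    j >= a and to zero otherwise. Hence the term q^-a, with a = 1 when chi^n is unramified. The
    passage from the conductor of chi xi to that of chi^n rests on 1 + P being pro-p and [n] prime
    to p. *)

Section Valuation.
Context (F : padicField).
Local Notation v := (@pf_v F).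
Implicit Types (x y a b : F) (m k : int).

Lemma pv1 : v 1 = 0.
Proof.
have := pf_valM (oner_neq0 F) (oner_neq0 F).
by rewrite mulr1 => /eqP; rewrite -subr_eq subrr eq_sym => /eqP.
Qed.

Lemma pvV x : x != 0 -> v x^-1 = - v x.
Proof.
move=> x0; have := pf_valM x0 (_ : x^-1 != 0).
by rewrite invr_eq0 divff // pv1 => /(_ x0)/esym/eqP; rewrite addrC addr_eq0 => /eqP.
Qed.

Lemma pvN x : v (- x) = v x.
Proof.
have [->|x0] := eqVneq x 0; first by rewrite oppr0.
have n1 : (-1 : F) != 0 by rewrite oppr_eq0 oner_eq0.
have v1 : v (-1) = 0.
  by have := pf_valM n1 n1; rewrite mulrNN mulr1 pv1; lia.
by rewrite -mulN1r pf_valM // v1 add0r.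
Qed.

Lemma pvX x (j : nat) : x != 0 -> v (x ^+ j) = v x *+ j.
Proof.
move=> x0; elim: j => [|j ih]; first by rewrite expr0 pv1.
by rewrite exprS pf_valM ?expf_neq0 // ih mulrS.
Qed.

Lemma pvXz x (j : int) : x != 0 -> v (x ^ j) = v x * j.
Proof.
move=> x0; case: j => j.
  by rewrite -exprnP pvX // -mulr_natr natz.
by rewrite NegzE -exprnN pvV ?expf_neq0 // pvX // mulrN -mulr_natr natz.
Qed.

Lemma pvM x y : x != 0 -> y != 0 -> v (x * y) = v x + v y.
Proof. exact: pf_valM. Qed.

Lemma inPE m x : x != 0 -> inP m x = (m <= v x).
Proof. by rewrite /in_ball => /negbTE ->. Qed.

Lemma inP0 m : inP m (0 : F).
Proof. by rewrite /in_ball eqxx. Qed.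

Lemma inPN m x : inP m (- x) = inP m x.
Proof. by rewrite /in_ball oppr_eq0 pvN. Qed.

Lemma inPD m x y : inP m x -> inP m y -> inP m (x + y).
Proof.
have [->|x0] := eqVneq x 0; first by rewrite add0r.
have [->|y0] := eqVneq y 0; first by rewrite addr0.
have [->|xy0] := eqVneq (x + y) 0; first by rewrite inP0.
rewrite !inPE // => hx hy; apply: le_trans (pf_valD x0 y0 xy0).
by rewrite le_min hx hy.
Qed.

Lemma inPB m x y : inP m x -> inP m y -> inP m (x - y).
Proof. by move=> hx hy; apply: inPD; rewrite ?inPN. Qed.

Lemma inPDl m x y : inP m x -> inP m (x + y) = inP m y.
Proof.
move=> hx; apply/idP/idP => [h|]; last exact: inPD.
by rewrite (_ : y = (x + y) - x) ?inPB // addrAC subrr add0r.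
Qed.

Lemma inPM m k x y : inP m x -> inP k y -> inP (m + k) (x * y).
Proof.
have [->|x0] := eqVneq x 0; first by rewrite mul0r !inP0.
have [->|y0] := eqVneq y 0; first by rewrite mulr0 !inP0.
by rewrite !inPE ?mulf_neq0 // pvM //; lia.
Qed.

Lemma inP_le m k x : k <= m -> inP m x -> inP k x.
Proof. by rewrite /in_ball => km /orP[->//|h]; rewrite (le_trans km) ?orbT. Qed.

Lemma inP_all0 x : (forall m, inP m x) -> x = 0.
Proof.
move=> h; apply/eqP/negP => /negP x0; have := h (v x + 1).
by rewrite inPE //; lia.
Qed.

Lemma inP_scale m a x : a != 0 -> inP (m + v a) (a * x) = inP m x.
Proof.
move=> a0; have [->|x0] := eqVneq x 0; first by rewrite mulr0 !inP0.
by rewrite !inPE ?mulf_neq0 // pvM //; lia.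
Qed.

Lemma inP_scale' m a x : a != 0 -> inP m (a * x) = inP (m - v a) x.
Proof. by move=> a0; rewrite -(inP_scale (m - v a) x a0) subrK. Qed.

Lemma inP1 : inP 0 (1 : F).
Proof. by rewrite inPE ?oner_eq0 // pv1. Qed.

Lemma pvD_lt x y : x != 0 -> inP (v x + 1) y -> x + y != 0 /\ v (x + y) = v x.
Proof.
move=> x0 hy.
have xy0 : x + y != 0.
  apply: contraTneq hy => /eqP; rewrite addr_eq0 => /eqP h.
  by rewrite inPE -1?oppr_eq0 -?h // -(pvN y) -h; lia.
split=> //; apply/eqP; rewrite eq_le; apply/andP; split.
  have : inP (v x + 1) (x - (x + y)) by rewrite opprD addrA subrr add0r inPN.
  apply: contraTT; rewrite -ltNge => h; apply/negP => h2.
  have h3 : inP (v x + 1) (x + y) by rewrite inPE //; lia.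
  by have := inPD h2 h3; rewrite subrK inPE //; lia.
have : inP (v x) (x + y).
  by apply: inPD; [rewrite inPE | apply: inP_le hy; lia].
by rewrite inPE.
Qed.

Lemma unit1P m x : 1 <= m -> inP m (x - 1) -> x != 0 /\ v x = 0.
Proof.
move=> m1 h; have := @pvD_lt 1 (x - 1) (oner_neq0 _).
by rewrite pv1 [1 + (x - 1)]addrC subrK; apply; apply: inP_le h.
Qed.

Lemma unit1M m x y : 0 <= m -> inP m (x - 1) -> inP m (y - 1) -> inP m (x * y - 1).
Proof.
move=> m0 hx hy; have -> : x * y - 1 = (x - 1) * (y - 1) + (x - 1) + (y - 1) by ring.
apply: inPD => //; apply: inPD => //.
by apply: inP_le (inPM hx hy); lia.
Qed.

Lemma unit1V m x : 1 <= m -> inP m (x - 1) -> inP m (x^-1 - 1).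
Proof.
move=> m1 h; have [x0 vx] := unit1P m1 h.
rewrite -(inP_scale _ _ x0) vx addr0 mulrBr divff // mulr1.
by rewrite -inPN opprB.
Qed.

Lemma unit1X m x j : 0 <= m -> inP m (x - 1) -> inP m (x ^+ j - 1).
Proof.
move=> m1 h; elim: j => [|j ih]; first by rewrite expr0 subrr inP0.
by rewrite exprS; apply: unit1M.
Qed.

Lemma unit1Xz m x j : 1 <= m -> inP m (x - 1) -> inP m (x ^ j - 1).
Proof.
move=> m1 h; have m0 : 0 <= m by lia.
case: j => j; first by apply: unit1X.
by rewrite NegzE -exprnN; apply: unit1V => //; apply: unit1X.
Qed.

Lemma inP_sum (I : Type) (r : seq I) (P : pred I) (f : I -> F) m :
  (forall i, P i -> inP m (f i)) -> inP m (\sum_(i <- r | P i) f i).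
Proof.
move=> h; elim/big_ind: _ => //; first exact: inP0.
by move=> x y hx hy; apply: inPD.
Qed.

Lemma inPX x j : inP 0 x -> inP 0 (x ^+ j).
Proof.
move=> h; elim: j => [|j ih]; first by rewrite expr0 inP1.
by rewrite exprS -[0]addr0; apply: inPM.
Qed.

Lemma inP0_nat j : inP 0 (j%:R : F).
Proof.
elim: j => [|j ih]; first exact: inP0.
by rewrite -addn1 natrD inPD // inP1.
Qed.

(** Primality of the maximal ideal. In [omega_ex] it selects, from the factorisation of X^n - 1, the
    root of unity congruent to a given element. *)
Lemma prod_in_P (s : seq F) : all (inP 0) s -> inP 1 (\prod_(x <- s) x) ->
  has (inP 1) s.
Proof.
elim: s => [_|x s ih /= /andP[hx hs]].
  by rewrite big_nil inPE ?oner_eq0 // pv1.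
rewrite big_cons => h; case hx1: (inP 1 x) => //=; apply: ih => //.
have [x0|x0] := eqVneq x 0; first by rewrite x0 inP0 in hx1.
move: hx hx1; rewrite !(inPE _ x0) => hx hx1.
have vx : v x = 0 by lia.
by move: h; rewrite (inP_scale' _ _ x0) vx subr0.
Qed.

End Valuation.

(** * The residue field: Fermat, Teichmuller representatives, roots of unity *)

Section Residue.
Context (F : padicField).
Local Notation v := (@pf_v F).
Local Notation q := (res_card F).
Implicit Types (x y a b : F) (m k : int).

Lemma res_reps : exists rep : 'I_q -> F,
  [/\ forall i, inP 0 (rep i),
      forall x, inP 0 x -> exists i, inP 1 (x - rep i) &
      forall i j, inP 1 (rep i - rep j) -> i = j].
Proof.
have [r [sr r0 rc]] := pf_res_card F.
exists (fun i => r`_i); split.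
- by move=> i; apply: (allP r0); rewrite mem_nth // sr.
- move=> x /rc rx.
  have : has (fun y => inP 1 (x - y)) r by rewrite has_count rx.
  case/(has_nthP 0) => i; rewrite sr => iq h.
  by exists (Ordinal iq).
- move=> i j hij.
  have ri : inP 0 (r`_i) by apply: (allP r0); rewrite mem_nth // sr.
  have := rc _ ri; rewrite -sum1_count (big_nth 0) big_mkord sr sum1_card => h.
  have /card_le1_eqP : (#|[pred k : 'I_q | inP 1 (r`_i - r`_k)]| <= 1)%N by rewrite -h.
  by apply; rewrite inE ?subrr ?inP0.
Qed.

Lemma inPM0 x y : inP 0 x -> inP 0 y -> inP 0 (x * y).
Proof. by move=> hx hy; rewrite -[0]addr0; apply: inPM. Qed.

Lemma inP_cong_prod (I : Type) (s : seq I) (P : pred I) (f g : I -> F) :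
  (forall i, P i -> inP 0 (f i)) -> (forall i, P i -> inP 0 (g i)) ->
  (forall i, P i -> inP 1 (f i - g i)) ->
  inP 1 (\prod_(i <- s | P i) f i - \prod_(i <- s | P i) g i).
Proof.
move=> hf hg hfg.
suff : [/\ inP 0 (\prod_(i <- s | P i) f i), inP 0 (\prod_(i <- s | P i) g i) &
  inP 1 (\prod_(i <- s | P i) f i - \prod_(i <- s | P i) g i)] by case.
elim/big_ind2: _ => [|x' x y' y [hx hy hxy] [hx' hy' hxy']|i Pi].
- by rewrite subrr inP0 inP1.
- split; [by apply: inPM0|by apply: inPM0|].
  have -> : x * y - x' * y' = (x - x') * y + x' * (y - y') by ring.
  apply: inPD; first by rewrite -[1]addr0; apply: inPM.
  by rewrite -[1]add0r; apply: inPM.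
- by split; [exact: hf|exact: hg|exact: hfg].
Qed.

Lemma inP_bigprod (I : Type) (s : seq I) (P : pred I) (f : I -> F) :
  (forall i, inP 0 (f i)) -> inP 0 (\prod_(i <- s | P i) f i).
Proof.
move=> h; elim/big_ind: _ => //; first exact: inP1.
exact: inPM0.
Qed.

Lemma unit_in_O x : x != 0 -> v x = 0 -> inP 0 x.
Proof. by move=> x0 vx; rewrite inPE // vx. Qed.

Lemma unit_notin_P x : x != 0 -> v x = 0 -> ~~ inP 1 x.
Proof. by move=> x0 vx; rewrite inPE // vx. Qed.

Lemma unitP x : inP 0 x -> ~~ inP 1 x -> x != 0 /\ v x = 0.
Proof.
have [->|x0] := eqVneq x 0; first by rewrite !inP0.
by rewrite !inPE //; lia.
Qed.

Lemma inP_divl x y m : x != 0 -> v x = 0 -> inP m (x * y) = inP m y.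
Proof. by move=> x0 vx; rewrite inP_scale' // vx subr0. Qed.

(** A map of the integers into themselves that is injective modulo the maximal ideal permutes the
    finite residue system. Translation by 1 and multiplication by a unit are the two maps used. *)
Lemma res_reindex (rep : 'I_q -> F) (g : F -> F) :
  (forall x, inP 0 x -> exists i, inP 1 (x - rep i)) ->
  (forall i j, inP 1 (rep i - rep j) -> i = j) ->
  (forall i, inP 0 (g (rep i))) ->
  (forall i j, inP 1 (g (rep i) - g (rep j)) -> inP 1 (rep i - rep j)) ->
  exists2 s : 'I_q -> 'I_q, injective s & forall i, inP 1 (g (rep i) - rep (s i)).
Proof.
move=> ex inj hg ginj.
have /choice [s hs] : forall i, exists j, inP 1 (g (rep i) - rep j).
  by move=> i; apply: ex.
exists s => // i j sij; apply: inj; apply: ginj.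
have -> : g (rep i) - g (rep j) = (g (rep i) - rep (s i)) - (g (rep j) - rep (s j)).
  by rewrite sij; ring.
exact: inPB.
Qed.

(** Translation by 1 permutes the residue classes, so summing x + 1 and x over them gives the same
    class; the difference is q. *)
Lemma q_in_P : inP 1 (q%:R : F).
Proof.
have [rep [r0 ex inj]] := res_reps.
have [|i j|s sinj hs] := @res_reindex rep (fun x => x + 1) ex inj.
- by move=> i; apply: inPD => //; apply: inP1.
- by rewrite (_ : rep i + 1 - (rep j + 1) = rep i - rep j) //; ring.
have h : inP 1 (\sum_i (rep i + 1 - rep (s i))) by apply: inP_sum.
have e : \sum_i rep i = \sum_i rep (s i) by rewrite (reindex_inj sinj).
move: h; rewrite sumrB big_split /= e.
by rewrite addrAC subrr add0r sumr_const card_ord.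
Qed.

Lemma q_gt1 : (1 < q)%N.
Proof.
have [rep [r0 ex inj]] := res_reps.
have [i hi] := ex 0 (inP0 _ _); have [j hj] := ex 1 (inP1 _).
have : i != j.
  apply: contraTneq (unit_notin_P (oner_neq0 F) (pv1 F)) => ij.
  rewrite negbK; have -> : (1 : F) = (1 - rep j) - (0 - rep i) by rewrite ij; ring.
  exact: inPB.
by case: i j {hi hj} => i hi [j hj]; rewrite -val_eqE /=; lia.
Qed.

(** Multiplication by [x] permutes the non-zero residues; cancelling their product leaves
    x^(q-1). *)
Lemma fermat x : x != 0 -> v x = 0 -> inP 1 (x ^+ (q - 1) - 1).
Proof.
move=> x0 vx; have [rep [r0 ex inj]] := res_reps.
have [i|i j|s sinj hs] := @res_reindex rep (fun y => x * y) ex inj.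
- by rewrite inP_divl.
- by rewrite -mulrBr inP_divl.
have [i0 hi0] := ex 0 (inP0 _ _); rewrite sub0r inPN in hi0.
have i0P i : inP 1 (rep i) -> i = i0.
  by move=> h; apply: inj; apply: inPB.
(* The zero class is fixed by the permutation, so the product may be restricted to the other q - 1
   classes. *)
have si0 i : (s i == i0) = (i == i0).
  have s0 : s i0 = i0.
    apply: i0P; rewrite (_ : rep _ = x * rep i0 - (x * rep i0 - rep (s i0))); last by ring.
    by rewrite inPB // inP_divl.
  by rewrite -{1}s0 (inj_eq sinj).
have hp : inP 1 (\prod_(i | i != i0) (x * rep i) - \prod_(i | i != i0) rep (s i)).
  by apply: inP_cong_prod => // i _; rewrite ?inP_divl.
rewrite big_split /= prodr_const cardC1 card_ord in hp.
have e : \prod_(i | i != i0) rep (s i) = \prod_(i | i != i0) rep i.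
  rewrite [RHS](reindex_inj sinj) /=; apply: eq_bigl => i.
  by rewrite si0.
rewrite e -[X in _ - X]mul1r -mulrBl mulrC in hp.
have [p0 vp] : \prod_(i | i != i0) rep i != 0 /\ v (\prod_(i | i != i0) rep i) = 0.
  elim/big_ind: _ => [|a b [a0 va] [b0 vb]|i ii0].
  - by rewrite oner_neq0 pv1.
  - by rewrite mulf_neq0 // pvM // va vb.
  - by apply: unitP => //; apply: contra ii0 => /i0P ->.
by rewrite inP_divl // -subn1 in hp.
Qed.

Lemma inP_subX m x y j : inP 0 x -> inP 0 y -> inP m (x - y) ->
  inP m (x ^+ j - y ^+ j).
Proof.
move=> hx hy h; rewrite subrXX -[m]addr0; apply: inPM => //.
apply: inP_sum => i _; apply: inPM0; exact: inPX.
Qed.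

(** The cofactor of x - y in x^q - y^q is congruent to q y^(q-1), and q lies in the maximal ideal:
    taking q-th powers gains one digit. *)
Lemma inP_subXq m x y : inP 0 x -> inP 0 y -> 1 <= m -> inP m (x - y) ->
  inP (m + 1) (x ^+ q - y ^+ q).
Proof.
move=> hx hy m1 h; rewrite subrXX; apply: inPM => //.
have h1 : inP 1 (x - y) by apply: inP_le h.
have : inP 1 (\sum_(i < q) (x ^+ (q.-1 - i) * y ^+ i - y ^+ q.-1)).
  apply: inP_sum => i _.
  have -> : y ^+ q.-1 = y ^+ (q.-1 - i) * y ^+ i.
    by rewrite -exprD subnK //; case: i => i /=; lia.
  rewrite -mulrBl -[1]addr0; apply: inPM; last exact: inPX.
  exact: inP_subX.
rewrite sumrB sumr_const card_ord -mulr_natr.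
have hq : inP 1 (y ^+ q.-1 * q%:R).
  by rewrite -[1]add0r; apply: inPM; [exact: inPX|exact: q_in_P].
by move=> h2; rewrite -(subrK (y ^+ q.-1 * q%:R) (\sum_(i < q) _)) inPD.
Qed.

(** The representative is the limit of x^(q^i): [inP_subXq] makes the sequence Cauchy, and its limit
    is fixed by the q-th power map. *)
Lemma teichmuller x : inP 0 x -> exists l, l ^+ q = l /\ inP 1 (l - x).
Proof.
move=> hx.
have fx : inP 1 (x ^+ q - x).
  have qE : q = (q - 1).+1 by have := q_gt1; lia.
  have [x1|x1] := boolP (inP 1 x).
    rewrite inPB // qE exprS -[1]addr0; apply: inPM => //; exact: inPX.
  have [x0 vx] := unitP hx x1.
  have := fermat x0 vx; rewrite {2}qE exprS -[X in _ -> inP 1 (_ - X)]mulr1 -mulrBr.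
  by rewrite inP_divl.
pose t i := x ^+ (q ^ i).
have tO i : inP 0 (t i) by apply: inPX.
have tS i : t i.+1 = t i ^+ q by rewrite /t expnSr exprM.
have t1 i : inP (i.+1)%:Z (t i.+1 - t i).
  elim: i => [|i ih]; first by rewrite tS /t expn0 expr1.
  by rewrite tS {2}tS (_ : i.+2%:Z = i.+1%:Z + 1); [apply: inP_subXq|lia].
have t2 i j : inP (i.+1)%:Z (t (i + j)%N - t i).
  elim: j => [|j ih]; first by rewrite addn0 subrr inP0.
  have -> : t (i + j.+1)%N - t i = (t (i + j).+1 - t (i + j)%N) + (t (i + j)%N - t i).
    by rewrite addnS; ring.
  by apply: inPD => //; apply: inP_le (t1 _); lia.
have [l hl] : exists l, forall m, exists N, forall i, (N <= i)%N -> inP m (t i - l).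
  apply: pf_complete => m; exists `|m|%N => i j hi hj.
  have -> : t i - t j = (t i - t `|m|%N) - (t j - t `|m|%N) by ring.
  apply: inPB; [rewrite -(subnKC hi)|rewrite -(subnKC hj)]; apply: inP_le (t2 _ _); lia.
have [N1 hN1] := hl 1.
have l1 : inP 1 (l - x).
  have -> : l - x = (t (0 + N1)%N - t 0%N) - (t N1 - l).
    by rewrite {2}/t expn0 expr1 add0n; ring.
  by apply: inPB; [apply: t2|apply: hN1].
have lO : inP 0 l.
  rewrite (_ : l = l - x + x); last by ring.
  by apply: inPD => //; apply: inP_le l1.
exists l; split=> //; apply/eqP; rewrite -subr_eq0; apply/eqP; apply: inP_all0 => m.
have [N hN] := hl m; rewrite (_ : _ - _ = (t N.+1 - l) - (t N ^+ q - l ^+ q)); last first.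
  by rewrite tS; ring.
by apply: inPB; [apply: hN; lia|apply: inP_subX => //; exact: hN].
Qed.

Lemma root1_val N (z : F) : (0 < N)%N -> z ^+ N = 1 -> z != 0 /\ v z = 0.
Proof.
move=> N0 zN.
have z0 : z != 0.
  by apply/eqP => z0; move/eqP: zN; rewrite z0 expr0n gtn_eqF // eq_sym oner_eq0.
split=> //.
have : v (z ^+ N) = 0 by rewrite zN pv1.
by rewrite pvX // => /eqP; rewrite mulrn_eq0 gtn_eqF //= => /eqP.
Qed.

Lemma prod_1_sub_prim_root (K : fieldType) N (z : K) : N.-primitive_root z ->
  \prod_(1 <= i < N) (1 - z ^+ i) = N%:R.
Proof.
move=> zN; have N0 := prim_order_gt0 zN.
have e0 : 'X^N - 1 = ('X - 1%:P) * \sum_(i < N) 'X^i :> {poly K}.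
  by rewrite -subrX1.
have := factor_Xn_sub_1 zN; rewrite e0 big_ltn // expr0.
move/(mulfI (negbT (polyXsubC_eq0 1))) => /(congr1 (horner^~ 1)).
rewrite horner_prod horner_sum.
under eq_bigr => i _ do rewrite hornerXsubC.
move=> ->; under eq_bigr => i _ do rewrite hornerXn expr1n.
by rewrite sumr_const card_ord.
Qed.

(** The product of the 1 - z^i for 0 < i < N is [N]. When [N] is a unit no factor lies in the
    maximal ideal, so reduction is injective on these roots of unity. *)
Lemma prim_root_cong N (z : F) : N.-primitive_root z -> ~~ inP 1 (N%:R : F) ->
  forall i j, inP 1 (z ^+ i - z ^+ j) -> z ^+ i = z ^+ j.
Proof.
move=> zN uN; have N0 := prim_order_gt0 zN.
have [z0 vz] := root1_val N0 (prim_expr_order zN).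
have zX i : z ^+ i != 0 /\ v (z ^+ i) = 0 by rewrite expf_neq0 // pvX // vz mul0rn.
have key i : (i < N)%N -> inP 1 (1 - z ^+ i) -> i = 0%N.
  case: i => // i iN h; case/negP: uN.
  rewrite -(prod_1_sub_prim_root zN) (big_cat_nat (n := i.+1)) //=; last by lia.
  rewrite (big_ltn iN) /= mulrCA -[1]addr0; apply: inPM => //.
  by apply: inPM0; apply: inP_bigprod => k; apply: inPB; rewrite ?inP1 // unit_in_O //; case: (zX k).
have key2 i j : (i <= j)%N -> inP 1 (z ^+ i - z ^+ j) -> z ^+ i = z ^+ j.
  move=> ij; rewrite -(subnKC ij) exprD -{1 3}[z ^+ i]mulr1 -mulrBr inP_divl; try by case: (zX i).
  rewrite -(prim_expr_mod zN (j - i)) => h.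
  by rewrite (key _ _ h) ?ltn_mod // expr0.
move=> i j; case: (leqP i j) => [|/ltnW] ij; first exact: key2.
by rewrite -inPN opprB => /(key2 _ _ ij).
Qed.

(** The non-zero Teichmuller representatives are q - 1 distinct roots of X^(q-1) - 1 in a field, so
    one of them is primitive, and its powers meet every unit class. *)
Lemma res_gen : exists2 g : F, (q - 1).-primitive_root g &
  forall x, x != 0 -> v x = 0 -> exists i, inP 1 (x - g ^+ i).
Proof.
have [rep [r0 ex inj]] := res_reps.
have q1 := q_gt1.
have /choice [t ht] : forall i, exists l, l ^+ q = l /\ inP 1 (l - rep i).
  by move=> i; apply: teichmuller.
have [i0 hi0] := ex 0 (inP0 _ _); rewrite sub0r inPN in hi0.
have i0P i : inP 1 (rep i) -> i = i0.
  by move=> h; apply: inj; apply: inPB.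
have tinj : injective t.
  move=> i j tij; apply: inj.
  rewrite (_ : _ - _ = (t j - rep j) - (t i - rep i)); last by rewrite tij; ring.
  by apply: inPB; [case: (ht j)|case: (ht i)].
pose rs := [seq t i | i <- enum 'I_q & i != i0].
have troot i : i != i0 -> t i ^+ (q - 1) = 1.
  move=> ii0; have [tq t1] := ht i.
  have t0 : t i != 0.
    apply: contra ii0 => /eqP t0; apply/eqP; apply: i0P.
    by move: t1; rewrite t0 sub0r inPN.
  by apply: (mulfI t0); rewrite -exprS mulr1 (_ : (q - 1).+1 = q) //; lia.
have /hasP [g _ gp] : has (q - 1).-primitive_root rs.
  apply: has_prim_root; first by lia.
  - apply/allP => x /mapP [j]; rewrite mem_filter => /andP[ii0 _] ->.
    by apply/unity_rootP/troot.
  - by rewrite map_inj_uniq // filter_uniq // enum_uniq.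
  - rewrite size_map size_filter -sum1_count big_enum_cond /= sum1_card.
    by rewrite (eq_card (B := predC1 i0)) ?cardC1 ?card_ord ?subn1 // => i; rewrite !inE.
exists g => // x x0 vx.
have [i hi] := ex x (unit_in_O x0 vx).
have ii0 : i != i0.
  apply: contra (unit_notin_P x0 vx) => /eqP ii0.
  by rewrite -(subrK (rep i) x) inPD // ii0.
have [j hj] := prim_rootP gp (troot i ii0).
exists j; rewrite -hj (_ : _ - _ = (x - rep i) - (t i - rep i)); last by ring.
by apply: inPB => //; case: (ht i).
Qed.

Lemma res_char_coprime_unit N : coprime (res_char F) N -> ~~ inP 1 (N%:R : F).
Proof.
move=> cop; have p0 : (0 < res_char F)%N by rewrite prime_gt0 // pf_res_char_prime.
have pP : inP 1 ((res_char F)%:R : F).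
  have := pf_res_char F; rewrite /in_ball => h; apply/orP; right; lia.
apply/negP => NP.
case: (egcdnP N p0) => a b e _.
rewrite (eqP cop) in e.
have : (a * res_char F)%:R = (b * N + 1)%:R :> F by rewrite e.
rewrite natrD !natrM => e1.
have : inP 1 (1 : F).
  rewrite (_ : (1 : F) = a%:R * (res_char F)%:R - b%:R * N%:R); last by rewrite e1; ring.
  by apply: inPB; rewrite -[1]add0r; apply: inPM => //; apply: inP0_nat.
by rewrite inPE ?oner_eq0 // pv1.
Qed.

End Residue.

(** * The tame Hilbert symbol *)

Section Hilbert.
Context (R : realType) (F : padicField) (n : nat) (iota : root_ident R F n).
Hypotheses (hn : (0 < n)%N) (hpn : coprime (res_char F) n).
Local Notation C := R[i].
Local Notation v := (@pf_v F).
Local Notation q := (res_card F).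
Local Notation zF := (rootF iota).
Local Notation zC := (Defs.rootC iota).
Implicit Types (x y a b : F) (m : int).

Local Lemma zFp : n.-primitive_root zF. Proof. exact: rootF_prim. Qed.
Local Lemma zCp : n.-primitive_root zC. Proof. exact: Defs.rootC_prim. Qed.

Lemma zF_cong i j : inP 1 (zF ^+ i - zF ^+ j) -> zF ^+ i = zF ^+ j.
Proof. exact: (prim_root_cong zFp (res_char_coprime_unit hpn)). Qed.

Lemma zFC i j : zF ^+ i = zF ^+ j -> zC ^+ i = zC ^+ j.
Proof.
move/eqP; rewrite (eq_prim_root_expr zFp) => h; apply/eqP.
by rewrite (eq_prim_root_expr zCp).
Qed.

Lemma zF_val : zF != 0 /\ v zF = 0.
Proof. exact: root1_val hn (prim_expr_order zFp). Qed.

(** Fermat makes z^(q-1) congruent to 1 for the primitive root z; congruent [n]-th roots of unity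
    are equal, so the order [n] divides q - 1. *)
Lemma n_dvd_q1 : (n %| q - 1)%N.
Proof.
have [z0 vz] := zF_val.
rewrite (prim_order_dvd zFp) -[1](expr0 zF); apply/eqP; apply: zF_cong.
by rewrite expr0; apply: fermat.
Qed.

Local Notation N := ((q - 1) %/ n)%N.

(* The tame character: the n-th root of unity congruent to [x ^+ ((q - 1) / n)],
   so that the Hilbert symbol is [omega] of the tame symbol. *)
Definition omega (x : F) : C :=
  sval (if [pick k : 'I_n | inP 1 (zF ^+ k - x ^+ N)] is Some k
        then root_pow iota k else root_pow iota 0).

(** With y = x^((q-1)/n), the product of the y - z^k over k < n is y^n - 1 = x^(q-1) - 1, which lies
    in the maximal ideal. *)
Lemma omega_ex x : x != 0 -> v x = 0 -> exists k : nat, inP 1 (zF ^+ k - x ^+ N).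
Proof.
move=> x0 vx; have := fermat x0 vx.
rewrite -{1}(divnK n_dvd_q1) exprM.
have /(congr1 (horner^~ (x ^+ N))) := factor_Xn_sub_1 zFp.
rewrite horner_prod !hornerE => <-.
under eq_bigr => i _ do rewrite hornerXsubC.
move=> h; have /hasP[y] : has (inP 1) [seq x ^+ N - zF ^+ k | k <- index_iota 0 n].
  apply: prod_in_P; last by rewrite big_map.
  apply/allP => y /mapP [j _ ->]; have [z0 vz] := zF_val.
  by apply: inPB; apply: inPX; apply: unit_in_O.
by case/mapP => j _ -> hj; exists j; rewrite -inPN opprB.
Qed.

Lemma omegaE x (k : nat) : inP 1 (zF ^+ k - x ^+ N) -> omega x = zC ^+ k.
Proof.
move=> h; rewrite /omega; case: pickP => [j hj|no] /=.
  apply: zFC; apply: zF_cong.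
  rewrite (_ : _ - _ = (zF ^+ j - x ^+ N) - (zF ^+ k - x ^+ N)); last by ring.
  exact: inPB.
have := no (Ordinal (ltn_pmod k hn)); rewrite /= (prim_expr_mod zFp).
by rewrite h.
Qed.

Lemma omegaM x y : x != 0 -> v x = 0 -> y != 0 -> v y = 0 ->
  omega (x * y) = omega x * omega y.
Proof.
move=> x0 vx y0 vy; have [k hk] := omega_ex x0 vx; have [j hj] := omega_ex y0 vy.
rewrite (omegaE hk) (omegaE hj) -exprD; apply: omegaE.
rewrite exprD exprMn.
have -> : zF ^+ k * zF ^+ j - x ^+ N * y ^+ N =
  (zF ^+ k - x ^+ N) * zF ^+ j + x ^+ N * (zF ^+ j - y ^+ N) by ring.
have [z0 vz] := zF_val.
apply: inPD; first by rewrite -[1]addr0; apply: inPM => //; apply/inPX/unit_in_O.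
by rewrite -[1]add0r; apply: inPM => //; apply/inPX/unit_in_O.
Qed.

Lemma omega_unit1 x : inP 1 (x - 1) -> omega x = 1.
Proof.
move=> h; rewrite -(expr0 zC); apply: omegaE.
by rewrite expr0 -inPN opprB; apply: unit1X.
Qed.

Lemma omega1 : omega 1 = 1.
Proof. by apply: omega_unit1; rewrite subrr inP0. Qed.

Lemma omegan x : omega x ^+ n = 1.
Proof. by rewrite /omega; case: pickP => [j hj|no] /=; rewrite exprAC (prim_expr_order zCp) expr1n. Qed.

Lemma omega_neq0 x : omega x != 0.
Proof.
apply: contra_eq_neq (omegan x) => ->; rewrite expr0n gtn_eqF // eq_sym; exact: oner_neq0.
Qed.

(** If g generates the residue units then g^((q-1)/n) is a primitive [n]-th root of unity. A single
    unit therefore separates all the powers of [omega]. *)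
Lemma omega_gen : exists g : F, [/\ g != 0, v g = 0, n.-primitive_root (omega g) &
  forall x, x != 0 -> v x = 0 -> exists i, inP 1 (x - g ^+ i)].
Proof.
have [g gp hg] := res_gen F; have q1 := q_gt1 F.
have q0 : (0 < q - 1)%N by lia.
have [g0 vg] := root1_val q0 (prim_expr_order gp).
exists g; split=> //.
have gNp : n.-primitive_root (g ^+ N).
  have := dvdn_prim_root gp (_ : (n %| q - 1)%N); rewrite n_dvd_q1 => /(_ isT).
  by [].
have [k hk] := prim_rootP zFp (prim_expr_order gNp).
have -> : omega g = zC ^+ k by apply: omegaE; rewrite hk subrr inP0.
by rewrite (prim_root_exp_coprime _ zCp) -(prim_root_exp_coprime _ zFp) -hk.
Qed.

Definition tame a b : F := (-1) ^ (v a * v b) * a ^ (v b) * b ^ (- v a).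

Definition hil a b : C := sval (hilbert iota a b).

Lemma hilE a b : hil a b = omega (tame a b).
Proof. by []. Qed.

Lemma tame_unit a b : a != 0 -> b != 0 -> tame a b != 0 /\ v (tame a b) = 0.
Proof.
move=> a0 b0; have n1 : (-1 : F) != 0 by rewrite oppr_eq0 oner_eq0.
rewrite /tame !mulf_neq0 ?expfz_neq0 //; split=> //.
rewrite !pvM ?mulf_neq0 ?expfz_neq0 // !pvXz // pvN pv1.
by lia.
Qed.

Lemma tameMl a a' b : a != 0 -> a' != 0 -> b != 0 ->
  tame (a * a') b = tame a b * tame a' b.
Proof.
move=> a0 a'0 b0; have n1 : (-1 : F) != 0 by rewrite oppr_eq0 oner_eq0.
rewrite /tame pvM // mulrDl opprD !expfzDr // expfzMl; ring.
Qed.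

Lemma tameMr a b b' : a != 0 -> b != 0 -> b' != 0 ->
  tame a (b * b') = tame a b * tame a b'.
Proof.
move=> a0 b0 b'0; have n1 : (-1 : F) != 0 by rewrite oppr_eq0 oner_eq0.
rewrite /tame pvM // mulrDr !expfzDr // expfzMl; ring.
Qed.

Lemma hilMl a a' b : a != 0 -> a' != 0 -> b != 0 ->
  hil (a * a') b = hil a b * hil a' b.
Proof.
move=> a0 a'0 b0; rewrite !hilE tameMl //.
have [? ?] := tame_unit a0 b0; have [? ?] := tame_unit a'0 b0; exact: omegaM.
Qed.

Lemma hilMr a b b' : a != 0 -> b != 0 -> b' != 0 ->
  hil a (b * b') = hil a b * hil a b'.
Proof.
move=> a0 b0 b'0; rewrite !hilE tameMr //.
have [? ?] := tame_unit a0 b0; have [? ?] := tame_unit a0 b'0; exact: omegaM.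
Qed.

Lemma hil_neq0 a b : hil a b != 0.
Proof. exact: omega_neq0. Qed.

Lemma hiln a b : hil a b ^+ n = 1.
Proof. exact: omegan. Qed.

Lemma hil1l b : b != 0 -> hil 1 b = 1.
Proof.
move=> b0; apply: (mulfI (hil_neq0 1 b)).
by rewrite -hilMl ?oner_neq0 // !mulr1.
Qed.

Lemma hil1r a : a != 0 -> hil a 1 = 1.
Proof.
move=> b0; apply: (mulfI (hil_neq0 a 1)).
by rewrite -hilMr ?oner_neq0 // !mulr1.
Qed.

Lemma hilVl a b : a != 0 -> b != 0 -> hil a^-1 b = (hil a b)^-1.
Proof.
move=> a0 b0; apply: (mulfI (hil_neq0 a b)).
by rewrite -hilMl ?invr_eq0 // !divff ?hil_neq0 // hil1l.
Qed.

Lemma hilVr a b : a != 0 -> b != 0 -> hil a b^-1 = (hil a b)^-1.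
Proof.
move=> a0 b0; apply: (mulfI (hil_neq0 a b)).
by rewrite -hilMr ?invr_eq0 // !divff ?hil_neq0 // hil1r.
Qed.

Lemma hilC a b : a != 0 -> b != 0 -> hil a b = (hil b a)^-1.
Proof.
move=> a0 b0; apply: (mulIf (hil_neq0 b a)); rewrite mulVf ?hil_neq0 // !hilE.
have [? ?] := tame_unit a0 b0; have [? ?] := tame_unit b0 a0; rewrite -omegaM //.
rewrite (_ : tame a b * tame b a = 1) ?omega1 // /tame (mulrC (v b)).
rewrite -!invr_expz.
have h : ((-1) ^ (v a * v b)) * ((-1) ^ (v a * v b)) = 1 :> F.
  by rewrite -expfzMl mulrNN mulr1 exp1rz.
have ha := expfz_neq0 (v b) a0; have hb := expfz_neq0 (v a) b0.
transitivity (((-1) ^ (v a * v b)) * ((-1) ^ (v a * v b)) * (a ^ v b / a ^ v b)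
  * (b ^ v a / b ^ v a)); first by ring.
by rewrite h !divff // !mulr1.
Qed.

Lemma hilN a : a != 0 -> hil a (- a) = 1.
Proof.
move=> a0; rewrite hilE (_ : tame _ _ = 1) ?omega1 // /tame pvN.
have n1 : (-1 : F) != 0 by rewrite oppr_eq0 oner_eq0.
rewrite -[- a]mulN1r expfzMl -[RHS](expr0z (-1 : F)).
have e : (-1) ^ (v a * v a) * (-1) ^ (- v a) = 1 :> F.
  rewrite -expfzDr //.
  (* The sign left over is (-1)^(v(a)^2 - v(a)), whose exponent is even. *)
  have : exists k, v a * v a - v a = k + k.
    have [m [hm|hm]] : exists m, v a = m * 2 \/ v a = m * 2 + 1.
      have := divz_eq (v a) 2; have := modz_ge0 (v a) (_ : 2 != 0 :> int).
      have := ltz_mod (v a) (_ : 2 != 0 :> int) => /(_ isT) h1 /(_ isT) h2 h3.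
      by exists (v a %/ 2)%Z; lia.
    by exists (m * 2 * m - m); rewrite hm; ring.
    by exists ((m * 2 + 1) * m); rewrite hm; ring.
  by case=> k ->; rewrite expfzDr // -expfzMl mulrNN mulr1 exp1rz.
by rewrite expr0z mulrACA e mul1r -expfzDr // subrr expr0z.
Qed.

Lemma hil_self a : a != 0 -> hil a a = hil a (-1).
Proof.
move=> a0; have n1 : (-1 : F) != 0 by rewrite oppr_eq0 oner_eq0.
have := hilN a0; rewrite -[- a]mulN1r (hilMr a0 n1 a0) => h.
have h2 : hil a (-1) * hil a (-1) = 1 by rewrite -(hilMr a0 n1 n1) mulrNN mulr1 hil1r.
by apply: (mulfI (hil_neq0 a (-1))); rewrite h h2.
Qed.

Lemma hil_unit1l a b : inP 1 (a - 1) -> hil a b = 1.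
Proof.
move=> h; have [a0 va] := unit1P (lexx 1) h.
rewrite hilE /tame va mul0r oppr0 !expr0z mul1r mulr1; apply: omega_unit1.
exact: unit1Xz.
Qed.

Lemma hil_unit1r a b : inP 1 (b - 1) -> hil a b = 1.
Proof.
move=> h; have [b0 vb] := unit1P (lexx 1) h.
rewrite hilE /tame vb mulr0 !expr0z !mul1r; apply: omega_unit1.
exact: unit1Xz.
Qed.

Lemma hil_units a b : v a = 0 -> v b = 0 -> hil a b = 1.
Proof. by move=> va vb; rewrite hilE /tame va vb oppr0 !expr0z !mulr1 omega1. Qed.

(** If v(a) > 0 then 1 - a is a 1-unit; if v(a) < 0 then 1 - a = -a (1 - 1/a), where the second
    factor is a 1-unit; if v(a) = 0, either [a] is a 1-unit or both arguments are units. The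
    relation supplies the cocycle identity in [secG_smooth]. *)
Lemma hil_steinberg a : a != 0 -> 1 - a != 0 -> hil (1 - a) a = 1.
Proof.
move=> a0 b0; have n1 : (-1 : F) != 0 by rewrite oppr_eq0 oner_eq0.
have [va|va|va] := ltgtP (v a) 0; last 1 first.
- have [h|h] := boolP (inP 1 (1 - a)).
    by apply: hil_unit1r; rewrite -inPN opprB.
  apply: hil_units => //; apply: (unitP _ h).2.
  by apply: inPB; [exact: inP1|exact: unit_in_O].
- have e : 1 - a = (- a) * (1 - a^-1) by rewrite mulrBr mulNr mulNr divff // mulr1; ring.
  have h : inP 1 ((1 - a^-1) - 1).
    by rewrite addrAC subrr add0r inPN inPE ?invr_eq0 // pvV //; lia.
  have [c0 _] := unit1P (lexx _) h.
  rewrite e hilMl // ?oppr_eq0 // (hil_unit1l _ h) mulr1.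
  by rewrite -{2}[a]opprK hilN // oppr_eq0.
- apply: hil_unit1l; rewrite addrAC subrr add0r inPN inPE //; lia.
Qed.

Lemma hil_cong_l a a' b : a != 0 -> a' != 0 -> b != 0 -> inP 1 (a' / a - 1) -> hil a' b = hil a b.
Proof.
move=> a0 a'0 b0 h; rewrite -{1}(divfK a0 a') mulrC hilMl //; last by rewrite mulf_neq0 ?invr_eq0.
by rewrite (hil_unit1l _ h) mulr1.
Qed.

Lemma hil_cong_r a b b' : a != 0 -> b != 0 -> b' != 0 -> inP 1 (b' / b - 1) -> hil a b' = hil a b.
Proof.
move=> a0 b0 b'0 h; rewrite -{1}(divfK b0 b') mulrC hilMr //; last by rewrite mulf_neq0 ?invr_eq0.
by rewrite (hil_unit1r _ h) mulr1.
Qed.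

End Hilbert.

Import ComplexField.Normc.

(** * Integration on F *)

Section Measure.
Context (R : realType) (F : padicField).
Local Notation C := R[i].
Local Notation v := (@pf_v F).
Local Notation q := (res_card F).
Local Notation T := (borelF F).
Implicit Types (x y a b : F) (m : int).

Definition pball (a : F) (m : int) : set T := [set x : F | inP m (x - a)].

Lemma ball_measurable a m : measurable (pball a m).
Proof. by apply: sub_sigma_algebra; exists a, m. Qed.

Lemma unif_ex : exists2 p : F, p != 0 & v p = 1.
Proof. exact: pf_val_onto. Qed.

Lemma dense_O (m : nat) : exists S : seq F, forall x, inP 0 x ->
  has (fun d => inP m%:Z (x - d)) S.
Proof.
have [p p0 vp] := unif_ex.
elim: m => [|m [S hS]]; first by exists [:: 0] => x hx /=; rewrite subr0 hx.
have [r [_ _ rc]] := pf_res_card F.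
exists [seq a + p * d | a <- r, d <- S] => x hx.
have /hasP[a ar ha] : has (fun y => inP 1 (x - y)) r by rewrite has_count (rc _ hx).
have : inP 0 (p^-1 * (x - a)).
  by rewrite inP_scale' ?invr_eq0 // pvV // vp.
case/hS/hasP => d dS hd; apply/hasP; exists (a + p * d); first exact: allpairs_f.
have -> : x - (a + p * d) = p * (p^-1 * (x - a) - d).
  by rewrite mulrBr mulVKf //; ring.
by rewrite inP_scale' // vp (_ : _ - 1 = m%:Z) //; lia.
Qed.

Lemma dense_F : exists D : nat -> F, forall x m, exists k, inP m (x - D k).
Proof.
have [p p0 vp] := unif_ex.
have /choice [S hS] := dense_O.
exists (fun k => if unpickle k is Some (j, m, i) then p ^- j * (S m)`_i else 0).
move=> x m; pose j := `|v x|%N; pose m' := (`|m| + j)%N.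
have : inP 0 (p ^+ j * x).
  have [->|x0] := eqVneq x 0; first by rewrite mulr0 inP0.
  by rewrite inPE ?mulf_neq0 ?expf_neq0 // pvM ?expf_neq0 // pvX // vp; lia.
case/(hS m')/(has_nthP 0) => i _ hi.
exists (pickle (j, m', i)); rewrite pickleK.
have -> : x - p ^- j * (S m')`_i = p ^- j * (p ^+ j * x - (S m')`_i).
  by rewrite mulrBr mulKf ?expf_neq0.
rewrite inP_scale' ?invr_eq0 ?expf_neq0 // pvV ?expf_neq0 // pvX // vp.
by apply: inP_le hi; lia.
Qed.

(** The topology is second countable: by [dense_F], an open set is the union of the countably many
    balls with centre [D k] and natural index that it contains. *)
Lemma open_measurable (U : set T) :
  (forall x : F, U x -> exists m, forall y : F, inP m (y - x) -> U y) -> measurable U.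
Proof.
move=> hU; have [D hD] := dense_F.
pose B k (m : nat) : set T := [set x | pball (D k) m%:Z `<=` U /\ pball (D k) m%:Z x].
rewrite (_ : U = \bigcup_k \bigcup_m B k m); last first.
  apply/seteqP; split=> x /=; last by case=> k _ [m _ [h1 h2]]; apply: h1.
  move=> Ux; have [m hm] := hU x Ux; have [k hk] := hD x `|m|%N%:Z.
  exists k => //; exists `|m|%N => //; split=> // y hy; apply: hm.
  apply: (@inP_le _ `|m|%N%:Z); first lia.
  rewrite (_ : y - x = (y - D k) - (x - D k)); last by rewrite opprB addrA subrK.
  exact: inPB.
apply: bigcupT_measurable => k; apply: bigcupT_measurable => m.
have [h|h] := pselect (pball (D k) m%:Z `<=` U).
  rewrite (_ : B k m = pball (D k) m%:Z) //; first exact: ball_measurable.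
  by apply/seteqP; split=> x /=; [case|split].
rewrite (_ : B k m = set0) //.
by apply/seteqP; split=> x //= [].
Qed.

Lemma point_measurable a : measurable ([set a] : set T).
Proof.
rewrite (_ : [set a] = \bigcap_(m in [set: nat]) pball a m%:Z).
  by apply: bigcapT_measurable => m; exact: ball_measurable.
apply/seteqP; split=> x /=; first by move=> -> m _; rewrite /pball /= subrr inP0.
move=> h; apply/eqP; rewrite -subr_eq0; apply/eqP; apply: inP_all0 => m.
by apply: inP_le (h `|m|%N I); lia.
Qed.

(** The exceptional point is usually the origin: functions such as t -> rho(1/t) v0 are locally
    constant only away from 0. Points being measurable, one exception does no harm to
    measurability. *)
Definition loc_const (S : Type) (a : F) (f : F -> S) : Prop :=
  forall x, x != a -> exists m, forall y, inP m (y - x) -> f y = f x.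

Lemma loc_const_measurable d (S : measurableType d) a (f : F -> S) :
  loc_const a f -> measurable_fun setT (f : T -> S).
Proof.
move=> hf _ Y _; rewrite setTI; set U := _ @^-1` _.
have -> : U = ([set a] `&` U) `|` (~` [set a] `&` U).
  by rewrite -setIUl setUv setTI.
apply: measurableU.
  have [h|h] := pselect (U a).
    rewrite (_ : _ `&` _ = [set a]); first exact: point_measurable.
    by apply/seteqP; split=> x /=; [case|move=> ->].
  rewrite (_ : _ `&` _ = set0) //.
  by apply/seteqP; split=> x //= [->].
apply: open_measurable => x [/= xa Ux].
have x_a : x != a by apply/eqP.
have [m hm] := hf x x_a.
exists (`|m|%N + `|v (x - a)|%N + 1)%N%:Z => y hy.
have hym : inP m (y - x) by apply: inP_le hy; move: (v _) => w; lia.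
split=> /=; last by rewrite /U /= (hm y hym).
move=> ya; move: hy; rewrite ya -inPN opprB inPE ?subr_eq0 //; move: (v _) => w; lia.
Qed.

Context (mu : {measure set T -> \bar R}).
Hypothesis (hmu : is_haar mu).

Definition vol : R := fine (mu (pball 0 0)).

Lemma mu_ball_translate a m : mu (pball a m) = mu (pball 0 m).
Proof.
rewrite -(hmu.1 (pball 0 m) a (ball_measurable _ _)); congr (mu _).
apply/seteqP; split=> x /=.
  by rewrite /pball /= => h; exists (x - a); [rewrite subr0|rewrite addrC subrK].
by case=> y; rewrite /pball /= subr0 => hy <-; rewrite addrAC subrr add0r.
Qed.

Lemma mu_ball_split m : mu (pball 0 m) = (q%:R%:E * mu (pball 0 (m + 1)))%E.
Proof.
have [p p0 vp] := unif_ex.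
have [rep [r0 ex inj]] := res_reps F.
have pm0 : p ^ m != 0 by rewrite expfz_neq0.
have vpm : v (p ^ m) = m by rewrite pvXz // vp mul1r.
have -> : pball 0 m = \big[setU/set0]_(i < q) pball (p ^ m * rep i) (m + 1).
  rewrite -bigcup_seq; apply/seteqP; split=> x /=; rewrite /pball /= ?subr0.
    move=> hx; have [i hi] : exists i, inP 1 (p ^ (- m) * x - rep i).
      apply: ex; rewrite inP_scale' ?expfz_neq0 // pvXz // vp.
      by rewrite mul1r opprK add0r.
    exists i => //=; first exact: mem_index_enum.
    rewrite (_ : x - _ = p ^ m * (p ^ (- m) * x - rep i)); last first.
      by rewrite mulrBr mulrA -expfzDr // subrr expr0z mul1r.
    by rewrite inP_scale' // vpm addrC addKr.
  case=> i _ /= h; rewrite -(subrK (p ^ m * rep i) x) inPD //.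
    by apply: inP_le h; lia.
  by rewrite inP_scale' // vpm subrr.
rewrite measure_bigsetU_ord_cond; last 2 first.
- by move=> i _; exact: ball_measurable.
- apply/trivIsetP => i j _ _ ij; rewrite -subset0 => x [].
  rewrite /pball /= => h1 h2; case/negP: ij; apply/eqP/inj.
  have : inP (m + 1) (p ^ m * (rep i - rep j)).
    rewrite (_ : _ * _ = (x - p ^ m * rep j) - (x - p ^ m * rep i)); last by ring.
    exact: inPB.
  by rewrite inP_scale' // vpm addrC addKr.
transitivity (\sum_(i < q) mu (pball 0 (m + 1)))%E.
  by apply: eq_bigr => i _; exact: mu_ball_translate.
by rewrite sumr_const card_ord mule_natl.
Qed.

Lemma mu_ball0_fin : mu (pball 0 0) = vol%:E.
Proof.
have [_ /andP[h1 h2]] := hmu.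
rewrite /vol fineK // ge0_fin_numE ?measure_ge0 //.
rewrite (_ : pball 0 0 = [set x : F | inP 0 x]) //.
by apply/seteqP; split=> x; rewrite /pball /= subr0.
Qed.

Lemma vol_gt0 : 0 < vol.
Proof.
rewrite -lte_fin -mu_ball0_fin; have [_ /andP[h1 h2]] := hmu.
rewrite (_ : pball 0 0 = [set x : F | inP 0 x]) //.
by apply/seteqP; split=> x; rewrite /pball /= subr0.
Qed.

Lemma q_neq0 (K : numDomainType) : (q%:R : K) != 0.
Proof. by rewrite pnatr_eq0; have := q_gt1 F; lia. Qed.

Lemma mu_ball a m : mu (pball a m) = ((q%:R ^ (- m)) * vol)%:E.
Proof.
rewrite mu_ball_translate.
have S k : mu (pball 0 k) = (q%:R ^ (- k) * vol)%:E ->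
   mu (pball 0 (k + 1)) = (q%:R ^ (- (k + 1)) * vol)%:E.
  rewrite mu_ball_split => h.
  (* Finiteness comes first, so that q can be cancelled among real numbers; an infinite value would
     contradict the finite measure of the larger ball. *)
  have : (mu (pball 0 (k + 1)) < +oo)%E.
    rewrite ltey; apply: contra_eqN h => /eqP ->.
    by rewrite gt0_muley // lte_fin ltr0n; have := q_gt1 F; lia.
  rewrite -ge0_fin_numE ?measure_ge0 // => hf; move: h; rewrite -(fineK hf) -EFinM.
  move=> -[h]; congr EFin; apply: (mulfI (q_neq0 _)); rewrite h mulrA; congr (_ * _).
  by rewrite -{2}[q%:R]expr1z -expfzDr ?q_neq0 //; congr (_ ^ _); lia.
have P k : mu (pball 0 (k + 1)) = (q%:R ^ (- (k + 1)) * vol)%:E ->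
   mu (pball 0 k) = (q%:R ^ (- k) * vol)%:E.
  move=> h; rewrite mu_ball_split h -EFinM mulrA; congr (_ * _)%:E.
  by rewrite -{1}[q%:R]expr1z -expfzDr ?q_neq0 //; congr (_ ^ _); lia.
have h0 : mu (pball 0 0) = (q%:R ^ (- 0) * vol)%:E.
  by rewrite oppr0 expr0z mul1r mu_ball0_fin.
case: m => m.
  elim: m => [//|m ih]; rewrite (_ : Posz m.+1 = Posz m + 1); [exact: S|lia].
elim: m => [|m ih]; first by apply: P.
by apply: P; rewrite (_ : Negz m.+1 + 1 = Negz m) //; lia.
Qed.

End Measure.

(** * Affine changes of variable *)

Section Affine.
Context (R : realType) (F : padicField).
Local Notation C := R[i].
Local Notation v := (@pf_v F).
Local Notation q := (res_card F).
Local Notation T := (borelF F).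
Implicit Types (x y a b : F) (m : int).

Definition affine a b : T -> T := fun x => (a * (x : F) + b : F).

Lemma affine_ball a b c m : a != 0 ->
  affine a b @^-1` pball c m = pball (a^-1 * (c - b)) (m - v a).
Proof.
move=> a0; apply/seteqP; split=> x; rewrite /pball /affine /= => h.
  rewrite -(inP_scale _ _ a0) subrK mulrBr mulVKf //.
  by rewrite (_ : a * x - _ = a * x + b - c) //; ring.
move: h; rewrite -(inP_scale _ _ a0) subrK mulrBr mulVKf //.
by rewrite (_ : a * x - _ = a * x + b - c) //; ring.
Qed.

Lemma affine_measurable a b : a != 0 -> measurable_fun setT (affine a b).
Proof.
move=> a0; apply: (@measurability _ _ T T setT (affine a b) (@balls F : set (set T))) => //.
move=> _ [B [c [m ->]] <-]; rewrite setTI.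
change (measurable (affine a b @^-1` pball c m)).
by rewrite affine_ball //; exact: ball_measurable.
Qed.

Lemma ballI c d m k : pball c m `&` pball d k = set0 \/
  exists e j, pball c m `&` pball d k = @pball F e j.
Proof.
have [->|/set0P [x [h1 h2]]] := eqVneq (pball c m `&` pball d k) set0; first by left.
right; exists x, (Num.max m k); move: h1 h2; rewrite /pball /= => h1 h2.
apply/seteqP; split=> y /=.
  move=> [h3 h4]; case: (leP m k) => _.
    by rewrite (_ : y - x = (y - d) - (x - d)); [exact: inPB|ring].
  by rewrite (_ : y - x = (y - c) - (x - c)); [exact: inPB|ring].
move=> h; split.
  rewrite (_ : y - c = (y - x) + (x - c)); [apply: inPD => //|ring].
  by apply: inP_le h; rewrite le_max lexx.
rewrite (_ : y - d = (y - x) + (x - d)); [apply: inPD => //|ring].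
by apply: inP_le h; rewrite le_max lexx orbT.
Qed.

(** Two balls meet in a ball or not at all, so balls and the empty set form a generating family
    stable under intersection, and the balls around 0 exhaust the field. *)
Lemma haar_unique (m1 m2 : {measure set T -> \bar R}) :
  (forall c m, m1 (pball c m) = m2 (pball c m)) ->
  (forall m, (m1 (pball 0 m) < +oo)%E) ->
  forall A, measurable A -> m1 A = m2 A.
Proof.
move=> h12 hf A mA.
pose G : set (set T) := [set B | balls B \/ B = set0].
apply: (measure_unique G (fun k => pball 0 (- k%:Z))) => //.
- rewrite eqEsubset; split.
    by apply: sub_sigma_algebra2 => B; left.
  apply: smallest_sub; first exact: smallest_sigma_algebra.
  move=> B [hB|->]; first exact: sub_sigma_algebra.
  exact: measurable0.
- move=> B1 B2 [[c [m ->]]|->] [[d [k ->]]|->]; rewrite ?setI0 ?set0I; try by right.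
  case: (ballI c d m k) => [h|[e [j h]]]; first by right.
  by left; exists e, j.
- by move=> i; left; exists 0, (- i%:Z).
- rewrite eqEsubset; split => // x _; exists `|v x|%N => //.
  rewrite /pball /= subr0; have [->|x0] := eqVneq x 0; first exact: inP0.
  by rewrite inPE //; lia.
- move=> B [[c [m ->]]|->]; last by rewrite !measure0.
  exact: h12.
Qed.

Context (mu : {measure set T -> \bar R}).
Hypothesis (hmu : is_haar mu).

Lemma qv_ge0 (k : int) : 0 <= (q%:R : R) ^ k.
Proof. by rewrite exprz_ge0. Qed.

(** The preimage of a ball of index m is a ball of index m - v(a); the factor is thus the inverse of
    the absolute value of [a], and agreement on balls suffices. *)
Lemma mu_affine a b A : a != 0 -> measurable A ->
  mu (affine a b @^-1` A) = ((q%:R ^ v a)%:E * mu A)%E.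
Proof.
move=> a0 mA; have mf := affine_measurable b a0.
pose c : {nonneg R} := NngNum (qv_ge0 (v a)).
unshelve epose (m1 := (pushforward mu (affine a b) : {measure set T -> \bar R})) => //.
apply: (haar_unique (m1 := m1) (m2 := mscale c mu)) => // [d m|m].
  rewrite /m1 /= /pushforward affine_ball // mu_ball // /mscale /= mu_ball // -EFinM mulrA.
  rewrite -expfzDr ?q_neq0 //; congr (_ ^ _ * _)%:E; lia.
by rewrite /m1 /= /pushforward affine_ball // mu_ball // ltry.
Qed.

Lemma ge0_integral_affine a b (f : T -> \bar R) : a != 0 ->
  measurable_fun setT f -> (forall x, (0 <= f x)%E) ->
  (\int[mu]_x f (affine a b x) = (q%:R ^ v a)%:E * \int[mu]_x f x)%E.
Proof.
move=> a0 mf ind_char_section; have mphi := affine_measurable b a0.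
pose c : {nonneg R} := NngNum (qv_ge0 (v a)).
rewrite -[X in (X%:E * _)%E]/(c%:num) -ge0_integral_mscale //.
transitivity (\int[pushforward mu (affine a b)]_x f x)%E.
  by rewrite (ge0_integral_pushforward mphi mu) // preimage_setT.
unshelve epose (m1 := (pushforward mu (affine a b) : {measure set T -> \bar R})) => //.
apply: (@eq_measure_integral _ _ _ _ (mscale c mu) m1) => A mA _.
by rewrite /m1 /= /pushforward mu_affine.
Qed.

Lemma integrable_affine a b (f : T -> R) : a != 0 ->
  mu.-integrable setT (EFin \o f) -> mu.-integrable setT (EFin \o (f \o affine a b)).
Proof.
move=> a0 /integrableP[mf fi]; have mphi := affine_measurable b a0.
apply/integrableP; split.
  by rewrite compA; apply: measurableT_comp.
rewrite (_ : (\int[mu]_x _)%E = ((q%:R ^ v a)%:E * \int[mu]_x `|(f x)%:E|)%E).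
  by apply: lte_mul_pinfty => //; rewrite ?lee_fin ?qv_ge0.
rewrite -(@ge0_integral_affine a b (fun x : T => `|(f x)%:E|%E)) //.
exact: measurableT_comp.
Qed.

Lemma Rintegral_affine a b (f : T -> R) : a != 0 ->
  mu.-integrable setT (EFin \o f) ->
  Rintegral mu setT (f \o affine a b) = q%:R ^ v a * Rintegral mu setT f.
Proof.
move=> a0 fi; have := integrable_affine b a0 fi => fi'.
have /integrableP[mf _] := fi.
rewrite /Rintegral [in LHS]integralE [in RHS]integralE.
have hp : (\int[mu]_x ((fun x => (f (affine a b x))%:E)^\+ x) =
   (q%:R ^ v a)%:E * \int[mu]_x ((EFin \o f)^\+ x))%E.
  rewrite -(@ge0_integral_affine a b ((EFin \o f)^\+)%E) //; last exact: measurable_funepos.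
  by apply: eq_integral => x _; rewrite !funeposE.
have hn : (\int[mu]_x ((fun x => (f (affine a b x))%:E)^\- x) =
   (q%:R ^ v a)%:E * \int[mu]_x ((EFin \o f)^\- x))%E.
  rewrite -(@ge0_integral_affine a b ((EFin \o f)^\-)%E) //; last exact: measurable_funeneg.
  by apply: eq_integral => x _; rewrite !funenegE.
rewrite [X in fine (X - _)%E]hp [X in fine (_ - X)%E]hn.
have := integrable_pos_fin_num measurableT fi; have := integrable_neg_fin_num measurableT fi.
move=> hA hB; rewrite -(fineK hA) -(fineK hB) -!EFinM -!EFinB /=.
by rewrite mulrBr.
Qed.

End Affine.

(** * Complex-valued integrals *)

Section CInt.
Context (R : realType) (F : padicField).
Local Notation C := R[i].
Local Notation v := (@pf_v F).
Local Notation q := (res_card F).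
Local Notation T := (borelF F).
Local Notation Re := complex.Re.
Local Notation Im := complex.Im.
Context (mu : {measure set T -> \bar R}).

Lemma ReM (z w : C) : Re (z * w) = Re z * Re w - Im z * Im w.
Proof. by case: z w => a b [c d]. Qed.

Lemma ImM (z w : C) : Im (z * w) = Re z * Im w + Im z * Re w.
Proof. by case: z w => a b [c d]; rewrite /= addrC. Qed.

Lemma normc_Re (z : C) : `|Re z| <= normc z.
Proof. by case: z => a b /=; rewrite -sqrtr_sqr ler_wsqrtr // lerDl sqr_ge0. Qed.

Lemma normc_Im (z : C) : `|Im z| <= normc z.
Proof. by case: z => a b /=; rewrite -sqrtr_sqr ler_wsqrtr // lerDr sqr_ge0. Qed.

Lemma normc_ge0 (z : C) : 0 <= normc z.
Proof. by case: z => a b /=; exact: sqrtr_ge0. Qed.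

Lemma normcX (z : C) k : normc (z ^+ k) = normc z ^+ k.
Proof. by elim: k => [|k ih]; rewrite ?normc1 // !exprS normcM ih. Qed.

Lemma eq_ReIm (z w : C) : Re z = Re w -> Im z = Im w -> z = w.
Proof. by case: z w => a b [c d] /= -> ->. Qed.

Local Notation I := (cintegral mu setT).

Lemma integrable_EFinZl (k : R) (f : T -> R) : mu.-integrable setT (EFin \o f) ->
  mu.-integrable setT (EFin \o (fun x => k * f x)).
Proof.
move=> h; rewrite (_ : _ \o _ = (fun x : T => k%:E * (EFin \o f) x)%E); first exact: integrableZl.
by apply: funext => x /=; rewrite EFinM.
Qed.

Lemma cintegrable_ext (f g : F -> C) : f =1 g -> cintegrable mu f -> cintegrable mu g.
Proof. by move=> /funext ->. Qed.

Lemma cintegrableZ (c : C) (f : F -> C) : cintegrable mu f -> cintegrable mu (fun x => c * f x).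
Proof.
case=> h1 h2; split.
  apply: (@eq_integrable _ _ _ mu setT measurableT
    ((fun x : T => ((Re c)%:E * (Re (f x))%:E)) \- (fun x : T => ((Im c)%:E * (Im (f x))%:E)))%E).
    by move=> x _ /=; rewrite ReM.
  by apply: integrableB => //; exact: integrableZl.
apply: (@eq_integrable _ _ _ mu setT measurableT
    ((fun x : T => ((Re c)%:E * (Im (f x))%:E)) \+ (fun x : T => ((Im c)%:E * (Re (f x))%:E)))%E).
  by move=> x _ /=; rewrite ImM.
by apply: integrableD => //; exact: integrableZl.
Qed.

Lemma cintegralZ (c : C) (f : F -> C) : cintegrable mu f ->
  I (fun x => c * f x) = c * I f.
Proof.
case=> h1 h2; apply: eq_ReIm; rewrite ?ReM ?ImM /=.
  under eq_Rintegral do rewrite ReM.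
  rewrite (@RintegralB _ _ _ mu setT _ _ measurableT); try exact: integrable_EFinZl.
  by rewrite !RintegralZl.
under eq_Rintegral do rewrite ImM.
rewrite (@RintegralD _ _ _ mu setT _ _ measurableT); try exact: integrable_EFinZl.
by rewrite !RintegralZl.
Qed.

Lemma cintegrableD (f g : F -> C) : cintegrable mu f -> cintegrable mu g ->
  cintegrable mu (fun x => f x + g x).
Proof.
case=> h1 h2 [h3 h4]; split.
  apply: (@eq_integrable _ _ _ mu setT measurableT
    ((fun x : T => (Re (f x))%:E) \+ (fun x : T => (Re (g x))%:E))%E).
    by move=> x _ /=; case: (f x) (g x) => a b [c d].
  exact: integrableD.
apply: (@eq_integrable _ _ _ mu setT measurableT
    ((fun x : T => (Im (f x))%:E) \+ (fun x : T => (Im (g x))%:E))%E).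
  by move=> x _ /=; case: (f x) (g x) => a b [c d].
exact: integrableD.
Qed.

Lemma cintegralD (f g : F -> C) : cintegrable mu f -> cintegrable mu g ->
  I (fun x => f x + g x) = I f + I g.
Proof.
case=> h1 h2 [h3 h4]; apply: eq_ReIm; rewrite /=.
  rewrite -(@RintegralD _ _ _ mu setT _ _ measurableT) //.
  by apply: eq_Rintegral => x _; case: (f x) (g x) => a b [c d].
rewrite -(@RintegralD _ _ _ mu setT _ _ measurableT) //.
by apply: eq_Rintegral => x _; case: (f x) (g x) => a b [c d].
Qed.

Lemma cintegrable0 : cintegrable mu (fun _ => 0).
Proof. by split; exact: integrable0. Qed.

Lemma cintegral0 : I (fun _ => 0) = 0.
Proof.
rewrite -[RHS](mul0r (I (fun _ => 0))) -(cintegralZ 0 cintegrable0).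
by congr (I _); apply: funext => x; rewrite mul0r.
Qed.

Lemma cintegrable_sum (J : Type) (s : seq J) (f : J -> F -> C) :
  (forall j, cintegrable mu (f j)) -> cintegrable mu (fun x => \sum_(j <- s) f j x).
Proof.
move=> h; elim: s => [|j s ih].
  by apply: cintegrable_ext cintegrable0 => x; rewrite big_nil.
by apply: cintegrable_ext (cintegrableD (h j) ih) => x; rewrite big_cons.
Qed.

Lemma cintegral_sum (J : Type) (s : seq J) (f : J -> F -> C) :
  (forall j, cintegrable mu (f j)) ->
  I (fun x => \sum_(j <- s) f j x) = \sum_(j <- s) I (f j).
Proof.
move=> h; elim: s => [|j s ih].
  by rewrite big_nil -[RHS]cintegral0; congr (I _); apply: funext => x; rewrite big_nil.
rewrite big_cons -ih -cintegralD //; last exact: cintegrable_sum.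
by congr (I _); apply: funext => x; rewrite big_cons.
Qed.

Lemma cintegrable_dom (a : F) (f : F -> C) (g : T -> R) : loc_const a f ->
  mu.-integrable setT (EFin \o g) -> (forall x, normc (f x) <= g x) -> cintegrable mu f.
Proof.
move=> hf hg hfg; split; apply: le_integrable hg => //.
- apply/measurable_EFinP.
  apply: (@loc_const_measurable _ _ _ a (fun x => Re (f x))) => x /hf [m hm].
  by exists m => y /hm ->.
- move=> x _ /=; rewrite lee_fin (le_trans (normc_Re _)) // (le_trans (hfg x)) //.
  exact: ler_norm.
- apply/measurable_EFinP.
  apply: (@loc_const_measurable _ _ _ a (fun x => Im (f x))) => x /hf [m hm].
  by exists m => y /hm ->.
- move=> x _ /=; rewrite lee_fin (le_trans (normc_Im _)) // (le_trans (hfg x)) //.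
  exact: ler_norm.
Qed.

Hypothesis (hmu : is_haar mu).
Local Notation V := (vol mu).

Lemma cintegrable_affine a b (f : F -> C) : a != 0 -> cintegrable mu f ->
  cintegrable mu (fun x => f (a * x + b)).
Proof.
move=> a0 [h1 h2]; split.
  exact: (integrable_affine hmu b a0 h1).
exact: (integrable_affine hmu b a0 h2).
Qed.

Lemma cintegral_affine a b (f : F -> C) : a != 0 -> cintegrable mu f ->
  I (fun x => f (a * x + b)) = q%:R ^ v a * I f.
Proof.
move=> a0 [h1 h2].
have e1 := Rintegral_affine hmu b a0 h1; have e2 := Rintegral_affine hmu b a0 h2.
have -> : (q%:R : C) ^ v a = (q%:R ^ v a)%:C%C by rewrite rmorphXz ?unitfE ?q_neq0 // rmorph_nat.
apply: eq_ReIm; rewrite ?ReM ?ImM /= ?mul0r ?subr0 ?addr0; [exact: e1|exact: e2].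
Qed.

Definition indb (a : F) (m : int) (x : F) : C := if inP m (x - a) then 1 else 0.

Lemma pball_integrable a m : mu.-integrable setT (EFin \o (\1_(pball a m) : T -> R)).
Proof.
have mb := ball_measurable a m.
apply/integrableP; split; first exact/measurable_EFinP.
rewrite (eq_integral (fun x : T => (\1_(pball a m) x)%:E)); last first.
  by move=> t _; rewrite gee0_abs// lee_fin.
by rewrite integral_indic// setIT mu_ball // ltry.
Qed.

Lemma pball_Rintegral a m : Rintegral mu setT (\1_(pball a m)) = q%:R ^ (- m) * V.
Proof. by rewrite /Rintegral integral_indic ?setIT ?mu_ball //; exact: ball_measurable. Qed.

Lemma cint_indb a m : cintegrable mu (indb a m) /\
  I (indb a m) = q%:R ^ (- m) * V%:C%C.
Proof.
have e1 : (fun x => Re (indb a m x)) = \1_(pball a m) :> (T -> R).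
  apply: funext => x; rewrite /indb indicE /pball.
  case: ifPn => h; first by rewrite mem_set.
  by rewrite memNset //; apply/negP.
have e2 : (fun x => Im (indb a m x)) = cst 0 :> (T -> R).
  by apply: funext => x; rewrite /indb; case: ifP.
split.
  split.
    have := pball_integrable a m; rewrite -e1; apply.
  have := integrable0 mu setT; rewrite (_ : cst 0%E = (fun x : T => (Im (indb a m x))%:E)) //.
  by apply: funext => x; rewrite /indb; case: ifP.
have -> : (q%:R : C) ^ (- m) = (q%:R ^ (- m))%:C%C by rewrite rmorphXz ?unitfE ?q_neq0 // rmorph_nat.
apply: eq_ReIm; rewrite ?ReM ?ImM /= ?mul0r ?subr0 ?mulr0 ?addr0.
  by rewrite e1 pball_Rintegral.
by rewrite e2 Rintegral_cst // mul0r.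
Qed.

End CInt.

(** * Shells of fixed valuation and geometric majorants *)

Section Shell.
Context (R : realType) (F : padicField).
Local Notation C := R[i].
Local Notation v := (@pf_v F).
Local Notation q := (res_card F).
Local Notation T := (borelF F).
Context (mu : {measure set T -> \bar R}).
Hypothesis (hmu : is_haar mu).
Local Notation V := (vol mu).
Local Notation I := (cintegral mu setT).

Definition shell (k : int) : set T := [set x : F | x != 0 /\ v x = k].

Lemma shellE k : shell k = pball 0 k `\` pball 0 (k + 1).
Proof.
apply/seteqP; split=> x; rewrite /pball /shell /= !subr0.
  by move=> [x0 vx]; rewrite !inPE // vx; split; lia.
have [->|x0] := eqVneq x 0; first by rewrite !inP0 => -[].
rewrite !inPE // => -[h1 h2]; split=> //; lia.
Qed.

Lemma shell_measurable k : measurable (shell k).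
Proof. by rewrite shellE; apply: measurableD; exact: ball_measurable. Qed.

(** The shell of valuation -i has measure at most q^i vol, which the power of 1/q absorbs; what
    remains is the convergent series of the M vol c^i. *)
Lemma geometric_integrable (M c : R) : 0 <= M -> 0 <= c -> c < 1 ->
  mu.-integrable setT (EFin \o (fun x : T =>
    if ((x : F) != 0) && (v x <= 0) then M * (c / q%:R) ^+ `|v x| else 0)).
Proof.
move=> M0 c0 c1; set g := fun x : T => _.
have q0 : 0 < (q%:R : R) by rewrite ltr0n; have := q_gt1 F; lia.
have g0 x : 0 <= g x.
  by rewrite /g; case: ifP => // _; rewrite mulr_ge0 ?exprn_ge0 ?divr_ge0 // ltW.
have lcg : loc_const 0 g.
  move=> x x0; exists (v x + 1) => y hy.
  have [h1 h2] := pvD_lt x0 hy; rewrite addrC subrK in h1 h2.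
  by rewrite /g x0 h1 h2.
have mg : measurable_fun setT g by exact: loc_const_measurable lcg.
pose A (i : nat) := shell (- i%:Z).
have mA i : measurable (A i) by exact: shell_measurable.
have tA : trivIset setT A.
  apply/trivIsetP => i j _ _ ij; rewrite -subset0 => x [[x0 h1] [_ h2]].
  by case/eqP: ij; move: h1; rewrite h2; lia.
apply/integrableP; split; first exact/measurable_EFinP.
rewrite (eq_integral (((fun x => (g x)%:E) \_ (\bigcup_i A i))%E)); last first.
  move=> x _; rewrite patchE /= ger0_norm ?g0 //; case: ifPn => // h.
  rewrite /g; case: ifP => // /andP[x0 vx]; case/negP: h.
  by rewrite mem_set //; exists `|v x|%N => //; split=> //; lia.
rewrite -integral_mkcond ge0_integral_bigcup //; last 2 first.
  by apply: measurable_funTS; exact/measurable_EFinP.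
  by move=> x _; rewrite lee_fin.
apply: (@le_lt_trans _ _ (\sum_(i <oo) (M * V * c ^+ i)%:E)%E).
  apply: lee_nneseries => [i _ _|i _].
    by apply: integral_ge0 => x _; rewrite lee_fin.
  rewrite (eq_integral (cst (M * (c / q%:R) ^+ i)%:E)); last first.
    move=> x; rewrite inE => -[x0 vx]; rewrite /g x0 vx /=.
    by rewrite (_ : - i%:Z <= 0) ?abszN ?absz_nat //; lia.
  rewrite integral_cst // -/(A i) (_ : (M * V * c ^+ i)%:E = (M * (c / q%:R) ^+ i)%:E * mu (pball 0 (- i%:Z)))%E.
    apply: lee_pmul => //; first by rewrite lee_fin mulr_ge0 ?exprn_ge0 ?divr_ge0 // ltW.
    apply: le_measure; rewrite ?inE //; first exact: ball_measurable.
    by rewrite /A shellE; apply: subDsetl.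
  rewrite mu_ball // -EFinM opprK -exprnP; congr EFin.
  rewrite expr_div_n; field; rewrite expf_neq0 // gt_eqF //.
have h : series (geometric (M * V) c) @ \oo --> (M * V) * (1 - c)^-1.
  by apply: cvg_geometric_series; rewrite ger0_norm.
rewrite (_ : (\sum_(i <oo) _)%E = ((M * V) * (1 - c)^-1)%:E) ?ltry //.
apply/cvg_lim => //.
rewrite (_ : (fun n : nat => _) = EFin \o series (geometric (M * V) c)).
  by apply/fine_cvgP; split; [exact: nearW|].
by apply: funext => k /=; rewrite sumEFin.
Qed.

End Shell.

Section ShellInt.
Context (R : realType) (F : padicField).
Local Notation C := R[i].
Local Notation v := (@pf_v F).
Local Notation q := (res_card F).
Local Notation T := (borelF F).
Context (mu : {measure set T -> \bar R}).
Hypothesis (hmu : is_haar mu).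
Local Notation V := ((vol mu)%:C%C).
Local Notation I := (cintegral mu setT).

Definition shell1 (k : int) (x : F) : C := if (x != 0) && (v x == k) then 1 else 0.

Lemma shell1E k x : shell1 k x = indb R 0 k x + (-1) * indb R 0 (k + 1) x.
Proof.
rewrite /shell1 /indb !subr0 mulN1r.
have [->|x0] := eqVneq x 0; first by rewrite !inP0 subrr.
rewrite !inPE //=.
case h1: (v x == k); case h2: (k <= v x); case h3: (k + 1 <= v x);
  rewrite ?subr0 ?subrr //; lia.
Qed.

Lemma qC_neq0 : (q%:R : C) != 0. Proof. exact: q_neq0. Qed.

Lemma cint_shell k : cintegrable mu (shell1 k) /\
  I (shell1 k) = q%:R ^ (- k) * (1 - q%:R^-1) * V.
Proof.
have [h1 e1] := cint_indb hmu 0 k; have [h2 e2] := cint_indb hmu 0 (k + 1).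
have -> : shell1 k = (fun x => indb R 0 k x + (-1) * indb R 0 (k + 1) x).
  by apply: funext => x; exact: shell1E.
split; first by apply: cintegrableD => //; exact: cintegrableZ.
rewrite cintegralD //; last exact: cintegrableZ.
rewrite cintegralZ // e1 e2 opprD expfzDr ?qC_neq0 // exprN1; ring.
Qed.

(** Multiplication by a unit preserves the measure, so the integral equals [z] times itself. *)
Lemma unit_absorb (f : F -> C) (r : F) (z : C) : r != 0 -> v r = 0 -> z != 1 ->
  cintegrable mu f -> (forall x, f (r * x) = z * f x) -> I f = 0.
Proof.
move=> r0 vr z1 fi h.
have := cintegral_affine hmu 0 r0 fi; rewrite vr expr0z mul1r.
have -> : (fun x => f (r * x + 0)) = (fun x => z * f x).
  by apply: funext => x; rewrite addr0 h.
rewrite cintegralZ // => /eqP; rewrite -subr_eq0 -{2}[I f]mul1r -mulrBl mulf_eq0 subr_eq0 (negbTE z1) /=.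
by move/eqP.
Qed.

Context (p : F) (p0 : p != 0) (vp : v p = 1) (n : nat) (n0 : (0 < n)%N).
(** [hE] is an alternative on the shell of valuation -i: either [Psi] is constant there, with value
    [E i], or some unit multiplies it by z <> 1 and its integral vanishes. [B] bounds the ratio
    between shells [n] apart, so convergence holds for small [X]. *)
Context (Psi : F -> C) (rho X : C) (E : nat -> C) (B : R).
Hypotheses (lcPsi : loc_const 0 Psi)
  (perPsi : forall x, x != 0 -> Psi (p ^- n * x) = rho * Psi x)
  (normPsi : forall r x, r != 0 -> v r = 0 -> x != 0 -> normc (Psi (r * x)) = normc (Psi x))
  (hE : forall i, (i < n)%N ->
    (forall r, r != 0 -> v r = 0 -> Psi (r * p ^- i) = E i) \/
    (E i = 0 /\ exists r z, [/\ r != 0, v r = 0, z != 1 &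
       forall x, x != 0 -> v x = - i%:Z -> Psi (r * x) = z * Psi x]))
  (B1 : 1 <= B) (rhoB : normc rho <= B) (XB : normc X * B < 1).

(** For X = q^-s the factor is |x|^(-1-s). The range |x| >= 1 is what the big-cell condition v(c) <=
    v(d) becomes in the intertwining integrals. *)
Definition shellJ (x : F) : C :=
  if (x != 0) && (v x <= 0) then (X / q%:R) ^+ `|v x| * Psi x else 0.

Let M : R := \sum_(i < n) normc (Psi (p ^- i)).

Lemma pX0 k : p ^- k != 0 /\ v (p ^- k) = - k%:Z.
Proof. by rewrite invr_eq0 expf_neq0 // pvV ?expf_neq0 // pvX // vp -mulr_natr mul1r natz. Qed.

Lemma unit_part k x : x != 0 -> v x = - k%:Z ->
  exists r, [/\ r != 0, v r = 0 & x = r * p ^- k].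
Proof.
move=> x0 vx; exists (x * p ^+ k); split.
- by rewrite mulf_neq0 // expf_neq0.
- by rewrite pvM ?expf_neq0 // pvX // vp vx -mulr_natr mul1r natz addNr.
- by rewrite mulfK // expf_neq0.
Qed.

(** Shells beyond the first [n] are reached by periodicity. One factor [B] is spent per shell
    although a whole period costs only one; since B >= 1 this is harmless, and it gives a purely
    geometric majorant. *)
Lemma Psi_bound k : forall x, x != 0 -> v x = - k%:Z -> normc (Psi x) <= M * B ^+ k.
Proof.
have M0 : 0 <= M by apply: sumr_ge0 => i _; exact: normc_ge0.
have B0 : 0 <= B by apply: le_trans B1.
elim/ltn_ind: k => k ih x x0 vx.
have [kn|nk] := ltnP k n.
  have [r [r0 vr ->]] := unit_part x0 vx.
  rewrite normPsi //; last by case: (pX0 k).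
  apply: (@le_trans _ _ M); last by rewrite ler_peMr // exprn_ege1.
  rewrite /M (bigD1 (Ordinal kn)) //= lerDl; apply: sumr_ge0 => i _; exact: normc_ge0.
have y0 : p ^+ n * x != 0 by rewrite mulf_neq0 ?expf_neq0.
have vy : v (p ^+ n * x) = - (k - n)%N%:Z.
  by rewrite pvM ?expf_neq0 // pvX // vp vx; lia.
rewrite (_ : x = p ^- n * (p ^+ n * x)); last by rewrite mulKf ?expf_neq0.
rewrite perPsi // normcM (_ : k = (n + (k - n))%N); last by lia.
rewrite exprD mulrCA; apply: ler_pM; rewrite ?normc_ge0 //.
  by apply: le_trans rhoB _; rewrite -{1}[B]expr1 ler_weXn2l.
by apply: ih => //; lia.
Qed.

Lemma shellJ_lc : loc_const 0 shellJ.
Proof.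
move=> x x0; have [m hm] := lcPsi x0.
exists (`|m|%N + `|v x|%N + 1)%N%:Z => y hy.
have hy1 : inP (v x + 1) (y - x) by apply: inP_le hy; lia.
have [h1 h2] := pvD_lt x0 hy1; rewrite addrC subrK in h1 h2.
rewrite /shellJ x0 h1 h2 (hm y) //.
by apply: inP_le hy; move: (v x) => w; lia.
Qed.

Lemma shellJ_dom_integrable (f : F -> C) : loc_const 0 f ->
  (forall x, normc (f x) <= normc (shellJ x)) -> cintegrable mu f.
Proof.
move=> lcf hf.
have M0 : 0 <= M by apply: sumr_ge0 => i _; exact: normc_ge0.
have B0 : 0 <= B by apply: le_trans B1.
have q0 : 0 < (q%:R : R) by rewrite ltr0n; have := q_gt1 F; lia.
apply: (cintegrable_dom lcf (geometric_integrable hmu M0 (c := normc X * B) _ _)) => //.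
  by rewrite mulr_ge0 ?normc_ge0.
move=> x; apply: le_trans (hf x) _; rewrite /shellJ.
case: ifP => [/andP[x0 vx]|_]; last by rewrite normc0.
rewrite normcM normcX normcM normcV.
have -> : normc (q%:R : C) = q%:R.
  rewrite -(rmorph_nat (real_complex R)) /= expr0n /= addr0 sqrtr_sqr ger0_norm //; exact: ltW.
have := @Psi_bound `|v x|%N x x0 => h.
rewrite (_ : M * _ = (normc X / q%:R) ^+ `|v x| * (M * B ^+ `|v x|)).
  apply: ler_wpM2l; last by apply: h; lia.
  by rewrite exprn_ge0 // divr_ge0 ?normc_ge0 // ltW.
by rewrite !exprMn; ring.
Qed.

Lemma shellJ_integrable : cintegrable mu shellJ.
Proof. exact: shellJ_dom_integrable shellJ_lc _. Qed.

Lemma shell1_lc k : loc_const 0 (shell1 k).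
Proof.
move=> x x0; exists (v x + 1) => y hy.
have [h1 h2] := pvD_lt x0 hy; rewrite addrC subrK in h1 h2.
by rewrite /shell1 x0 h1 h2.
Qed.

Lemma shellJ_piece i : (i < n)%N ->
  cintegrable mu (fun x => shell1 (- i%:Z) x * shellJ x) /\
  I (fun x => shell1 (- i%:Z) x * shellJ x) = (1 - q%:R^-1) * V * X ^+ i * E i.
Proof.
move=> iN; have [hs es] := cint_shell (- i%:Z).
case: (hE iN) => [h|[Ei [r [z [r0 vr z1 h]]]]].
  have e : (fun x => shell1 (- i%:Z) x * shellJ x) =
           (fun x => ((X / q%:R) ^+ i * E i) * shell1 (- i%:Z) x).
    apply: funext => x; rewrite /shell1 /shellJ.
    case: ifP => [/andP[x0 /eqP vx]|]; last by rewrite mul0r mulr0.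
    rewrite x0 vx mul1r mulr1 abszN absz_nat /= (_ : - i%:Z <= 0); last by lia.
    by have [r [r0 vr ->]] := unit_part x0 vx; rewrite h.
  rewrite e; split; first exact: cintegrableZ.
  rewrite cintegralZ // es opprK -exprnP expr_div_n.
  by have := qC_neq0 => q0; field; rewrite ?q0 ?expf_neq0.
rewrite Ei mulr0.
have ci : cintegrable mu (fun x => shell1 (- i%:Z) x * shellJ x).
  apply: shellJ_dom_integrable.
    move=> x x0; have [m hm] := shell1_lc (- i%:Z) x0; have [m' hm'] := shellJ_lc x0.
    exists (`|m|%N + `|m'|%N)%N%:Z => y hy.
    rewrite (hm y) ?(hm' y) //; apply: inP_le hy; lia.
  move=> x; rewrite normcM /shell1; case: ifP => _; first by rewrite normc1 mul1r.
  by rewrite normc0 mul0r normc_ge0.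
split=> //; apply: (unit_absorb r0 vr z1 ci) => x.
rewrite /shell1 /shellJ; have [->|x0] := eqVneq x 0; first by rewrite mulr0 eqxx /= !mul0r mulr0.
rewrite mulf_neq0 // pvM // vr add0r /=.
case: eqP => vx; last by rewrite !mul0r mulr0.
rewrite vx (_ : - i%:Z <= 0); last by lia.
by rewrite h //; ring.
Qed.

Let J1 : F -> C := fun x => ((X / q%:R) ^+ n * rho) * shellJ (p ^+ n * x + 0).

(** [J1] is a dilate of [shellJ] by p^n and carries exactly the shells of valuation at most -n. *)
Lemma shellJ_split x :
  shellJ x = \sum_(i < n) shell1 (- i%:Z) x * shellJ x + J1 x.
Proof.
rewrite /J1 addr0; have [->|x0] := eqVneq x 0.
  by rewrite mulr0 /shellJ eqxx /= mulr0 addr0 big1 // => i _; rewrite mulr0.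
have y0 : p ^+ n * x != 0 by rewrite mulf_neq0 ?expf_neq0.
have vy : v (p ^+ n * x) = n%:Z + v x.
  by rewrite pvM ?expf_neq0 // pvX // vp; lia.
have s0 (i : 'I_n) : ~~ (v x == - i%:Z) -> shell1 (- i%:Z) x * shellJ x = 0.
  by rewrite /shell1 x0 /= => /negbTE ->; rewrite mul0r.
have [vx|vx] := leP (v x) (- n%:Z).
  rewrite big1 ?add0r; last by move=> i _; apply: s0; case: i => i /= iN; lia.
  rewrite {1}/shellJ x0 /= (_ : v x <= 0); last by lia.
  rewrite /shellJ y0 vy /= (_ : n%:Z + v x <= 0); last by lia.
  have -> : Psi x = rho * Psi (p ^+ n * x) by rewrite -perPsi // mulKf ?expf_neq0.
  rewrite (_ : `|v x|%N = (n + `|(n%:Z + v x)%R|)%N); last by lia.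
  by rewrite exprD; ring.
rewrite {3}/shellJ y0 vy /=; case: ifP => [|_]; first by lia.
rewrite mulr0 addr0; have [vx0|vx0] := leP (v x) 0; last first.
  rewrite big1; last by move=> i _; apply: s0; lia.
  by rewrite /shellJ x0 /= leNgt vx0.
have iN : (`|v x| < n)%N by lia.
rewrite (bigD1 (Ordinal iN)) //= big1 ?addr0; last first.
  by move=> i; rewrite -val_eqE /= => hi; apply: s0; lia.
by rewrite /shell1 x0 /= (_ : v x == - `|v x|%N%:Z) ?mul1r //; lia.
Qed.

(** Self-similarity replaces an infinite sum. Dilation by p^n has Jacobian q^n, which cancels the
    q^-n of (X/q)^n, so the integral I satisfies I = (first n shells) + rho X^n I. *)
Lemma shellJ_integral : 1 - rho * X ^+ n != 0 ->
  I shellJ = (1 - q%:R^-1) * V * (\sum_(i < n) X ^+ i * E i) / (1 - rho * X ^+ n).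
Proof.
move=> h0; have pn0 : p ^+ n != 0 by rewrite expf_neq0.
have iJ := shellJ_integrable.
have iJ' := cintegrable_affine hmu 0 pn0 iJ.
have e : I shellJ = (1 - q%:R^-1) * V * (\sum_(i < n) X ^+ i * E i) + rho * X ^+ n * I shellJ.
  rewrite {1}(_ : shellJ = fun x => \sum_(i < n) shell1 (- i%:Z) x * shellJ x + J1 x); last first.
    by apply: funext => x; exact: shellJ_split.
  rewrite cintegralD; last 2 first.
    by apply: cintegrable_sum => i; case: (shellJ_piece (ltn_ord i)).
    exact: cintegrableZ.
  rewrite cintegral_sum; last by move=> i; case: (shellJ_piece (ltn_ord i)).
  congr (_ + _).
    rewrite mulr_sumr; apply: eq_bigr => i _.
    by have [_ ->] := shellJ_piece (ltn_ord i); ring.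
  rewrite /J1 cintegralZ // (cintegral_affine hmu 0 pn0 iJ) pvX // vp.
  rewrite expr_div_n (_ : 1 *+ n = n%:Z :> int); last by rewrite -mulr_natr mul1r natz.
  rewrite -exprnP; have := qC_neq0 => q0; field; rewrite ?q0 ?expf_neq0 //.
apply: (mulIf h0); rewrite divfK //.
rewrite mulrBr mulr1 {1}e; ring.
Qed.

End ShellInt.


Lemma int_least (P : set int) (b m : int) :
  P m -> (forall k, P k -> b <= k) -> exists k, is_least P k.
Proof.
move=> Pm hb; have mb := hb m Pm.
have ex : exists i : nat, `[< P (b + i%:Z) >].
  by exists `|m - b|%N; apply/asboolP; rewrite (_ : _ + _ = m) //; lia.
case: (ex_minnP ex) => i /asboolP Pi hi; exists (b + i%:Z); split=> // k Pk.
have kb := hb k Pk.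
have : (i <= `|k - b|)%N.
  by apply: hi; apply/asboolP; rewrite (_ : _ + _ = k) //; lia.
lia.
Qed.

(** * Self-dual measures and the Weil index *)

Section AddChar.
Context (R : realType) (F : padicField).
Local Notation C := R[i].
Local Notation v := (@pf_v F).
Local Notation q := (res_card F).
Local Notation T := (borelF F).

Lemma normc_root1 (z : C) N : (0 < N)%N -> z ^+ N = 1 -> normc z = 1.
Proof.
move=> N0 /(congr1 (@normc R)); rewrite normcX normc1 => h.
by apply/eqP; rewrite -(@pexpr_eq1 _ _ N) ?normc_ge0 // h.
Qed.

Lemma res_char_pow_P (m : int) : exists k, inP m ((res_char F ^ k)%:R : F).
Proof.
have pP : inP 1 ((res_char F)%:R : F).
  by have := pf_res_char F; rewrite /in_ball => h; apply/orP; right; lia.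
have h k : inP k%:Z ((res_char F ^ k)%:R : F).
  elim: k => [|k ih]; first by rewrite expn0 inP1.
  by rewrite expnS natrM (_ : k.+1%:Z = 1 + k%:Z); [exact: inPM|lia].
by exists `|m|%N; apply: inP_le (h _); lia.
Qed.

Lemma res_char_gt0 : (0 < res_char F)%N.
Proof. by rewrite prime_gt0 // pf_res_char_prime. Qed.

Section One.
Context (psi : F -> C).
Hypothesis (hpsi : add_char psi).

Lemma add_charMn x k : psi (x *+ k) = psi x ^+ k.
Proof.
case: hpsi => hD h0 _; elim: k => [|k ih]; first by rewrite mulr0n.
by rewrite mulrS hD ih exprS.
Qed.

(** Multiplication by a high power of p moves [x] into the kernel of [psi], so psi(x) is a root of
    unity. *)
Lemma add_char_normc x : normc (psi x) = 1.
Proof.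
case: (hpsi) => hD h0 [m hm].
have [k hk] := res_char_pow_P (m - v x).
apply: (@normc_root1 _ (res_char F ^ k)); first by rewrite expn_gt0 res_char_gt0.
rewrite -add_charMn; apply: hm; rewrite -mulr_natl.
have [->|x0] := eqVneq x 0; first by rewrite mulr0 inP0.
by rewrite mulrC inP_scale'.
Qed.

Lemma cond_addP : (exists x, psi x <> 1) ->
  (forall x, inP (cond_add psi) x -> psi x = 1) /\
  (exists2 t, inP (cond_add psi - 1) t & psi t != 1).
Proof.
case: (hpsi) => hD h0 [m hm] [x0 hx0].
have [k [kP kmin]] : exists k, is_least [set m | forall x, inP m x -> psi x = 1] k.
  apply: (@int_least _ (v x0) m) => // j hj; rewrite leNgt; apply/negP => jx.
  apply: hx0; apply: hj; rewrite /in_ball; apply/orP; right; exact: ltW.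
have [h1 h2] : is_least [set m | forall x, inP m x -> psi x = 1] (cond_add psi).
  by apply: xgetPex; exists k.
split=> //; apply: contrapT => no.
have : cond_add psi <= cond_add psi - 1.
  apply: h2 => x hx; apply: contrapT => hx1; apply: no; exists x => //.
  by apply/eqP.
lia.
Qed.

(** Fourier inversion at 0 for the indicator of the integers: its transform is vol times the
    indicator of P^m, of integral vol^2 q^-m, and inversion makes this 1. *)
Lemma self_dual_vol (mu : {measure set T -> \bar R}) m : self_dual psi mu ->
  (forall x, inP m x -> psi x = 1) ->
  (exists2 t, inP (m - 1) t & psi t != 1) ->
  vol mu ^+ 2 = q%:R ^ m.
Proof.
move=> [hmu sd] hm [t ht pt]; case: (hpsi) => hD h0 _.
have sb : schwartz_bruhat (indb R (0 : F) 0).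
  exists 0, 0; split=> x; last by rewrite /indb subr0 => /negbTE ->.
  by move=> y hy; rewrite /indb !subr0 addrC inPDl.
have := sd _ sb 0; rewrite oppr0 {2}/indb subr0 inP0.
have [i0 e0] := cint_indb hmu 0 0; rewrite oppr0 expr0z mul1r in e0.
have inner x : cintegral mu setT (fun y => indb R 0 0 y * psi (y * x)) =
    (vol mu)%:C%C * indb R 0 m x.
  rewrite {2}/indb subr0; case: ifPn => hx.
    rewrite mulr1 -e0; congr cintegral; apply: funext => y.
    rewrite /indb subr0; case: ifPn => hy; last by rewrite mul0r.
    by rewrite mul1r hm //; rewrite -[m]add0r; apply: inPM.
  rewrite mulr0.
  have x0 : x != 0 by apply: contra hx => /eqP ->; rewrite inP0.
  have vx : v x <= m - 1 by move: hx; rewrite inPE //; lia.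
  (* Translation by [y0] preserves the integers and multiplies the integrand by psi(t) <> 1, so the
     integral vanishes. *)
  pose y0 := t / x.
  have y0O : inP 0 y0.
    rewrite /y0 mulrC inP_scale' ?invr_eq0 // pvV // opprK add0r.
    by apply: inP_le ht.
  pose f y := indb R 0 0 y * psi (y * x).
  have fi : cintegrable mu f.
    apply: (@cintegrable_dom _ _ _ 0 f (\1_(pball 0 0))).
    - case: (hpsi) => _ _ [k hk] y _; exists (`|k - v x|%N)%:Z => z hz.
      have -> : z = y + (z - y) by ring.
      have h1 : inP 0 (z - y) by apply: inP_le hz; lia.
      rewrite /f /indb !subr0 addrC inPDl //; case: ifP => _; last by rewrite !mul0r.
      rewrite mulrDl hD (hk ((z - y) * x)) ?mul1r //.
      by rewrite mulrC inP_scale' //; apply: inP_le hz; lia.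
    - exact: (pball_integrable hmu).
    - move=> y; rewrite /f normcM add_char_normc mulr1 /indb indicE.
      case: ifPn => h; first by rewrite mem_set // normc1.
      by rewrite normc0.
  have := cintegral_affine hmu y0 (oner_neq0 F) fi.
  rewrite pv1 expr0z mul1r.
  have -> : (fun y => f (1 * y + y0)) = (fun y => psi (y0 * x) * f y).
    apply: funext => y; rewrite /f mul1r /indb !subr0 addrC inPDl //.
    by case: ifP => _; rewrite ?mul0r ?mulr0 // !mul1r mulrDl hD.
  rewrite cintegralZ // => /eqP; rewrite -subr_eq0 -{2}[cintegral _ _ _]mul1r -mulrBl.
  rewrite {1}/y0 divfK // mulf_eq0 subr_eq0 (negbTE pt) /= => /eqP.
  by [].
have [im em] := cint_indb hmu 0 m.
have -> : (fun x => cintegral mu setT (fun y => indb R 0 0 y * psi (y * x)) * psi (x * 0))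
   = (fun x => (vol mu)%:C%C * indb R 0 m x).
  by apply: funext => x; rewrite inner mulr0 h0 mulr1.
rewrite cintegralZ // em => h.
have qm : (q%:R : C) ^ m != 0 by rewrite expfz_neq0 // qC_neq0.
have : (vol mu ^+ 2)%:C%C = (q%:R ^ m)%:C%C :> C.
  rewrite rmorphXn rmorphXz ?unitfE ?q_neq0 // rmorph_nat.
  by apply: (mulfI (_ : (q%:R : C) ^ (- m) != 0)); rewrite ?expfz_neq0 ?qC_neq0 // -expfzDr ?qC_neq0 // addNr expr0z -[RHS]h expr2 [RHS]mulrCA.
by case.
Qed.

End One.

Lemma Rintegral_scale (m1 m2 : {measure set T -> \bar R}) (c : {nonneg R}) (f : T -> R) :
  (forall A, measurable A -> m1 A = (c%:num%:E * m2 A)%E) ->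
  m2.-integrable setT (EFin \o f) ->
  Rintegral m1 setT f = c%:num * Rintegral m2 setT f.
Proof.
move=> h fi; have /integrableP[mf _] := fi.
have sc (g : T -> \bar R) : measurable_fun setT g -> (forall x, (0 <= g x)%E) ->
    (\int[m1]_x g x = c%:num%:E * \int[m2]_x g x)%E.
  move=> mg g0; rewrite -ge0_integral_mscale //.
  by apply: eq_measure_integral => A mA _; rewrite h.
rewrite /Rintegral [in LHS]integralE [in RHS]integralE.
rewrite [X in fine (X - _)%E]sc //; last exact: measurable_funepos.
rewrite [X in fine (_ - X)%E]sc //; last exact: measurable_funeneg.
have hA := integrable_pos_fin_num measurableT fi.
have hB := integrable_neg_fin_num measurableT fi.
rewrite -(fineK hA) -(fineK hB) -!EFinM -!EFinB /=.
by rewrite mulrBr.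
Qed.

Lemma lim_shift (u w : nat -> R) j : (forall i, w (i + j)%N = u i) ->
  lim (w @ \oo) = lim (u @ \oo).
Proof.
move=> h; rewrite /lim /lim_in; congr xget; apply: funext => l.
rewrite -[RHS]/(u @ \oo --> l) -[LHS]/(w @ \oo --> l) -(cvg_shiftn j w).
by congr (_ @ \oo --> l); apply: funext => i /=; rewrite h.
Qed.

Section Weil.
Context (dx : (F -> C) -> {measure set T -> \bar R}) (hdx : self_dual_family dx).
Context (psi : F -> C) (hpsi : nontrivial_add_char psi).

Definition gauss (k : int) (y : F) : C := if inP k y then psi (y ^+ 2) else 0.

Lemma gauss_integrable (mu : {measure set T -> \bar R}) k : is_haar mu ->
  cintegrable mu (gauss k).
Proof.
move=> hmu; case: (hpsi) => ha _; case: (ha) => hD h0 [m hm].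
apply: (@cintegrable_dom _ _ _ 0 (gauss k) (\1_(pball 0 k))).
- move=> x x0; exists (`|m|%N + `|v x|%N + `|k|%N)%N%:Z => y hy.
  have h1 : inP k (y - x) by apply: inP_le hy; move: (v x) => w; lia.
  have -> : y = x + (y - x) by ring.
  rewrite /gauss addrC inPDl //; case: ifP => // _.
  have -> : ((y - x) + x) ^+ 2 = x ^+ 2 + ((y - x) * (y - x) + (1 + 1) * (x * (y - x))) by ring.
  rewrite hD (hm (_ + _)) ?mulr1 //; apply: inPD.
    by apply: inP_le (inPM hy hy); move: (v x) => w; lia.
  rewrite -[m]add0r; apply: inPM; first by apply: inPD; exact: inP1.
  by rewrite inP_scale' //; apply: inP_le hy; move: (v x) => w; lia.
- exact: (pball_integrable hmu).
- move=> y; rewrite /gauss indicE; case: ifPn => h.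
    by rewrite mem_set ?add_char_normc // /pball /= subr0.
  by rewrite normc0.
Qed.

Lemma cintegral_patch (mu : {measure set T -> \bar R}) (f : F -> C) (D : set F) (P : pred F) :
  D = [set x | P x] ->
  cintegral mu D f = cintegral mu setT (fun x => if P x then f x else 0).
Proof.
move=> ->; apply: eq_ReIm => /=.
  rewrite [LHS]Rintegral_mkcond; congr (Rintegral _ _); apply: funext => x.
  rewrite patchE; case: ifPn => h; first by rewrite (_ : P x = true) //; rewrite inE in h.
  by rewrite notin_setE /= in h; case: ifP => // /h.
rewrite [LHS]Rintegral_mkcond; congr (Rintegral _ _); apply: funext => x.
rewrite patchE; case: ifPn => h; first by rewrite (_ : P x = true) //; rewrite inE in h.
by rewrite notin_setE /= in h; case: ifP => // /h.
Qed.

Lemma add_char_dilate (a : F) : a != 0 -> nontrivial_add_char (fun x => psi (a * x)).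
Proof.
move=> a0; case: (hpsi) => -[hD h0 [m hm]] [x hx]; split; last first.
  by exists (a^-1 * x); rewrite mulVKf.
split=> [y z||]; [by rewrite mulrDr hD|by rewrite mulr0|].
exists (m - v a) => y hy; apply: hm; by rewrite inP_scale'.
Qed.

(** Dilation by a^2 lowers the conductor exponent by 2 v(a). By [self_dual_vol] this gives the ratio
    of the squared volumes, and positivity selects the root. *)
Lemma vol_dilate (a : F) : a != 0 ->
  vol (dx (fun x => psi (a ^+ 2 * x))) = q%:R ^ (- v a) * vol (dx psi).
Proof.
move=> a0; set psi' := fun x => _.
have a20 : a ^+ 2 != 0 by rewrite expf_neq0.
have hpsi' : nontrivial_add_char psi' by exact: add_char_dilate.
have [sd sd'] := (hdx hpsi, hdx hpsi').
have q0 : (q%:R : R) != 0 by exact: q_neq0.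
case: (hpsi) => ha hex; have [c1 [t ht pt]] := cond_addP ha hex.
have e1 := self_dual_vol ha sd c1 (ex_intro2 _ _ t ht pt).
have va2 : v (a ^+ 2) = v a + v a by rewrite expr2 pvM.
have e2 : vol (dx psi') ^+ 2 = q%:R ^ (cond_add psi - (v a + v a)).
  apply: (self_dual_vol hpsi'.1 sd').
    by move=> x hx; apply: c1; rewrite inP_scale' // va2.
  exists ((a ^+ 2)^-1 * t); last by rewrite /psi' mulVKf.
  by rewrite inP_scale' ?invr_eq0 // pvV // va2; apply: inP_le ht; lia.
have p1 := vol_gt0 sd.1; have p2 := vol_gt0 sd'.1.
apply/eqP; rewrite -(@eqrXn2 _ 2) //; last 2 first.
- exact: ltW.
- by rewrite mulr_ge0 ?exprz_ge0 // ltW.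
rewrite exprMn e1 e2 opprD !expfzDr //; apply/eqP.
by rewrite expr2; ring.
Qed.

(** In the substitution x -> b x the self-dual measure contributes q^(-v(b)), the Jacobian q^(v(b)),
    and the domain P^(-r-j) becomes P^-r. The two sequences agree up to a shift of the index, hence
    so do their limits. *)
Lemma weil_index_sq (b : F) (j : nat) : b != 0 -> v b = j%:Z ->
  weil_index dx (fun x => psi (b ^+ 2 * x)) = weil_index dx psi.
Proof.
move=> b0 vb; set psi' := fun x => _.
have b20 : b ^+ 2 != 0 by rewrite expf_neq0.
have hpsi' : nontrivial_add_char psi' by exact: add_char_dilate.
have [sd sd'] := (hdx hpsi, hdx hpsi').
have q0 : (q%:R : R) != 0 by exact: q_neq0.
pose c : {nonneg R} := NngNum (qv_ge0 R F (- v b)).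
have vd : vol (dx psi') = q%:R ^ (- v b) * vol (dx psi) by exact: vol_dilate.
have sc A : measurable A -> dx psi' A = (c%:num%:E * dx psi A)%E.
  move=> mA; apply: (haar_unique (m1 := dx psi') (m2 := mscale c (dx psi))) => // [d m|m].
    transitivity (c%:num%:E * dx psi (pball d m))%E; last by [].
    rewrite (mu_ball sd.1) (mu_ball sd'.1) vd -EFinM; congr EFin; rewrite /=; ring.
  by rewrite (mu_ball sd'.1) ltry.
have cq : q%:R ^ v b * c%:num = 1 :> R by rewrite /= -expfzDr // subrr expr0z.
have key r : cintegral (dx psi') [set x | inP (- (r + j)%N%:Z) x] (fun x => psi' (x ^+ 2)) =
             cintegral (dx psi) [set x | inP (- r%:Z) x] (fun x => psi (x ^+ 2)).
  rewrite !(cintegral_patch _ _ erefl).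
  have g1 := gauss_integrable (- r%:Z) sd.1.
  have g2 := gauss_integrable (- r%:Z) sd'.1.
  have -> : (fun x => if inP (- (r + j)%N%:Z) x then psi' (x ^+ 2) else 0) =
            (fun x => gauss (- r%:Z) (b * x + 0)).
    apply: funext => x; rewrite addr0 /gauss inP_scale' // vb exprMn.
    by rewrite (_ : - r%:Z - j%:Z = - (r + j)%N%:Z) //; lia.
  rewrite (cintegral_affine sd'.1) //.
  have -> : (q%:R : C) ^ v b = (q%:R ^ v b)%:C%C by rewrite rmorphXz ?unitfE ?q_neq0 // rmorph_nat.
  apply: eq_ReIm; rewrite ?ReM ?ImM /= ?mul0r ?subr0 ?addr0.
    rewrite (Rintegral_scale (c := c) sc); last exact: g1.1.
    by rewrite mulrA cq mul1r.
  rewrite (Rintegral_scale (c := c) sc); last exact: g1.2.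
  by rewrite mulrA cq mul1r.
rewrite /weil_index; congr Complex; apply: (@lim_shift _ _ j) => i; by rewrite key.
Qed.

End Weil.
End AddChar.

(** * Complex powers of positive reals and the variable q^-s *)

Section Cpow.
Context (R : realType).
Local Notation C := R[i].

Lemma cpowM (x y : R) (s : C) : 0 < x -> 0 < y -> cpow (x * y) s = cpow x s * cpow y s.
Proof.
move=> x0 y0; apply: eq_ReIm; rewrite ?ReM ?ImM /= lnM ?posrE // mulrDr powRM ?ltW //.
  by rewrite cosD; ring.
by rewrite sinD; ring.
Qed.

Lemma cpow1l (s : C) : cpow 1 s = 1.
Proof. by apply: eq_ReIm; rewrite /= ln1 mulr0 powR1 mul1r ?cos0 ?sin0. Qed.

Lemma cpow_neq0 (x : R) (s : C) : 0 < x -> cpow x s != 0.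
Proof.
move=> x0; apply/eqP => h.
have := cpow1l s; rewrite -(@divff _ x) ?gt_eqF // cpowM ?invr_gt0 // h mul0r => /eqP.
by rewrite eq_sym oner_eq0.
Qed.

Lemma cpowDr (x : R) (s t : C) : 0 < x -> cpow x (s + t) = cpow x s * cpow x t.
Proof.
move=> x0; case: s t => a b [c d].
have e : x `^ (a + c) = x `^ a * x `^ c by rewrite powRD //; apply/implyP => _; rewrite gt_eqF.
apply: eq_ReIm; rewrite ?ReM ?ImM /= mulrDl e.
  by rewrite cosD; ring.
by rewrite sinD; ring.
Qed.

Lemma cpow0r (x : R) : 0 < x -> cpow x 0 = 1.
Proof. by move=> x0; apply: eq_ReIm; rewrite /= powRr0 mul0r mul1r ?cos0 ?sin0. Qed.

Lemma cpowV (x : R) (s : C) : 0 < x -> cpow x^-1 s = (cpow x s)^-1.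
Proof.
move=> x0; apply: (mulfI (cpow_neq0 s x0)); rewrite -cpowM ?invr_gt0 //.
by rewrite divff ?gt_eqF // cpow1l divff // cpow_neq0.
Qed.

Lemma cpowN (x : R) (s : C) : 0 < x -> cpow x (- s) = (cpow x s)^-1.
Proof.
move=> x0; apply: (mulfI (cpow_neq0 s x0)); rewrite -cpowDr //.
by rewrite subrr cpow0r // divff // cpow_neq0.
Qed.

Lemma cpowX (x : R) (s : C) (k : int) : 0 < x -> cpow (x ^ k) s = cpow x s ^ k.
Proof.
move=> x0.
have nat_case (j : nat) : cpow (x ^+ j) s = cpow x s ^+ j.
  by elim: j => [|j ih]; rewrite ?cpow1l // !exprS cpowM ?exprn_gt0 // ih.
case: k => j; first by rewrite -!exprnP nat_case.
by rewrite NegzE -!exprnN cpowV ?exprn_gt0 // nat_case.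
Qed.

Lemma normc_cpow (x : R) (s : C) : 0 < x -> normc (cpow x s) = x `^ complex.Re s.
Proof.
move=> x0; rewrite /cpow /normc !exprMn -mulrDr cos2Dsin2 mulr1 sqrtr_sqr ger0_norm //.
exact: powR_ge0.
Qed.

Lemma cpowMn (x : R) (s : C) k : 0 < x -> cpow x (k%:R * s) = cpow x s ^+ k.
Proof.
move=> x0; elim: k => [|k ih]; first by rewrite mul0r cpow0r.
by rewrite -natr1 mulrDl mul1r cpowDr // ih exprSr.
Qed.

Lemma cpow1r (x : R) : 0 < x -> cpow x 1 = x%:C%C.
Proof.
by move=> x0; apply: eq_ReIm; rewrite /= powRr1 ?ltW // mul0r ?cos0 ?sin0 ?mulr1 ?mulr0.
Qed.

Section Qs.
Context (F : padicField).
Local Notation q := (res_card F).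
Local Notation v := (@pf_v F).

Lemma qR_gt0 : 0 < (q%:R : R). Proof. by rewrite ltr0n; have := q_gt1 F; lia. Qed.

Lemma qR_gt1 : 1 < (q%:R : R). Proof. by rewrite ltr1n; exact: q_gt1. Qed.

Lemma qs_neq0 (s : C) : qs F s != 0.
Proof. exact: cpow_neq0 qR_gt0. Qed.

Lemma qsN (s : C) : qs F (- s) = (qs F s)^-1.
Proof. by rewrite /qs cpowN // qR_gt0. Qed.

Lemma qs_Mn (s : C) k : qs F (k%:R * s) = qs F s ^+ k.
Proof. by rewrite /qs -mulrN cpowMn // qR_gt0. Qed.

Lemma absFE (a : F) : a != 0 -> absF R a = q%:R ^ (- v a).
Proof. by rewrite /absF => /negbTE ->. Qed.

Lemma absF_factor (a : F) (s : C) : a != 0 ->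
  (absF R a)%:C%C * cpow (absF R a) s = q%:R ^ (- v a) * qs F s ^ (v a).
Proof.
move=> a0; rewrite absFE // cpowX ?qR_gt0 //.
rewrite rmorphXz ?unitfE ?q_neq0 // rmorph_nat; congr (_ * _).
by rewrite /qs cpowN ?qR_gt0 // exprz_inv.
Qed.

(** As |q^-s| = q^(-Re s), it suffices that Re s exceed the logarithm of max(B, 1) to base q. *)
Lemma qs_half_plane (B : R) : exists s0 : R, forall s : C, s0 < complex.Re s ->
  normc (qs F s) * B < 1.
Proof.
have lq : 0 < ln (q%:R : R) by rewrite ln_gt0 // qR_gt1.
exists (ln (Num.max B 1) / ln q%:R) => s.
rewrite ltr_pdivrMr // => hs.
have B0 : 0 < Num.max B 1 by rewrite lt_max ltr01 orbT.
rewrite /qs normc_cpow ?qR_gt0 //.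
apply: (@le_lt_trans _ _ (q%:R `^ complex.Re (- s) * Num.max B 1)).
  by rewrite ler_wpM2l ?powR_ge0 // le_max lexx.
rewrite (_ : complex.Re (- s) = - complex.Re s); last by case: s {hs}.
rewrite powRN -ltr_pdivlMl ?invr_gt0 ?powR_gt0 ?qR_gt0 // invrK mulr1.
rewrite -(@ltr_ln R) ?posrE ?powR_gt0 ?qR_gt0 //.
by rewrite ln_powR.
Qed.

End Qs.
End Cpow.

(** * The cover of SL_2 *)

Section Cover.
Context (R : realType) (F : padicField) (n : nat) (iota : root_ident R F n).
Hypotheses (hn : (0 < n)%N) (hpn : coprime (res_char F) n).
Local Notation C := R[i].
Local Notation v := (@pf_v F).
Local Notation q := (res_card F).
Local Notation H := (hil iota).
Local Notation e1 := (root_pow iota 0).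
Local Notation G := (coverSL2 R F n).
Local Notation cm := (cmul iota).

Lemma e1E : sval e1 = 1. Proof. by rewrite /= expr0. Qed.

Lemma mu_eq (e e' : mu_n R n) : sval e = sval e' -> e = e'.
Proof. exact: val_inj. Qed.

Lemma SL2_eq (g g' : SL2 F) : sval g = sval g' -> g = g'.
Proof. exact: val_inj. Qed.

Lemma mul2E (A B : 'M[F]_2) i j : (A *m B) i j = A i 0 * B 0 j + A i 1 * B 1 j.
Proof.
rewrite mxE !big_ord_recl big_ord0 addr0.
by congr (A _ _ * B _ _ + A _ _ * B _ _); apply: val_inj.
Qed.

Lemma mat2_00 (a b c d : F) : mat2 a b c d 0 0 = a. Proof. by rewrite mxE. Qed.
Lemma mat2_01 (a b c d : F) : mat2 a b c d 0 1 = b. Proof. by rewrite mxE. Qed.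
Lemma mat2_10 (a b c d : F) : mat2 a b c d 1 0 = c. Proof. by rewrite mxE. Qed.
Lemma mat2_11 (a b c d : F) : mat2 a b c d 1 1 = d. Proof. by rewrite mxE. Qed.
Definition mat2E := (mat2_00, mat2_01, mat2_10, mat2_11).

Lemma ord2 (i : 'I_2) : i = 0 \/ i = 1.
Proof. by case: i => [[|[|//]]] hi; [left|right]; apply: val_inj. Qed.

Lemma mat2_eta (A : 'M[F]_2) : A = mat2 (A 0 0) (A 0 1) (A 1 0) (A 1 1).
Proof.
by apply/matrixP => i j; case: (ord2 i) => ->; case: (ord2 j) => ->; rewrite mat2E.
Qed.

Lemma mat2_inj (A B : 'M[F]_2) : A 0 0 = B 0 0 -> A 0 1 = B 0 1 ->
  A 1 0 = B 1 0 -> A 1 1 = B 1 1 -> A = B.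
Proof. by move=> h1 h2 h3 h4; rewrite (mat2_eta A) (mat2_eta B) h1 h2 h3 h4. Qed.

Lemma SL2_det (g : SL2 F) : sval g 0 0 * sval g 1 1 - sval g 0 1 * sval g 1 0 = 1.
Proof. by have /eqP := svalP g; rewrite {1}(mat2_eta (sval g)) det_mat2. Qed.

Lemma SL2_mulE (g g' : SL2 F) i j :
  sval (SL2_mul g g') i j = sval g i 0 * sval g' 0 j + sval g i 1 * sval g' 1 j.
Proof. exact: mul2E. Qed.

Definition cocyc (g g' : SL2 F) : C := sval (cocycle iota g g').

Lemma cmul2 (g g' : G) :
  sval (cm g g').2 = cocyc g.1 g'.1 * sval g.2 * sval g'.2.
Proof. by []. Qed.

Lemma cinv2 (g : G) :
  sval (cinv iota g).2 = (cocyc g.1 (SL2_inv g.1))^-1 * (sval g.2)^-1.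
Proof. by []. Qed.

Lemma cocycE g g' : cocyc g g' =
  H (xSL (SL2_mul g g') * (xSL g)^-1) (xSL (SL2_mul g g') * (xSL g')^-1).
Proof. by []. Qed.

Lemma cover_eq (g g' : G) : sval g.1 = sval g'.1 -> sval g.2 = sval g'.2 -> g = g'.
Proof.
by case: g g' => [a b] [c d] /= h1 h2; rewrite (SL2_eq h1) (mu_eq h2).
Qed.

Lemma sval_w : sval (SL2_w F) = mat2 0 1 (-1) 0. Proof. by []. Qed.
Lemma sval_h (a : F) (a0 : a != 0) : sval (SL2_h a0) = mat2 a 0 0 a^-1.
Proof. by []. Qed.
Lemma sval_n x : sval (SL2_n (F := F) x) = mat2 1 x 0 1. Proof. by []. Qed.

Lemma sval_winv : sval (SL2_inv (SL2_w F)) = mat2 0 (-1) 1 0.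
Proof.
have wu : mat2 0 1 (-1) 0 \in (unitmx : {pred 'M[F]_2}).
  by rewrite unitmxE det_mat2 mulr0 sub0r mulrN1 opprK unitr1.
apply: (can_inj (mulKmx wu)).
rewrite /= mulmxV //; apply: mat2_inj; rewrite mul2E !mat2E !mxE /=; ring.
Qed.

Lemma xSL_h (a : F) (a0 : a != 0) : xSL (SL2_h a0) = a^-1.
Proof. by rewrite /xSL /= !mat2E eqxx. Qed.

Lemma xSL_n x : xSL (SL2_n (F := F) x) = 1.
Proof. by rewrite /xSL /= !mat2E eqxx. Qed.

Lemma xSL_w : xSL (SL2_w F) = -1.
Proof. by rewrite /xSL /= !mat2E oppr_eq0 oner_eq0. Qed.

Lemma xSL_1 : xSL (SL2_one F) = 1.
Proof. by rewrite /xSL /= !mxE /= mulr0n eqxx. Qed.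

Lemma xSL_neq0 (g : SL2 F) : xSL g != 0.
Proof.
rewrite /xSL; case: ifPn => // /negPn/eqP c0.
apply/eqP => d0; have := SL2_det g; rewrite c0 d0 !mulr0 subr0 => /eqP.
by rewrite eq_sym oner_eq0.
Qed.

(* [SL2_h] without its proof argument; the value at [0] is the identity. *)
Definition hh (a : F) : SL2 F := insubd (SL2_one F) (mat2 a 0 0 a^-1).

Lemma hhE a (a0 : a != 0) : hh a = SL2_h a0.
Proof. by apply: SL2_eq; rewrite [LHS]val_insubd SL2_h_subproof. Qed.

Lemma n1F : (-1 : F) != 0. Proof. by rewrite oppr_eq0 oner_eq0. Qed.

(** The cocycle contributes (a, -1) and (-1, a), which are inverse to each other; conjugation by w
    therefore inverts the torus and leaves the central coordinate alone. *)
Lemma w_h_w a (a0 : a != 0) (e : mu_n R n) (a1 : a^-1 != 0) :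
  cm (cm (sec iota (SL2_w F)) (SL2_h a0, e)) (cinv iota (sec iota (SL2_w F))) =
  (SL2_h a1, e).
Proof.
have e2 := sval_winv.
apply: cover_eq.
  rewrite [LHS]/(sval (SL2_mul (SL2_mul (SL2_w F) (SL2_h a0)) (SL2_inv (SL2_w F)))).
  by apply: mat2_inj; rewrite !SL2_mulE e2 sval_w !sval_h !mat2E ?invrK; ring.
have x1 : xSL (SL2_inv (SL2_w F)) = 1.
  by rewrite /xSL e2 !mat2E oner_neq0.
have c1 : cocyc (SL2_w F) (SL2_inv (SL2_w F)) = 1.
  rewrite cocycE x1 xSL_w /xSL !SL2_mulE e2 sval_w !mat2E.
  rewrite !(mul0r, mulr0, addr0, add0r) eqxx /= mulrN1 opprK !mul1r invr1 invrN invr1.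
  by rewrite hil1r // n1F.
have x2 : xSL (SL2_mul (SL2_w F) (SL2_h a0)) = - a.
  by rewrite /xSL !SL2_mulE sval_w sval_h !mat2E mulN1r mul0r addr0 oppr_eq0 a0.
have x3 : xSL (SL2_mul (SL2_mul (SL2_w F) (SL2_h a0)) (SL2_inv (SL2_w F))) = a.
  rewrite /xSL !SL2_mulE e2 sval_w sval_h !mat2E.
  by rewrite !(mul0r, mulr0, addr0, add0r, mulr1) eqxx /= mulN1r mulrN1 opprK.
have c2 : cocyc (SL2_w F) (SL2_h a0) = H a (-1).
  rewrite cocycE x2 xSL_w xSL_h invrK invrN invr1 mulrN1 opprK mulNr.
  rewrite -[- (a * a)]mulN1r !hilMr ?mulf_neq0 ?n1F // !hil_self // -!hilMr ?mulf_neq0 ?n1F //.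
  by rewrite !mulrNN !mulr1.
have c3 : cocyc (SL2_mul (SL2_w F) (SL2_h a0)) (SL2_inv (SL2_w F)) = H (-1) a.
  by rewrite cocycE x3 x2 x1 invr1 mulr1 invrN mulrN divff.
rewrite cmul2 (cmul2 (sec iota (SL2_w F))) cinv2.
rewrite [(sec _ _).1]/(SL2_w F) [(cm _ _).1]/(SL2_mul (SL2_w F) (SL2_h a0)) [(sec _ _).2]/e1.
rewrite [(cinv _ _).1]/(SL2_inv (SL2_w F)) [(SL2_h a0, e).1]/(SL2_h a0).
rewrite /fst /snd c1 c2 c3 e1E (hilC iota hn hpn n1F a0) invr1 !mulr1.
by rewrite mulrA mulVf ?mul1r // hil_neq0.
Qed.

End Cover.

(** * Projective representations of the torus and explicit sections *)

Section Sec.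
Context (R : realType) (F : padicField) (n : nat) (iota : root_ident R F n).
Hypotheses (hn : (0 < n)%N) (hpn : coprime (res_char F) n).
Local Notation C := R[i].
Local Notation v := (@pf_v F).
Local Notation q := (res_card F).
Local Notation H := (hil iota).
Local Notation e1 := (root_pow iota 0).
Local Notation G := (coverSL2 R F n).
Local Notation cm := (cmul iota).
Context (V : lmodType C).

(* On the diagonal torus a genuine representation is the same as a projective
   representation [rho] of F^* with multiplier the Hilbert symbol. *)
Definition proj_rep (tau : G -> V -> V) (rho : F -> V -> V) : Prop :=
  [/\ forall a (a0 : a != 0) e u, tau (SL2_h a0, e) u = sval e *: rho a u,
      forall a, a != 0 -> forall (c : C) u w, rho a (c *: u + w) = c *: rho a u + rho a w,
      forall a b, a != 0 -> b != 0 -> forall u, rho a (rho b u) = H b a *: rho (a * b) u &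
      forall u, rho 1 u = u].

Lemma coc_1l g : cocyc iota (SL2_one F) g = 1.
Proof.
have e : SL2_mul (SL2_one F) g = g by apply: SL2_eq; rewrite /= mul1mx.
by rewrite cocycE e xSL_1 invr1 mulr1 divff ?xSL_neq0 // hil1r // xSL_neq0.
Qed.

(** As x(h(a)) = 1/a, the cocycle is (1/b, 1/a), which explains the order of the arguments. *)
Lemma coc_hh a b (a0 : a != 0) (b0 : b != 0) : cocyc iota (SL2_h a0) (SL2_h b0) = H b a.
Proof.
have ab0 : a * b != 0 by rewrite mulf_neq0.
have e : SL2_mul (SL2_h a0) (SL2_h b0) = SL2_h ab0.
  apply: SL2_eq; apply: mat2_inj; rewrite SL2_mulE !sval_h !mat2E ?mulr0 ?mul0r ?addr0 ?add0r //.
  by rewrite invfM.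
rewrite cocycE e !xSL_h !invrK invfM divfK // mulrAC mulVf // mul1r.
by rewrite hilVl ?invr_eq0 // hilVr // invrK.
Qed.

Lemma rep_proj (tau : G -> V -> V) : is_rep iota (cover_H R F n) tau -> genuine tau ->
  proj_rep tau (fun a u => tau (hh a, e1) u).
Proof.
move=> [lin t1 tM] gen.
have hH a (a0 : a != 0) (e : mu_n R n) : cover_H R F n (SL2_h a0, e) by exists a, a0.
have one0 : (1 : F) != 0 by exact: oner_neq0.
have h1 : SL2_h one0 = SL2_one F.
  apply: SL2_eq; rewrite /=; apply: mat2_inj; rewrite !mat2E !mxE /= ?invr1 //.
have hI (e : mu_n R n) : cover_H R F n (SL2_one F, e) by exists 1, one0.
split=> [a a0 e u|a a0 c u w|a b a0 b0 u|u].
- rewrite (hhE a0).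
  have -> : (SL2_h a0, e) = cm (SL2_one F, e) (SL2_h a0, e1).
    apply: cover_eq; first by rewrite /= mul1mx.
    by rewrite cmul2 coc_1l e1E mulr1 mul1r.
  by rewrite tM // gen.
- by rewrite (hhE a0) lin.
- have ab0 : a * b != 0 by rewrite mulf_neq0.
  rewrite (hhE a0) (hhE b0) (hhE ab0) -tM //.
  have -> : cm (SL2_h a0, e1) (SL2_h b0, e1) =
      cm (SL2_one F, cocycle iota (SL2_h a0) (SL2_h b0)) (SL2_h ab0, e1).
    apply: cover_eq.
      rewrite /= mul1mx; apply: mat2_inj; rewrite mul2E !mat2E ?mulr0 ?mul0r ?addr0 ?add0r //.
      by rewrite invfM.
    by rewrite !cmul2 coc_1l e1E !mulr1 mul1r.
  by rewrite tM // gen -coc_hh.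
- by rewrite (hhE one0) h1 t1.
Qed.

Lemma tauw_proj tau rho : proj_rep tau rho ->
  proj_rep (tau_w iota tau) (fun a => rho a^-1).
Proof.
move=> [r1 r2 r3 r4]; split=> [a a0 e u|a a0 c u w|a b a0 b0 u|u].
- have a1 : a^-1 != 0 by rewrite invr_neq0.
  by rewrite /tau_w (w_h_w iota hn hpn a0 e a1) r1.
- by apply: r2; rewrite invr_neq0.
- rewrite r3 ?invr_neq0 // invfM; congr (_ *: _).
  by rewrite hilVl ?invr_neq0 // hilVr // invrK.
- by rewrite invr1 r4.
Qed.

Lemma proj_rep0 tau rho a : proj_rep tau rho -> a != 0 -> rho a 0 = 0.
Proof.
move=> [_ r2 _ _] a0; have := r2 a a0 (-1) 0 0.
by rewrite scaleN1r addNr scaleN1r addNr.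
Qed.

Lemma proj_repZ tau rho a c u : proj_rep tau rho -> a != 0 -> rho a (c *: u) = c *: rho a u.
Proof.
move=> pr a0; have [_ r2 _ _] := pr.
by rewrite -[c *: u]addr0 r2 // (proj_rep0 pr a0) addr0.
Qed.

Section NH.
Context (x a : F) (a0 : a != 0) (e : mu_n R n) (g : G).
Let g' := cm (cm (sec iota (SL2_n x)) (SL2_h a0, e)) g.
Let nh := SL2_mul (SL2_n x) (SL2_h a0).

Lemma nh_c : sval g'.1 1 0 = a^-1 * sval g.1 1 0.
Proof.
rewrite [sval g'.1]/(sval (SL2_mul nh g.1)) SL2_mulE /nh !SL2_mulE sval_n sval_h !mat2E; ring.
Qed.

Lemma nh_d : sval g'.1 1 1 = a^-1 * sval g.1 1 1.
Proof.
rewrite [sval g'.1]/(sval (SL2_mul nh g.1)) SL2_mulE /nh !SL2_mulE sval_n sval_h !mat2E; ring.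
Qed.

Lemma nh_x : xSL g'.1 = a^-1 * xSL g.1.
Proof. by rewrite /xSL nh_c nh_d mulf_eq0 invr_eq0 (negbTE a0) /=; case: ifP. Qed.

Lemma nh_e : sval g'.2 = H (xSL g.1) a^-1 * sval e * sval g.2.
Proof.
have xnh : xSL nh = a^-1.
  by rewrite /xSL /nh !SL2_mulE sval_n sval_h !mat2E !mul0r mulr0 addr0 eqxx /= add0r mul1r.
have E : sval g'.2 = cocyc iota nh g.1 * (cocyc iota (SL2_n x) (SL2_h a0) * sval e1 * sval e) * sval g.2 by [].
rewrite E e1E mulr1.
have -> : cocyc iota (SL2_n x) (SL2_h a0) = 1.
  rewrite cocycE [xSL (SL2_mul _ _)]xnh xSL_n xSL_h invrK invr1 mulr1 mulVf // hil1r // invr_neq0 //.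
rewrite mul1r; congr (_ * _ * _).
rewrite cocycE (nh_x : xSL (SL2_mul nh g.1) = _) xnh invrK mulrAC mulVf // mul1r mulfK ?xSL_neq0 //.
Qed.
End NH.

Context (tau : G -> V -> V) (rho : F -> V -> V) (pr : proj_rep tau rho).
Context (a : int) (a1 : 1 <= a) (Rv Wv : V) (m0 : int) (m01 : 1 <= m0).
Hypotheses (fixR : forall r, inP m0 (r - 1) -> rho r Rv = Rv)
           (fixW : forall r, inP m0 (r - 1) -> rho r Wv = Wv).

(** For an entry c of valuation [k] and X = q^-s this is |c|^(-1-s): the modulus factor and the
    twist of tau_s at h(1/c). *)
Definition fac (X : C) (k : int) : C := q%:R ^ k * X ^ (- k).

(* With [X = q ^ (-s)], the element of I(tau, s) equal, modulo the Borel subgroup,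
   to [Rv] at [w] and wherever [v c <= v d] ((c, d) being the bottom row), to [Wv]
   on the ball [v (c / d) >= a] around the identity, and to [0] elsewhere. This family is stable
   under both intertwining operators. *)
Definition secG (X : C) (g : G) : V :=
  let c := sval g.1 1 0 in let d := sval g.1 1 1 in let e := sval g.2 in
  if (c != 0) && inP (v c) d then (fac X (v c) * e / H (-1) (- c)) *: rho (- c^-1) Rv
  else if (d != 0) && inP (v d + a) c then
    (fac X (v d) * e / (if c == 0 then 1 else H (c / d) d)) *: rho d^-1 Wv
  else 0.

Lemma facD X k j : X != 0 -> fac X (k + j) = fac X k * fac X j.
Proof. by move=> X0; rewrite /fac opprD !expfzDr ?qC_neq0 //; ring. Qed.

(** Left multiplication by n(x) h(b) divides the bottom row by [b], so both cells are preserved; the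
    remaining identity follows from bimultiplicativity of the symbol. *)
Lemma secG_nh X x b (b0 : b != 0) e g : X != 0 ->
  secG X (cm (cm (sec iota (SL2_n x)) (SL2_h b0, e)) g) =
  fac X (- v b) *: tau (SL2_h b0, e) (secG X g).
Proof.
move=> X0; have [r1 r2 r3 r4] := pr; have n1 := n1F F.
have bi : b^-1 != 0 by rewrite invr_neq0.
rewrite /secG nh_c nh_d nh_e r1.
set c := sval g.1 1 0; set d := sval g.1 1 1; set ee := sval g.2.
rewrite !mulf_eq0 invr_eq0 (negbTE b0) /=.
have [c0|c0] := eqVneq c 0.
  have d0 : d != 0 by have := xSL_neq0 g.1; rewrite /xSL -/c c0 eqxx.
  rewrite /= d0 c0 mulr0 !inP0 /=.
  rewrite (proj_repZ _ _ pr b0) r3 ?invr_neq0 // !scalerA invfM invrK; congr (_ *: _).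
  rewrite /xSL -/c -/d c0 eqxx /= pvM // pvV // addrC facD // !hilVr // hilVl //; ring.
rewrite /= /xSL -/c c0 /= pvM // pvV //.
rewrite inP_scale' // pvV // (_ : - v b + v c - - v b = v c); last by ring.
case: ifP => hd.
  rewrite (proj_repZ _ _ pr b0) r3 ?oppr_eq0 ?invr_neq0 // !scalerA invfM invrK mulrN.
  congr (_ *: _).
  rewrite facD // (_ : - (b^-1 * c) = -1 * (b^-1 * c)); last by ring.
  have -> : - c^-1 = -1 * c^-1 by ring.
  have -> : - c = -1 * c by ring.
  rewrite !hilMr ?mulf_neq0 ?invr_neq0 //.
  rewrite !hilMl ?invr_neq0 // !hilVr // !hilVl //.
  have h1 := hil_neq0 iota hn c b; have h2 := hil_neq0 iota hn (-1) b.
  have h3 := hil_neq0 iota hn (-1) c; have h4 := hil_neq0 iota hn (-1) (-1).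
  by field; rewrite ?h1 ?h2 ?h3 ?h4.
have [d0|d0] := eqVneq d 0.
  by rewrite /= (proj_rep0 pr b0) !scaler0.
rewrite /= pvM // pvV // inP_scale' // pvV // (_ : - v b + v d + a - - v b = v d + a); last by ring.
case: ifP => hc; last by rewrite (proj_rep0 pr b0) !scaler0.
rewrite (_ : b^-1 * c / (b^-1 * d) = c / d); last by field; rewrite b0 d0.
rewrite (proj_repZ _ _ pr b0) r3 ?invr_neq0 // !scalerA invfM invrK; congr (_ *: _).
rewrite facD //.
rewrite !hilMr ?mulf_neq0 ?invr_neq0 // !hilMl ?invr_neq0 // !hilVr ?invr_neq0 // !hilVl //.
have h1 := hil_neq0 iota hn c b; have h2 := hil_neq0 iota hn d b.
have h3 := hil_neq0 iota hn c d; have h4 := hil_neq0 iota hn d d.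
by field; rewrite ?h1 ?h2 ?h3 ?h4.
Qed.

Lemma fixR_mul u r (z : V) : u != 0 -> inP 1 (r - 1) -> rho r z = z -> rho (u * r) z = rho u z.
Proof.
move=> u0 hr hz; have [_ _ r3 _] := pr; have [r0 _] := unit1P (lexx _) hr.
by have := r3 u r u0 r0 z; rewrite hz (hil_unit1l iota hn hpn) // scale1r.
Qed.

Lemma unit_quot (m : int) (x y : F) : x != 0 -> inP (v x + m) (y - x) -> inP m (y / x - 1).
Proof.
move=> x0 h; rewrite (_ : y / x - 1 = x^-1 * (y - x)); last by field.
by rewrite inP_scale' ?invr_neq0 // pvV // opprK addrC.
Qed.

Lemma quot_fix (z : V) (x y : F) : x != 0 -> (forall r, inP m0 (r - 1) -> rho r z = z) ->
  inP m0 (y / x - 1) -> rho y^-1 z = rho x^-1 z.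
Proof.
move=> x0 hz h.
have h1 : inP 1 (y / x - 1) by apply: inP_le h.
have [yx0 _] := unit1P (lexx _) h1.
have hi := unit1V m01 h.
rewrite (_ : y^-1 = x^-1 * (y / x)^-1); last by rewrite invf_div mulrA mulVf // mul1r.
by apply: fixR_mul; rewrite ?invr_neq0 //; [exact: inP_le hi|exact: hz].
Qed.

(** A congruence subgroup changes the dominant entry of the bottom row by a factor close to 1, so
    the cell and the vector are unchanged. The delicate point is the central coordinate: around the
    identity the change of (c/d, d) must cancel the cocycle, whose shape depends on which lower left
    entries vanish. *)
Lemma secG_smooth X : exists2 m, (0 < m)%N &
  forall k g, congrK m k -> secG X (cm g (sec iota k)) = secG X g.
Proof.
have n1 := n1F F.
(* One level for both purposes: [m0] for fixing the vectors, [a] for preserving the ball v(c/d) >=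
   a. *)
pose m := (`|m0| + `|a|)%N.
have ml : m0 <= m%:Z by rewrite /m; lia.
have al : a <= m%:Z by rewrite /m; lia.
have m1 : 1 <= m%:Z by apply: le_trans ml.
exists m; first by lia.
move=> k g hk.
have k00 : inP m%:Z (sval k 0 0 - 1) by have := hk 0 0; rewrite mxE.
have k11 : inP m%:Z (sval k 1 1 - 1) by have := hk 1 1; rewrite mxE.
have k01 : inP m%:Z (sval k 0 1) by have := hk 0 1; rewrite mxE subr0.
have k10 : inP m%:Z (sval k 1 0) by have := hk 1 0; rewrite mxE subr0.
have cE : sval (cm g (sec iota k)).1 1 0 = sval g.1 1 0 * sval k 0 0 + sval g.1 1 1 * sval k 1 0.
  exact: SL2_mulE.
have dE : sval (cm g (sec iota k)).1 1 1 = sval g.1 1 0 * sval k 0 1 + sval g.1 1 1 * sval k 1 1.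
  exact: SL2_mulE.
have eE : sval (cm g (sec iota k)).2 = cocyc iota g.1 k * sval g.2.
  by rewrite cmul2 e1E mulr1.
have xg : xSL g.1 = if sval g.1 1 0 != 0 then sval g.1 1 0 else sval g.1 1 1 by [].
have xk : xSL k = if sval k 1 0 != 0 then sval k 1 0 else sval k 1 1 by [].
have xgk : xSL (SL2_mul g.1 k) = if sval (cm g (sec iota k)).1 1 0 != 0
   then sval (cm g (sec iota k)).1 1 0 else sval (cm g (sec iota k)).1 1 1 by [].
have xg0 := xSL_neq0 g.1; have xk0 := xSL_neq0 k; have xgk0 := xSL_neq0 (SL2_mul g.1 k).
rewrite /secG eE; move: (cocycE iota g.1 k).
move: xg xk xgk xg0 xk0 xgk0 cE dE.
move: (xSL _) (xSL _) (xSL _) => xg xk xgk.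
move: (cocyc _ _ _) => coc.
move: (sval (cm _ _).1 1 0) (sval (cm _ _).1 1 1) => c' d'.
move: (sval g.1 1 0) (sval g.1 1 1) (sval g.2) => c d ee.
move: k00 k01 k10 k11; move: (sval k 0 0) (sval k 0 1) (sval k 1 0) (sval k 1 1) => a0 b0 c0 d0.
clear hk eE g k.
move=> ha hb hc hd xgE xkE xgkE xg0 xk0 xgk0 cE dE cocE.
have [ha1 hd1] : inP 1 (a0 - 1) /\ inP 1 (d0 - 1) by split; [apply: inP_le ha|apply: inP_le hd].
have [a00 va0] := unit1P (lexx _) ha1; have [d00 vd0] := unit1P (lexx _) hd1.
case: (boolP ((c != 0) && inP (v c) d)) => [/andP[cn0 cd]|ncd].
  have hc' : inP (v c + m%:Z) (c' - c).
    rewrite cE (_ : _ - c = c * (a0 - 1) + d * c0); last by ring.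
    by apply: inPD; [rewrite addrC inP_scale|apply: inPM].
  have uc : inP m%:Z (c' / c - 1) by exact: unit_quot.
  have uc1 : inP 1 (c' / c - 1) by apply: inP_le uc.
  have [c'0 vc'] : c' != 0 /\ v c' = v c.
    have := @pvD_lt _ c (c' - c) cn0; rewrite (_ : c + (c' - c) = c'); last (by ring); apply.
    by apply: inP_le hc'; clear -m1 al; lia.
  have hd' : inP (v c') d'.
    rewrite dE vc'; apply: inPD.
      by rewrite -[v c]addr0 addrC inP_scale //; apply: inP_le hb; clear -m1; lia.
    by rewrite -[v c]addr0; apply: inPM => //; exact: unit_in_O.
  rewrite c'0 hd' /= vc'.
  have -> : coc = 1.
    by rewrite cocE xgkE c'0 xgE cn0 (hil_unit1l iota hn hpn).
  rewrite mul1r (_ : H (-1) (- c') = H (-1) (- c)); last first.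
    apply: (hil_cong_r iota hn hpn); rewrite ?oppr_eq0 ?oner_eq0 //.
    by rewrite invrN mulrN mulNr opprK.
  congr (_ *: _); rewrite -!invrN; apply: (quot_fix _ fixR); rewrite ?oppr_eq0 //.
  by rewrite invrN mulrN mulNr opprK; apply: inP_le uc.
have [dz|dn0] := eqVneq d 0.
  case/negP: ncd; rewrite dz inP0 andbT; apply: contraNneq xg0 => c0z.
  by rewrite xgE c0z eqxx /= dz.
have vdc : c != 0 -> v d + 1 <= v c.
  by move=> cn0; move: ncd; rewrite cn0 /= inPE //; clear; lia.
have hcd1 : inP (v d + 1) c.
  by have [->|cn0] := eqVneq c 0; rewrite ?inP0 // inPE // vdc.
have hd' : inP (v d + m%:Z) (d' - d).
  rewrite dE (_ : _ - d = d * (d0 - 1) + c * b0); last by ring.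
  apply: inPD; first by rewrite addrC inP_scale.
  by apply: inP_le (inPM hcd1 hb); clear; lia.
have ud : inP m%:Z (d' / d - 1) by exact: unit_quot.
have ud1 : inP 1 (d' / d - 1) by apply: inP_le ud.
have [d'0 vd'] : d' != 0 /\ v d' = v d.
  have := @pvD_lt _ d (d' - d) dn0; rewrite (_ : d + (d' - d) = d'); last (by ring); apply.
  by apply: inP_le hd'; clear -m1; lia.
have hc' : inP (v d + m%:Z) (c' - c * a0).
  rewrite cE addrAC subrr add0r addrC inP_scale' // addrK //.
have caO j : inP j (c * a0) = inP j c by rewrite mulrC inP_divl.
have hc'1 : inP (v d + 1) c'.
  rewrite -(subrK (c * a0) c'); apply: inPD; last by rewrite caO.
  by apply: inP_le hc'; clear -m1 al; lia.
have -> : (c' != 0) && inP (v c') d' = false.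
  apply/negP => /andP[c'0]; rewrite inPE // vd'; move: hc'1; rewrite inPE //; clear; lia.
have hc'a : inP (v d + a) c' = inP (v d + a) c.
  rewrite -(subrK (c * a0) c') inPDl ?caO //.
  by apply: inP_le hc'; clear -m1 al; lia.
rewrite d'0 /= vd' hc'a; case: ifP => // hca.
congr (_ *: _); last by apply: (quot_fix _ fixW) => //; apply: inP_le ud.
suff key : coc / (if c' == 0 then 1 else H (c' / d') d') =
    (if c == 0 then 1 else H (c / d) d)^-1.
  by rewrite -key; ring.
(* Put r = c a0 / (c0 d). Then c' = c0 d (1 + r), and c'/c is (1 + r)/r up to the 1-unit a0, so
   (c'/c, 1 + r) = (1 + r, -r), which is 1 by the Steinberg relation. *)
have c0F : c0 != 0 -> c' != 0 -> c != 0 -> H (c' / c) (c' / c0) = H (c' / c) d.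
  move=> cc0 cc' cc.
  pose r := c * a0 / (c0 * d).
  have r0 : r != 0 by rewrite !mulf_neq0 ?invr_neq0 // mulf_neq0.
  have e1' : c' / (c0 * d) = 1 + r by rewrite /r cE; field; rewrite cc0 dn0.
  have r10 : 1 + r != 0 by rewrite -e1' mulf_neq0 ?invr_neq0 ?mulf_neq0.
  have e2' : c' / c = a0 * ((1 + r) / r).
    by rewrite -e1' /r; field; rewrite cc cc0 dn0 a00.
  have h : H (c' / c) (1 + r) = 1.
    rewrite e2' hilMl ?mulf_neq0 ?invr_neq0 // (hil_unit1l iota hn hpn _ ha1) mul1r.
    rewrite hilMl ?invr_neq0 // hil_self // hilVl // -(hilC iota hn hpn r10 r0).
    rewrite -hilMr // mulN1r.
    by have := @hil_steinberg _ _ _ iota hn hpn (- r); rewrite opprK oppr_eq0; apply.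
  rewrite (_ : c' / c0 = (1 + r) * d); last by rewrite -e1'; field; rewrite cc0 dn0.
  by rewrite hilMr // ?h ?mul1r // mulf_neq0 ?invr_neq0.
have ddcong x : x != 0 -> H x d' = H x d by move=> x0; apply: (hil_cong_r iota hn hpn).
have cdcong : c' != 0 -> H (c' / d') d' = H (c' / d) d.
  move=> cc'; rewrite ddcong ?mulf_neq0 ?invr_neq0 //.
  apply: (hil_cong_l iota hn hpn); rewrite ?mulf_neq0 ?invr_neq0 //.
  rewrite (_ : c' / d' / (c' / d) = (d' / d)^-1); last by field; rewrite dn0 d'0 cc'.
  exact: unit1V.
rewrite cocE xgkE xgE xkE.
have [cz|cn0] := eqVneq c 0.
  rewrite /= invr1; have c'E : c' = d * c0 by rewrite cE cz mul0r add0r.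
  have [c0z|c0n] := eqVneq c0 0.
    have c'z : c' = 0 by rewrite c'E c0z mulr0.
    by rewrite c'z eqxx /= (hil_unit1l iota hn hpn) // invr1 mulr1.
  have c'n : c' != 0 by rewrite c'E mulf_neq0.
  rewrite c'n (negbTE c'n) /= cdcong // c'E mulfK // (mulrC d c0) mulfK //.
  by rewrite divff // hil_neq0.
rewrite /=; have [c0z|c0n] := eqVneq c0 0.
  have c'E : c' = c * a0 by rewrite cE c0z mulr0 addr0.
  have c'n : c' != 0 by rewrite c'E mulf_neq0.
  rewrite c'n (negbTE c'n) /= (hil_unit1l iota hn hpn); last by rewrite c'E mulrAC divff // mul1r.
  rewrite mul1r cdcong //; congr (_^-1).
  apply: (hil_cong_l iota hn hpn); rewrite ?mulf_neq0 ?invr_neq0 //.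
  by rewrite (_ : c' / d / (c / d) = a0) // c'E; field; rewrite cn0 dn0.
(* If c' = 0 the quantity x(gk) jumps from the lower left to the lower right entry, and c0 = -c a0 /
   d. *)
have [c'z|c'n] := eqVneq c' 0; rewrite /=.
  rewrite invr1 mulr1.
  have c0E : c0 = - (c * a0) / d.
    by apply: (mulIf dn0); rewrite divfK //; apply/eqP; rewrite -subr_eq0 opprK mulrC addrC -cE c'z.
  have hdc : H (d' / c) (d' / c0) = H (d / c) (- (d * d / c)).
    transitivity (H (d / c) (d' / c0)).
      apply: (hil_cong_l iota hn hpn); rewrite ?mulf_neq0 ?invr_neq0 //.
      by rewrite (_ : d' / c / (d / c) = d' / d) //; field; rewrite cn0 dn0.
    apply: (hil_cong_r iota hn hpn); rewrite ?oppr_eq0 ?mulf_neq0 ?invr_neq0 //.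
    rewrite (_ : d' / c0 / - (d * d / c) = (d' / d) * a0^-1).
      by apply: unit1M => //; exact: unit1V.
    by rewrite c0E; field; rewrite cn0 dn0 a00 !oppr_eq0 !mulf_neq0.
  rewrite hdc (_ : - (d * d / c) = d * - (d / c)); last by ring.
  rewrite hilMr ?oppr_eq0 ?mulf_neq0 ?invr_neq0 // hilN ?mulf_neq0 ?invr_neq0 // mulr1.
  by rewrite -invf_div hilVl // mulf_neq0 ?invr_neq0.
rewrite c0F // cdcong //.
have -> : H (c' / d) d = H (c' / c) d * H (c / d) d.
  have n1' : c' / c != 0 by rewrite mulf_neq0 ?invr_neq0.
  have n2' : c / d != 0 by rewrite mulf_neq0 ?invr_neq0.
  rewrite -(hilMl iota hn hpn n1' n2' dn0) (_ : c' / d = c' / c * (c / d)) //.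
  by field; rewrite cn0 dn0.
rewrite invfM mulrA divff ?mul1r //.
exact: hil_neq0.
Qed.

End Sec.

(** * Flat sections and continuation *)

Section Flat.
Context (R : realType) (F : padicField) (n : nat) (iota : root_ident R F n).
Hypotheses (hn : (0 < n)%N) (hpn : coprime (res_char F) n).
Local Notation C := R[i].
Local Notation v := (@pf_v F).
Local Notation q := (res_card F).
Local Notation H := (hil iota).
Local Notation e1 := (root_pow iota 0).
Local Notation G := (coverSL2 R F n).
Local Notation cm := (cmul iota).
Context (V : lmodType C).
Context (tau : G -> V -> V) (rho : F -> V -> V) (pr : proj_rep iota tau rho).

Lemma secG_in_I (a : int) (a1 : 1 <= a) (Rv Wv : V) (m0 : int) (m01 : 1 <= m0)
   (fixR : forall r, inP m0 (r - 1) -> rho r Rv = Rv)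
   (fixW : forall r, inP m0 (r - 1) -> rho r Wv = Wv) (s : C) :
  in_I iota tau s (secG iota rho a Rv Wv (qs F s)).
Proof.
split; last exact: (secG_smooth hn hpn pr a1 m01 fixR fixW).
move=> x b b0 e g; rewrite (secG_nh hn hpn pr _ _ _ _ _ _ _ (qs_neq0 F s)).
by rewrite absF_factor // /fac opprK.
Qed.

(* [q ^ vlow g] is the norm of the torus part of [g] in the Iwasawa
   decomposition. *)
Definition vlow (g : SL2 F) : int :=
  if sval g 1 0 == 0 then v (sval g 1 1) else
  if inP (v (sval g 1 0)) (sval g 1 1) then v (sval g 1 0) else v (sval g 1 1).

(** [vlow] is the minimum of the valuations of the bottom row, a zero entry being ignored. In this
    threshold form its behaviour under multiplication reduces to membership in ideals. *)
Lemma vlowP (g : SL2 F) (j : int) : inP j (sval g 1 0) && inP j (sval g 1 1) = (j <= vlow g).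
Proof.
have := xSL_neq0 g; rewrite /vlow /xSL.
move: (sval g 1 0) (sval g 1 1) => c d; have [->|c0] := eqVneq c 0 => /= h.
  by rewrite inP0 inPE.
rewrite !(inPE _ c0); have [->|d0] := eqVneq d 0; first by rewrite !inP0 andbT.
rewrite !inPE //; clear; move: (v c) (v d) => x y.
by case: ifP => hcd; apply/idP/idP; lia.
Qed.

Lemma vlow_nh x b (b0 : b != 0) e (g : G) :
  vlow (cm (cm (sec iota (SL2_n x)) (SL2_h b0, e)) g).1 = vlow g.1 - v b.
Proof.
have key j : (j <= vlow (cm (cm (sec iota (SL2_n x)) (SL2_h b0, e)) g).1) = (j <= vlow g.1 - v b).
  by rewrite -vlowP nh_c nh_d !inP_scale' ?invr_neq0 // pvV // opprK vlowP lerBrDr.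
by apply/eqP; rewrite eq_le -key lexx /= key lexx.
Qed.

(** Right multiplication by an integral matrix preserves bottom rows with entries in P^j, and so
    does its inverse. *)
Lemma vlow_mulK (g k : G) : cover_K k -> vlow (cm g k).1 = vlow g.1.
Proof.
move=> hk.
have cE : sval (cm g k).1 1 0 = sval g.1 1 0 * sval k.1 0 0 + sval g.1 1 1 * sval k.1 1 0.
  exact: SL2_mulE.
have dE : sval (cm g k).1 1 1 = sval g.1 1 0 * sval k.1 0 1 + sval g.1 1 1 * sval k.1 1 1.
  exact: SL2_mulE.
have det := SL2_det k.1.
have cI : sval g.1 1 0 = sval (cm g k).1 1 0 * sval k.1 1 1 - sval (cm g k).1 1 1 * sval k.1 1 0.
  by rewrite cE dE -[LHS]mulr1 -[X in _ * X = _]det; ring.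
have dI : sval g.1 1 1 = sval (cm g k).1 1 1 * sval k.1 0 0 - sval (cm g k).1 1 0 * sval k.1 0 1.
  by rewrite cE dE -[LHS]mulr1 -[X in _ * X = _]det; ring.
have mO j (x y : F) : inP j x -> inP 0 y -> inP j (x * y).
  by move=> h1 h2; rewrite -[j]addr0; apply: inPM.
have key j : (j <= vlow (cm g k).1) = (j <= vlow g.1).
  rewrite -!vlowP; apply/andP/andP => -[h1 h2].
    by rewrite cI dI; split; apply: inPB; apply: mO => //; apply: hk.
  by rewrite cE dE; split; apply: inPD; apply: mO => //; apply: hk.
by apply/eqP; rewrite eq_le -key lexx /= key lexx.
Qed.

Lemma vlow_K (k : G) : cover_K k -> vlow k.1 = 0.
Proof.
move=> hk; apply/eqP; rewrite eq_le -vlowP !hk !andbT.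
rewrite leNgt; apply/negP => h.
have /andP[hc hd] : inP 1 (sval k.1 1 0) && inP 1 (sval k.1 1 1) by rewrite vlowP.
have : inP 1 (1 : F).
  rewrite -[X in inP 1 X](SL2_det k.1); apply: inPB.
    by rewrite -[1]add0r; apply: inPM.
  by rewrite -[1]add0r; apply: inPM.
by rewrite inPE ?oner_eq0 // pv1.
Qed.

(** Multiplication by |torus part|^(s - s0), which is 1 on the maximal compact subgroup: the flat
    section through [f]. *)
Definition ext (s0 : C) (f : G -> V) (s : C) : G -> V :=
  fun g => (qs F s / qs F s0) ^ (- vlow g.1) *: f g.

Lemma congrK_cover m k : (0 < m)%N -> congrK m k -> cover_K (sec iota k).
Proof.
move=> m0 hk i j; change (inP 0 (sval k i j)).
rewrite -(subrK ((1%:M : 'M[F]_2) i j) (sval k i j)); apply: inPD.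
  by apply: inP_le (hk i j).
by rewrite mxE; case: (i == j); rewrite ?inP1 ?inP0.
Qed.

Lemma ext_in_I s0 f s : in_I iota tau s0 f -> in_I iota tau s (ext s0 f s).
Proof.
move=> [h1 [m m0 h2]]; have [r1 _ _ _] := pr; split; last first.
  exists m => // k g hk; rewrite /ext h2 // vlow_mulK //.
  exact: congrK_cover hk.
move=> x a a0 e g; rewrite /ext h1 vlow_nh !r1 (proj_repZ _ _ pr a0) !scalerA; congr (_ *: _).
rewrite !absF_factor //.
have X0 := qs_neq0 F s; have X1 := qs_neq0 F s0.
have Y0 : qs F s / qs F s0 != 0 by rewrite mulf_neq0 ?invr_neq0.
have X1v : qs F s0 ^ v a != 0 by rewrite expfz_neq0.
have eY : (qs F s / qs F s0) ^ v a = qs F s ^ v a / qs F s0 ^ v a.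
  by rewrite expfzMl exprz_inv invr_expz.
rewrite opprB.
rewrite (expfzDr (v a) (- vlow g.1) Y0) eY.
move: (_ ^ (- vlow g.1)) (q%:R ^ (- v a)) (qs F s ^ v a) (sval e) (qs F s0 ^ v a) X1v.
by move=> A B D E K K0; field.
Qed.

Lemma ext_K s0 f s k : cover_K k -> ext s0 f s k = f k.
Proof. by move=> hk; rewrite /ext vlow_K // oppr0 expr0z scale1r. Qed.

Lemma ext_id s0 f : ext s0 f s0 = f.
Proof.
by apply: funext => g; rewrite /ext divff ?qs_neq0 // exp1rz scale1r.
Qed.

Lemma flat_ext s0 f : in_I iota tau s0 f -> flat_section iota tau (ext s0 f).
Proof.
move=> h; split; first by move=> s; exact: ext_in_I.
by move=> s s' k hk; rewrite !ext_K.
Qed.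

Lemma iwasawa (g : G) : exists x a (a0 : a != 0) e k, cover_K k /\
  g = cm (cm (sec iota (SL2_n x)) (SL2_h a0, e)) k.
Proof.
suff [x [a [a0 [k1 [kK gE]]]]] : exists x a (a0 : a != 0) (k1 : SL2 F),
    cover_K (sec iota k1) /\ SL2_mul (SL2_mul (SL2_n x) (SL2_h a0)) k1 = g.1.
  (* The central coordinate absorbs the symbol computed in [nh_e], so that the compact factor can be
     taken in the image of [sec]. *)
  exists x, a, a0, (mu_mul (mu_inv (hilbert iota (xSL k1) a^-1)) g.2), (sec iota k1); split=> //.
  apply: cover_eq; first by rewrite -gE.
  rewrite nh_e // e1E mulr1 [sval (mu_mul _ _)]/((H (xSL k1) a^-1)^-1 * sval g.2).
  by rewrite mulVKf // hil_neq0.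
have det : sval g.1 0 0 * sval g.1 1 1 = 1 + sval g.1 0 1 * sval g.1 1 0.
  by have /eqP := SL2_det g.1; rewrite subr_eq => /eqP.
have := xSL_neq0 g.1; rewrite /xSL.
have h4 (A : 'M[F]_2) : inP 0 (A 0 0) -> inP 0 (A 0 1) -> inP 0 (A 1 0) -> inP 0 (A 1 1) ->
    forall i j, inP 0 (A i j).
  by move=> ? ? ? ? i j; case: (ord2 i) => ->; case: (ord2 j) => ->.
case: (boolP ((sval g.1 1 0 != 0) && inP (v (sval g.1 1 0)) (sval g.1 1 1))).
  move=> /andP[c0 hd] _.
  have ci : (sval g.1 1 0)^-1 != 0 by rewrite invr_neq0.
  have dk : \det (mat2 0 (-1) 1 (sval g.1 1 1 / sval g.1 1 0)) == 1.
    by rewrite det_mat2 mul0r mulN1r sub0r opprK.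
  exists (sval g.1 0 0 / sval g.1 1 0), (sval g.1 1 0)^-1, ci, (exist (fun g : 'M[F]_2 => \det g == 1) _ dk); split.
    apply: h4; rewrite /= !mat2E ?inPN ?inP0 ?inP1 //.
    by rewrite mulrC inP_scale' // pvV // opprK add0r.
  apply: SL2_eq; apply: mat2_inj; rewrite !SL2_mulE sval_n sval_h /= !mat2E ?invrK.
  - by field.
  - transitivity ((sval g.1 0 0 * sval g.1 1 1 - 1) / sval g.1 1 0); first by field.
    by rewrite det addrAC subrr add0r mulfK.
  - by field.
  - by field.
move=> hn1 hx.
have d0 : sval g.1 1 1 != 0.
  apply: contraNneq hn1 => d0; rewrite d0 inP0 andbT.
  by apply: contraNneq hx => c0; rewrite c0 eqxx d0.
have di : (sval g.1 1 1)^-1 != 0 by rewrite invr_neq0.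
have dk : \det (mat2 1 0 (sval g.1 1 0 / sval g.1 1 1) 1) == 1.
  by rewrite det_mat2 mul0r mulr1 subr0.
exists (sval g.1 0 1 / sval g.1 1 1), (sval g.1 1 1)^-1, di, (exist (fun g : 'M[F]_2 => \det g == 1) _ dk); split.
  apply: h4; rewrite /= !mat2E ?inP0 ?inP1 //.
  rewrite mulrC inP_scale' // pvV // opprK add0r.
  move: hn1 hx d0; move: (sval g.1 1 0) (sval g.1 1 1) => c d; clear.
  have [->|c0] := eqVneq c 0; first by rewrite inP0.
  by move=> h1 _ d0; move: h1; rewrite /= !inPE // -ltNge => /ltW.
apply: SL2_eq; apply: mat2_inj; rewrite !SL2_mulE sval_n sval_h /= !mat2E ?invrK.
- transitivity ((1 + sval g.1 0 1 * sval g.1 1 0) / sval g.1 1 1); first by field.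
  by rewrite -det mulfK.
- by field.
- by field.
- by field.
Qed.

Lemma in_I_K s f f' : in_I iota tau s f -> in_I iota tau s f' ->
  (forall k, cover_K k -> f k = f' k) -> f = f'.
Proof.
move=> [h _] [h' _] hK; apply: funext => g.
by have [x [a [a0 [e [k [kK ->]]]]]] := iwasawa g; rewrite h h' hK.
Qed.

(* By the Iwasawa decomposition, so the choice of flat section made in the
   definition of [intertwining] is harmless. *)
Lemma flat_uniq s0 f phi : in_I iota tau s0 f -> flat_section iota tau phi ->
  phi s0 = f -> phi = ext s0 f.
Proof.
move=> hf [p1 p2] p0; apply: funext => s.
apply: (in_I_K (p1 s) (ext_in_I s hf)) => k hk.
by rewrite (p2 s s0) // p0 ext_K.
Qed.

(** [has_integral], and with it [continuation_value], sees [V] only through linear functionals, so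
    uniqueness requires that they separate points. [iso_to_ind_separated] supplies this. *)
Hypothesis sep : forall u : V, (forall l : {scalar V}, l u = 0) -> u = 0.

(** Continuations are tied to integrals only in a right half-plane; this provides infinitely many
    distinct values of q^-s there. *)
Lemma qs_seq (x : R) : exists2 f : nat -> C, injective (fun k => qs F (f k)) &
  forall k, x < complex.Re (f k).
Proof.
have e0 (k : nat) : (k%:R : C) = (k%:R : R)%:C%C by rewrite rmorph_nat.
exists (fun k => Complex (x + 1) 0 + (k%:R : R)%:C%C) => [k j|k]; last first.
  by rewrite /= -addrA ltrDl; exact: ltr_pwDl.
have e (i : nat) : qs F (Complex (x + 1) 0 + (i%:R : R)%:C%C) = qs F (Complex (x + 1) 0 : C) * (q%:R ^+ i)^-1.
  rewrite -e0 /qs opprD cpowDr ?qR_gt0 //; congr (_ * _).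
  rewrite (_ : (i%:R : C) = i%:R * 1); last by rewrite mulr1.
  rewrite (cpowN _ (qR_gt0 R F)) (cpowMn _ _ (qR_gt0 R F)) (cpow1r (qR_gt0 R F)).
  by rewrite rmorph_nat.
rewrite /= !e => /(mulfI (qs_neq0 _ _)) /invr_inj; rewrite -!natrX => /eqP.
rewrite eqr_nat => /eqP; apply: expnI; exact: q_gt1.
Qed.

Lemma poly_zero_seq (p : {poly C}) (f : nat -> C) : injective f ->
  (forall k, p.[f k] = 0) -> p = 0.
Proof.
move=> fi fr; apply/eqP; apply/negP => /negP p0.
have := max_poly_roots p0 (rs := [seq f k | k <- seq.iota 0 (size p)]).
rewrite size_map size_iota ltnn map_inj_uniq // iota_uniq => h.
suff : false by [].
by apply: h => //; apply/allP => x /mapP [j _ ->]; apply/rootP.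
Qed.

(** Under a functional, two continuations become rational functions of q^-s that agree at infinitely
    many points. *)
Lemma continuation_uniq (mu : {measure set (borelF F) -> \bar R}) (Phi : C -> F -> V) s u w :
  continuation_value mu Phi s u -> continuation_value mu Phi s w -> u = w.
Proof.
move=> [n1 [d1 [[s1 h1] dn1 ->]]] [n2 [d2 [[s2 h2] dn2 ->]]].
apply/eqP; rewrite -subr_eq0; apply/eqP; apply: sep => l.
pose P1 : {poly C} := \poly_(i < size n1) l n1`_i.
pose P2 : {poly C} := \poly_(i < size n2) l n2`_i.
have lE (nn : seq V) X : l (\sum_(i < size nn) X ^+ i *: nn`_i) =
    (\poly_(i < size nn) l nn`_i).[X].
  rewrite linear_sum horner_poly; apply: eq_bigr => i _.
  by rewrite linearZ mulrC.
have lr (nn : seq V) (d : C) X : l (d^-1 *: (\sum_(i < size nn) X ^+ i *: nn`_i)) =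
    d^-1 * (\poly_(i < size nn) l nn`_i).[X] by rewrite linearZ lE.
rewrite linearB !lr -/P1 -/P2 /=.
have [f fi hf] := qs_seq (Num.max s1 s2).
(* The extra factors [d1] and [d2] make the identity trivial at the zeros of the denominators, where
   the inverse takes the default value 0. *)
have PP : (P1 * d2 - P2 * d1) * d1 * d2 = 0.
  apply: (poly_zero_seq fi) => k.
  have [k1 k2] : s1 < complex.Re (f k) /\ s2 < complex.Re (f k).
    by have := hf k; rewrite gt_max => /andP.
  have [_ e1'] := h1 _ k1 l; have [_ e2'] := h2 _ k2 l.
  move: e1'; rewrite e2' !lr -/P1 -/P2 /= => e.
  rewrite !hornerM hornerD hornerN !hornerM.
  have [->|a1] := eqVneq d1.[qs F (f k)] 0; first by rewrite mulr0 mul0r.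
  have [->|a2] := eqVneq d2.[qs F (f k)] 0; first by rewrite mulr0.
  suff -> : P1.[qs F (f k)] * d2.[qs F (f k)] - P2.[qs F (f k)] * d1.[qs F (f k)] = 0 by rewrite !mul0r.
  transitivity (d1.[qs F (f k)] * d2.[qs F (f k)] *
    (d1.[qs F (f k)]^-1 * P1.[qs F (f k)] - d2.[qs F (f k)]^-1 * P2.[qs F (f k)])).
    by field; rewrite a1 a2.
  by rewrite e subrr mulr0.
have d10 : d1 != 0 by apply: contraNneq dn1 => ->; rewrite horner0.
have d20 : d2 != 0 by apply: contraNneq dn2 => ->; rewrite horner0.
have : P1 * d2 - P2 * d1 = 0.
  by move/eqP: PP; rewrite !mulf_eq0 (negbTE d10) (negbTE d20) !orbF => /eqP.
move/(congr1 (horner^~ (qs F s))); rewrite /= hornerD hornerN !hornerM horner0 => e.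
transitivity ((d1.[qs F s] * d2.[qs F s])^-1 * (P1.[qs F s] * d2.[qs F s] - P2.[qs F s] * d1.[qs F s])).
  by field; rewrite dn1 dn2.
by rewrite e mulr0.
Qed.

Lemma intertwining_eq (mu : {measure set (borelF F) -> \bar R}) w0 s f g u :
  in_I iota tau s f ->
  continuation_value mu
    (fun s' x => ext s f s' (cm (cm (sec iota w0) (sec iota (SL2_n x))) g)) s u ->
  intertwining iota mu w0 tau s f g = u.
Proof.
move=> hf hu; rewrite /intertwining; apply: xget_unique.
  by exists (ext s f); split; [exact: flat_ext|exact: ext_id|exact: hu].
move=> y [phi [fl p0 hy]]; rewrite (flat_uniq hf fl p0) in hy.
exact: continuation_uniq hy hu.
Qed.

Lemma continuation_rat (mu : {measure set (borelF F) -> \bar R}) (Phi : C -> F -> V) s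
    (N D : {poly C}) (u : V) :
  (exists s0 : R, forall s', s0 < complex.Re s' ->
     has_integral mu (Phi s') ((N.[qs F s'] / D.[qs F s']) *: u)) ->
  D.[qs F s] != 0 ->
  continuation_value mu Phi s ((N.[qs F s] / D.[qs F s]) *: u).
Proof.
move=> h D0.
have e s' : D.[qs F s']^-1 *: (\sum_(i < size [seq c *: u | c <- N]) qs F s' ^+ i *: [seq c *: u | c <- N]`_i)
   = (N.[qs F s'] / D.[qs F s']) *: u.
  rewrite mulrC -scalerA; congr (_ *: _); rewrite horner_coef scaler_suml size_map.
  apply: eq_bigr => i _; rewrite (nth_map 0) // scalerA mulrC //.
exists [seq c *: u | c <- N], D; split=> //; last by rewrite e.
by have [s0 hs0] := h; exists s0 => s' hs'; rewrite e; exact: hs0.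
Qed.

End Flat.

(** * Vector-valued integrals *)

Section HasInt.
Context (R : realType) (F : padicField).
Local Notation C := R[i].
Local Notation v := (@pf_v F).
Local Notation q := (res_card F).
Local Notation T := (borelF F).
Context (mu : {measure set T -> \bar R}) (hmu : is_haar mu).
Context (V : lmodType C).

Definition mk_scalar (f : V -> C) (hf : scalar f) : {scalar V} :=
  HB.pack f (GRing.isLinear.Build C V C *%R f hf).

Lemma mk_scalarE f hf u : @mk_scalar f hf u = f u.
Proof. by []. Qed.

(** A functional composed with [L] is again a functional, so weak integrals commute with linear
    maps. *)
Lemma has_integral_linear (J : F -> V) (I : V) (L : V -> V) :
  (forall (c : C) u w, L (c *: u + w) = c *: L u + L w) ->
  has_integral mu J I -> has_integral mu (fun x => L (J x)) (L I).
Proof.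
move=> hL hJ l.
have hs : scalar (fun u => l (L u)) by move=> c u w; rewrite hL linearP.
exact: (hJ (mk_scalar hs)).
Qed.

Lemma has_integral_affine (J : F -> V) (I : V) a b : a != 0 ->
  has_integral mu J I -> has_integral mu (fun x => J (a * x + b)) (q%:R ^ v a *: I).
Proof.
move=> a0 hJ l; have [h1 h2] := hJ l; split.
  exact: (cintegrable_affine hmu b a0 h1).
by rewrite (cintegral_affine hmu b a0 h1) h2 linearZ.
Qed.

Lemma has_integralZ (J : F -> V) (I : V) (c : C) :
  has_integral mu J I -> has_integral mu (fun x => c *: J x) (c *: I).
Proof.
apply: (has_integral_linear (L := fun u => c *: u)) => d u w.
by rewrite scalerDr !scalerA mulrC.
Qed.

Lemma has_integralD (J J' : F -> V) (I I' : V) :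
  has_integral mu J I -> has_integral mu J' I' ->
  has_integral mu (fun x => J x + J' x) (I + I').
Proof.
move=> h h' l; have [h1 h2] := h l; have [h3 h4] := h' l.
have e : (fun x => l (J x + J' x)) = (fun x => l (J x) + l (J' x)).
  by apply: funext => x; rewrite linearD.
rewrite e; split; first exact: cintegrableD.
by rewrite cintegralD // h2 h4 linearD.
Qed.

Lemma has_integral_vec (f : F -> C) (c : C) (u : V) : cintegrable mu f ->
  cintegral mu setT f = c -> has_integral mu (fun x => f x *: u) (c *: u).
Proof.
move=> fi fc l.
have e : (fun x => l (f x *: u)) = (fun x => l u * f x).
  by apply: funext => x; rewrite linearZ mulrC.
rewrite e; split; first exact: cintegrableZ.
by rewrite cintegralZ // fc linearZ mulrC.
Qed.

Lemma has_integral0 : has_integral mu (fun _ : F => 0 : V) 0.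
Proof.
have := has_integral_vec (0 : V) (cintegrable0 mu) (cintegral0 mu).
by rewrite scaler0; congr has_integral; apply: funext => x; rewrite scaler0.
Qed.

Lemma has_integral_ext (J J' : F -> V) (I I' : V) :
  J =1 J' -> I = I' -> has_integral mu J I -> has_integral mu J' I'.
Proof. by move=> /funext -> ->. Qed.

End HasInt.

(** * Powers of units and the pro-p group of 1-units *)

Section UnitPow.
Context (F : padicField).
Local Notation v := (@pf_v F).
Local Notation q := (res_card F).

(** The cofactor of x - 1 in x^p - 1 is congruent to p, hence lies in the maximal ideal. *)
Lemma unit1_powp (m : int) (x : F) : 1 <= m -> inP m (x - 1) ->
  inP (m + 1) (x ^+ res_char F - 1).
Proof.
move=> m1 h; rewrite -[X in _ - X](expr1n _ (res_char F)) subrXX; apply: inPM => //.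
have h1 : inP 1 (x - 1) by apply: inP_le h.
have pP : inP 1 ((res_char F)%:R : F).
  by have := pf_res_char F; rewrite /in_ball => h2; apply/orP; right; lia.
rewrite -(subrK ((res_char F)%:R) (\sum_(i < _) _)); apply: inPD => //.
have -> : (res_char F)%:R = \sum_(i < res_char F) (1 : F).
  by rewrite sumr_const card_ord.
rewrite -sumrB; apply: inP_sum => i _; rewrite expr1n mulr1.
exact: unit1X.
Qed.

Lemma unit1_powpX (m : nat) (x : F) : inP 1 (x - 1) ->
  inP (m.+1)%:Z (x ^+ (res_char F ^ m) - 1).
Proof.
move=> h; elim: m => [|m ih]; first by rewrite expn0 expr1.
rewrite expnSr exprM (_ : m.+2%:Z = m.+1%:Z + 1); last by lia.
by apply: unit1_powp.
Qed.

(** The exponent is (q - 1) p^m: Fermat leads into 1 + P, then each p-th power gains one digit. A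
    character of the units trivial on some 1 + P^m thus takes only roots of unity as values. *)
Lemma unit_pow_conv (m : nat) : exists2 N, (0 < N)%N &
  forall x : F, x != 0 -> v x = 0 -> inP m%:Z (x ^+ N - 1).
Proof.
exists ((q - 1) * res_char F ^ m)%N.
  by rewrite muln_gt0 expn_gt0 res_char_gt0 andbT; have := q_gt1 F; lia.
move=> x x0 vx; rewrite exprM; apply: inP_le (unit1_powpX _ (fermat x0 vx)); lia.
Qed.

End UnitPow.

Section HilUnit.
Context (R : realType) (F : padicField) (n : nat) (iota : root_ident R F n).
Hypotheses (hn : (0 < n)%N) (hpn : coprime (res_char F) n).
Local Notation C := R[i].
Local Notation v := (@pf_v F).
Local Notation H := (hil iota).
Local Notation om := (omega iota).

Lemma omegaV x : x != 0 -> v x = 0 -> om x^-1 = (om x)^-1.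
Proof.
move=> x0 vx; apply: (mulfI (omega_neq0 iota hn x)).
rewrite -omegaM ?invr_neq0 // ?pvV // ?vx ?oppr0 // !divff ?omega1 //.
exact: omega_neq0.
Qed.

Lemma omegaXz x (k : int) : x != 0 -> v x = 0 -> om (x ^ k) = om x ^ k.
Proof.
move=> x0 vx.
have hX (j : nat) : om (x ^+ j) = om x ^+ j.
  elim: j => [|j ih]; first by rewrite !expr0 omega1.
  by rewrite !exprS omegaM ?expf_neq0 // ?ih // pvX // vx mul0rn.
case: k => j; first by rewrite -!exprnP hX.
by rewrite NegzE -!exprnN omegaV ?expf_neq0 // ?hX // pvX // vx mul0rn.
Qed.

Lemma hil_unit_l r x : r != 0 -> v r = 0 -> H r x = om r ^ v x.
Proof.
by move=> r0 vr; rewrite hilE /tame vr mul0r oppr0 !expr0z mul1r mulr1 omegaXz.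
Qed.

Lemma hilXl a b (k : nat) : a != 0 -> b != 0 -> H (a ^+ k) b = H a b ^+ k.
Proof.
move=> a0 b0; elim: k => [|k ih]; first by rewrite !expr0 hil1l.
by rewrite !exprS hilMl ?expf_neq0 // ih.
Qed.

Lemma hilXr a b (k : nat) : a != 0 -> b != 0 -> H a (b ^+ k) = H a b ^+ k.
Proof.
move=> a0 b0; elim: k => [|k ih]; first by rewrite !expr0 hil1r.
by rewrite !exprS hilMr ?expf_neq0 // ih.
Qed.

Lemma hil_n_l a b : a != 0 -> b != 0 -> H (a ^+ n) b = 1.
Proof. by move=> a0 b0; rewrite hilXl // hiln. Qed.

Lemma hil_n_r a b : a != 0 -> b != 0 -> H a (b ^+ n) = 1.
Proof. by move=> a0 b0; rewrite hilXr // hiln. Qed.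

Lemma hilm1_sq a : a != 0 -> H (-1) a * H (-1) a = 1.
Proof.
move=> a0; rewrite -hilMl ?n1F // mulrNN mulr1 hil1l //.
Qed.

End HilUnit.

Section ExtSec.
Context (R : realType) (F : padicField) (n : nat) (iota : root_ident R F n).
Local Notation C := R[i].
Local Notation v := (@pf_v F).
Context (V : lmodType C) (rho : F -> V -> V) (a : int) (Rv Wv : V).

Lemma fac_shift (X Y : C) (k : int) : X != 0 -> (Y / X) ^ (- k) * fac F X k = fac F Y k.
Proof.
move=> X0; rewrite /fac expfzMl exprz_inv opprK.
have h : X ^ k * X ^ (- k) = 1 by rewrite -expfzDr // subrr expr0z.
move: (_ ^ (- k)) (_ ^ (- k)) (_ ^ k) (_ ^ k) h => A B D E h.
by transitivity (E * B * (D * A)); [ring|rewrite h mul1r].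
Qed.

Lemma fac_shift3 (X Y z w : C) (k : int) : X != 0 ->
  (Y / X) ^ (- k) * (fac F X k * z / w) = fac F Y k * z / w.
Proof. by move=> X0; rewrite -(fac_shift Y k X0); move: (fac F X k) (_ ^ _) => A B; ring. Qed.

(** On either cell the section depends on [X] only through [fac] at the exponent [vlow], so letting
    [X] vary is the same as flat extension. *)
Lemma ext_secG s s' g : ext s (secG iota rho a Rv Wv (qs F s)) s' g =
  secG iota rho a Rv Wv (qs F s') g.
Proof.
rewrite /ext /secG /vlow.
move: (sval g.1 1 0) (sval g.1 1 1) (sval g.2) => c d e.
have X0 := qs_neq0 F s; move: (qs F s) (qs F s') X0 => X Y X0.
have key k (z w : C) (u : V) : (Y / X) ^ (- k) *: ((fac F X k * z / w) *: u) = (fac F Y k * z / w) *: u.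
  by rewrite scalerA fac_shift3.
have [c0|c0] := eqVneq c 0; rewrite /=.
  by case: (_ && _); [exact: key|exact: scaler0].
case: (inP _ _); first exact: key.
by case: (_ && _); [exact: key|exact: scaler0].
Qed.

End ExtSec.

(** * The two shell integrals and the character integral over 1-units *)

Section Compute.
Context (R : realType) (F : padicField) (n : nat) (iota : root_ident R F n).
Hypotheses (hn : (0 < n)%N) (hpn : coprime (res_char F) n).
Local Notation C := R[i].
Local Notation v := (@pf_v F).
Local Notation q := (res_card F).
Local Notation H := (hil iota).
Local Notation e1 := (root_pow iota 0).
Local Notation G := (coverSL2 R F n).
Local Notation cm := (cmul iota).
Local Notation om := (omega iota).
Local Notation T := (borelF F).
Context (mu : {measure set T -> \bar R}) (hmu : is_haar mu).
Context (V : lmodType C).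
Hypothesis sep : forall u : V, (forall l : {scalar V}, l u = 0) -> u = 0.
Context (tau : G -> V -> V) (rho : F -> V -> V) (pr : proj_rep iota tau rho).
Context (p : F) (p0 : p != 0) (vp : v p = 1).
Context (v0 : V) (v0n : v0 != 0) (chi0 : F -> C) (eta : C).
Hypotheses (hchi0 : forall r, r != 0 -> v r = 0 -> rho r v0 = chi0 r *: v0)
  (heta : rho (p ^+ n) v0 = eta *: v0).
(** [a] is the least exponent, not below 1, for which chi0 is trivial on 1 + P^a. The floor 1 is the
    origin of the q^-1 in the unramified value. *)
Context (a : int) (a1 : 1 <= a).
Hypotheses (cond_a : forall r, inP a (r - 1) -> chi0 r = 1)
  (cond_min : forall j, 1 <= j -> j < a -> exists2 r, inP j (r - 1) & chi0 r != 1).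
(** [b] records whether chi0 is a power of the tame character on units, with exponent [i0]. Every
    other residue i comes with a unit that kills the shells of valuation -i. *)
Context (b : bool) (i0 : nat) (i0n : (i0 < n)%N).
Hypothesis good : forall i, (i < n)%N ->
  if b && (i == i0) then forall r, r != 0 -> v r = 0 -> chi0 r = om r ^+ i
  else exists r, [/\ r != 0, v r = 0 & chi0 r != om r ^+ i].

Local Notation vol' := ((vol mu)%:C%C : C).
Local Notation kap := ((1 - q%:R^-1) * vol' : C).

Lemma rhoM x y u : x != 0 -> y != 0 -> rho x (rho y u) = H y x *: rho (x * y) u.
Proof. by move=> x0 y0; case: pr => _ _ h _; exact: h. Qed.

Lemma rhoMV x y u : x != 0 -> y != 0 -> rho (x * y) u = (H y x)^-1 *: rho x (rho y u).
Proof. by move=> x0 y0; rewrite rhoM // scalerA mulVf ?scale1r // hil_neq0. Qed.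

Lemma rho1 u : rho 1 u = u. Proof. by case: pr. Qed.

Lemma rhoZ x c u : x != 0 -> rho x (c *: u) = c *: rho x u.
Proof. exact: proj_repZ pr. Qed.

Lemma scale_inj (c d : C) : c *: v0 = d *: v0 -> c = d.
Proof.
move/eqP; rewrite -subr_eq0 -scalerBl scaler_eq0 (negbTE v0n) orbF subr_eq0.
by move/eqP.
Qed.

Lemma chi0M r r' : r != 0 -> v r = 0 -> r' != 0 -> v r' = 0 ->
  chi0 (r * r') = chi0 r * chi0 r'.
Proof.
move=> r0 vr r'0 vr'; apply: scale_inj.
rewrite -hchi0 ?mulf_neq0 // ?pvM // ?vr ?vr' //.
by rewrite rhoMV // hil_units // invr1 scale1r hchi0 // rhoZ // hchi0 // scalerA mulrC.
Qed.

Lemma chi01 : chi0 1 = 1.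
Proof. by apply: cond_a; rewrite subrr inP0. Qed.

Lemma chi0V r : r != 0 -> v r = 0 -> chi0 r * chi0 r^-1 = 1.
Proof.
by move=> r0 vr; rewrite -chi0M ?invr_neq0 // ?pvV ?vr ?oppr0 // divff // chi01.
Qed.

Lemma chi0_neq0 r : r != 0 -> v r = 0 -> chi0 r != 0.
Proof.
move=> r0 vr; apply/eqP => h; have := chi0V r0 vr; rewrite h mul0r => /eqP.
by rewrite eq_sym oner_eq0.
Qed.

Lemma chi0X r k : r != 0 -> v r = 0 -> chi0 (r ^+ k) = chi0 r ^+ k.
Proof.
move=> r0 vr; elim: k => [|k ih]; first by rewrite !expr0 chi01.
by rewrite !exprS chi0M ?expf_neq0 // ?ih // pvX // vr mul0rn.
Qed.

(** A fixed power of every unit lies in 1 + P^a, so the values are roots of unity even when chi is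
    not unitary. *)
Lemma chi0_normc r : r != 0 -> v r = 0 -> normc (chi0 r) = 1.
Proof.
move=> r0 vr; have [N N0 hN] := unit_pow_conv F `|a|%N.
apply: (normc_root1 N0); rewrite -chi0X //; apply: cond_a.
by apply: inP_le (hN r r0 vr); lia.
Qed.

Lemma omega_normc r : normc (om r) = 1.
Proof. exact: normc_root1 hn (omegan iota r). Qed.

Lemma normcXz (z : C) (k : int) : normc z = 1 -> normc (z ^ k) = 1.
Proof.
move=> h; case: k => j; first by rewrite -exprnP normcX h expr1n.
by rewrite NegzE -exprnN normcV normcX h expr1n invr1.
Qed.

Lemma eta_neq0 : eta != 0.
Proof.
apply/eqP => h; have := rhoM v0 (_ : (p ^+ n)^-1 != 0) (_ : p ^+ n != 0).
rewrite heta h scale0r (proj_rep0 pr) ?invr_neq0 ?expf_neq0 // mulVf ?expf_neq0 // rho1.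
move=> /(_ isT isT)/esym/eqP; rewrite scaler_eq0 (negbTE v0n) orbF.
by rewrite (negbTE (hil_neq0 iota hn _ _)).
Qed.

Lemma fix_v0 r : inP a (r - 1) -> rho r v0 = v0.
Proof.
move=> hr; have hr1 : inP 1 (r - 1) by apply: inP_le hr.
have [r0 vr] := unit1P (lexx _) hr1.
by rewrite hchi0 // cond_a // scale1r.
Qed.

Lemma rho_comm1 x r u : x != 0 -> inP 1 (r - 1) -> rho r (rho x u) = rho x (rho r u).
Proof.
move=> x0 hr; have [r0 _] := unit1P (lexx _) hr.
by rewrite !rhoM // hil_unit1r // hil_unit1l // mulrC.
Qed.

Definition Psi1 (t : F) : V := rho t^-1 v0.

Lemma Psi1_unit r x : r != 0 -> v r = 0 -> x != 0 ->
  Psi1 (r * x) = (om r ^ (- v x) / chi0 r) *: Psi1 x.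
Proof.
move=> r0 vr x0; rewrite /Psi1 invfM mulrC rhoMV ?invr_neq0 //.
have vri : v r^-1 = 0 by rewrite pvV // vr oppr0.
rewrite hchi0 ?invr_neq0 // rhoZ ?invr_neq0 // scalerA; congr (_ *: _).
rewrite hilVl ?invr_neq0 // hilVr // invrK hil_unit_l // invr_expz; congr (_ * _).
by apply: (mulfI (chi0_neq0 r0 vr)); rewrite chi0V // divff // chi0_neq0.
Qed.

Lemma Psi1_per x : x != 0 -> Psi1 (p ^- n * x) = eta *: Psi1 x.
Proof.
move=> x0; rewrite /Psi1 invfM invrK mulrC rhoMV ?invr_neq0 ?expf_neq0 //.
by rewrite hil_n_l ?invr_neq0 // invr1 scale1r heta rhoZ ?invr_neq0.
Qed.

Lemma Psi1_lc : loc_const 0 Psi1.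
Proof.
move=> x x0; exists (v x + a) => y hy.
have h := unit_quot x0 hy; have h1 : inP 1 (y / x - 1) by apply: inP_le h.
have [u0 vu] := unit1P (lexx _) h1.
rewrite -(divfK x0 y) Psi1_unit // cond_a // divr1.
by rewrite omega_unit1 // exp1rz scale1r.
Qed.

Definition shellJV (Psi : F -> V) (X : C) (x : F) : V :=
  if (x != 0) && (v x <= 0) then (X / q%:R) ^+ `|v x| *: Psi x else 0.

Lemma half_plane_neq0 (B : R) (e X : C) : 1 <= B -> normc e <= B -> normc X * B < 1 ->
  1 - e * X ^+ n != 0.
Proof.
move=> B1 hB XB; rewrite subr_eq0; apply/eqP => /(congr1 (@normc R)).
rewrite normc1 normcM normcX => h; have : normc e * normc X ^+ n < 1.
  have X0 := normc_ge0 X.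
  have X1 : normc X <= 1 by apply: le_trans (ltW XB); rewrite ler_peMr.
  apply: le_lt_trans XB; rewrite mulrC.
  apply: ler_pM; rewrite ?exprn_ge0 ?normc_ge0 //.
  by case: (n) hn => // k _; rewrite exprS ler_piMr // exprn_ile1.
by rewrite -h ltxx.
Qed.

(* On the shell [v x = - k] only a [Psi] invariant under units has a non-zero
   integral, and the shells repeat geometrically with ratio [rh * X ^+ n]. *)
Lemma shellJV_integral (Psi : F -> V) (rh : C) (E : nat -> V) :
  loc_const 0 Psi ->
  (forall x, x != 0 -> Psi (p ^- n * x) = rh *: Psi x) ->
  (forall r x, r != 0 -> v r = 0 -> x != 0 -> exists2 z, normc z = 1 & Psi (r * x) = z *: Psi x) ->
  (forall i, (i < n)%N ->
    (forall r, r != 0 -> v r = 0 -> Psi (r * p ^- i) = E i) \/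
    (E i = 0 /\ exists r z, [/\ r != 0, v r = 0, z != 1 &
       forall x, x != 0 -> v x = - i%:Z -> Psi (r * x) = z *: Psi x])) ->
  exists s0 : R, forall s : C, s0 < complex.Re s ->
    has_integral mu (shellJV Psi (qs F s))
      ((kap / (1 - rh * qs F s ^+ n)) *: \sum_(i < n) qs F s ^+ i *: E i).
Proof.
move=> lc per nrm hE.
pose B := Num.max 1 (normc rh).
have B1 : 1 <= B by rewrite le_max lexx.
have hB : normc rh <= B by rewrite le_max lexx orbT.
have [s0 hs0] := qs_half_plane F B.
exists s0 => s hs l; have XB := hs0 s hs; set X := qs F s in XB *.
pose Psil x := l (Psi x).
have lcl : loc_const 0 Psil by move=> x /lc [m hm]; exists m => y /hm; rewrite /Psil => ->.
have perl x : x != 0 -> Psil (p ^- n * x) = rh * Psil x by move=> x0; rewrite /Psil per // linearZ.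
have nrml r x : r != 0 -> v r = 0 -> x != 0 -> normc (Psil (r * x)) = normc (Psil x).
  by move=> r0 vr x0; have [z z1 h] := nrm r x r0 vr x0; rewrite /Psil h linearZ normcM z1 mul1r.
have hEl i : (i < n)%N ->
    (forall r, r != 0 -> v r = 0 -> Psil (r * p ^- i) = l (E i)) \/
    (l (E i) = 0 /\ exists r z, [/\ r != 0, v r = 0, z != 1 &
       forall x, x != 0 -> v x = - i%:Z -> Psil (r * x) = z * Psil x]).
  move=> iN; have [h|[h [r [z [r0 vr z1 hz]]]]] := hE i iN; [left|right].
    by move=> r r0 vr; rewrite /Psil h.
  split; first by rewrite h linear0.
  by exists r, z; split=> // x x0 vx; rewrite /Psil hz // linearZ.
have h0 : 1 - rh * X ^+ n != 0 by apply: half_plane_neq0 hB XB.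
have iJ := shellJ_integrable hmu p0 vp hn lcl perl nrml B1 hB XB.
have eJ := shellJ_integral hmu p0 vp hn lcl perl nrml hEl B1 hB XB h0.
have e : (fun x => l (shellJV Psi X x)) = shellJ Psil X.
  apply: funext => x; rewrite /shellJV /shellJ; case: ifP => _; last by rewrite linear0.
  by rewrite linearZ.
rewrite e; split; first exact: iJ.
rewrite eJ [RHS]linearZ linear_sum mulrAC; congr (_ * _).
by apply: eq_bigr => i _; rewrite [RHS]linearZ.
Qed.

(** The value of [Psi1] at p^(-i0), a representative of the only class of shells that can
    contribute. *)
Definition w0 : V := rho (p ^+ i0) v0.

Definition cR (X : C) : C := b%:R * kap * X ^+ i0 / (1 - eta * X ^+ n).

Lemma sum_one_residue (X : C) (f : nat -> V) :
  \sum_(i < n) X ^+ i *: (if b && (i == i0 :> nat) then f i else 0) =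
  (b%:R * X ^+ i0) *: f i0.
Proof.
rewrite (bigD1 (Ordinal i0n)) //= eqxx andbT big1 ?addr0.
  by case: b; rewrite ?mul1r // mul0r scale0r scaler0.
by move=> i; rewrite -val_eqE /= => /negbTE ->; rewrite andbF scaler0.
Qed.

Lemma shell_Psi1_integral : exists s0 : R, forall s : C, s0 < complex.Re s ->
  has_integral mu (shellJV Psi1 (qs F s)) (cR (qs F s) *: w0).
Proof.
have [||||s0 hs0] := @shellJV_integral Psi1 eta
   (fun i => if b && (i == i0) then rho (p ^+ i) v0 else 0).
- exact: Psi1_lc.
- exact: Psi1_per.
- move=> r x r0 vr x0; exists (om r ^ (- v x) / chi0 r); last exact: Psi1_unit.
  by rewrite normcM normcV chi0_normc // invr1 mulr1 normcXz // omega_normc.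
- move=> i iN; have := good iN; case: ifP => _ h; [left=> r r0 vr|right].
    have [q1 q2] := pX0 p0 vp i.
    rewrite Psi1_unit // q2 opprK h // divff ?scale1r; first by rewrite /Psi1 invrK.
    by rewrite expf_neq0 // omega_neq0.
  split=> //; case: h => r [r0 vr hr]; exists r, (om r ^+ i / chi0 r); split=> //.
    apply: contraNneq hr => e; apply/eqP.
    by rewrite -[LHS]mul1r -e divfK // chi0_neq0.
  by move=> x x0 vx; rewrite Psi1_unit // vx opprK.
exists s0 => s hs; have := hs0 s hs.
rewrite (sum_one_residue _ (fun i => rho (p ^+ i) v0)) scalerA.
by congr has_integral; congr (_ *: _); rewrite /cR; ring.
Qed.

(** In the second integral the unit character is omega^i0 itself, so the other shells vanish because
    the powers of [omega] are distinct on units. *)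
Hypothesis gen : forall i, (i < n)%N -> i != i0 ->
  exists r, [/\ r != 0, v r = 0 & om r ^+ i != om r ^+ i0].

(** The integrand of the second operator at w, where the bottom row is (-x, 1); this accounts for
    the factor (-1, x)^-1. *)
Definition Psi2 (x : F) : V := (H (-1) x)^-1 *: rho x w0.

Lemma w0_unit r : b -> r != 0 -> v r = 0 -> rho r w0 = (om r ^+ i0)^-1 *: w0.
Proof.
move=> hb r0 vr; have := good i0n; rewrite hb eqxx /= => hg.
have pi0 : p ^+ i0 != 0 by rewrite expf_neq0.
rewrite /w0 rhoM // mulrC rhoMV // hchi0 // rhoZ // !scalerA; congr (_ *: _).
have hC : H (p ^+ i0) r = (H r (p ^+ i0))^-1 by apply: hilC.
rewrite hC hil_unit_l // pvX // vp hg // (_ : 1 *+ i0 = i0%:Z :> int); last by rewrite -mulr_natr mul1r natz.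
rewrite -exprnP; have := omega_neq0 iota hn r => o0.
by field; rewrite expf_neq0.
Qed.

Lemma w0_fix r : inP a (r - 1) -> rho r w0 = w0.
Proof.
move=> hr; have hr1 : inP 1 (r - 1) by apply: inP_le hr.
by rewrite /w0 rho_comm1 ?expf_neq0 // fix_v0.
Qed.

Lemma Psi2_unit r x : b -> r != 0 -> v r = 0 -> x != 0 ->
  Psi2 (r * x) = (om r ^ (- v x) / om r ^+ i0) *: Psi2 x.
Proof.
move=> hb r0 vr x0; rewrite /Psi2 hilMr ?n1F //.
have -> : H (-1) r = 1 by rewrite hil_units // pvN pv1.
rewrite mul1r mulrC rhoMV // w0_unit // rhoZ // !scalerA; congr (_ *: _).
rewrite (hil_unit_l iota hn hpn x r0 vr) invr_expz; ring.
Qed.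

Lemma pVn_v0 : rho (p ^- n) v0 = eta^-1 *: v0.
Proof.
have pn : p ^+ n != 0 by rewrite expf_neq0.
have h : rho (p ^- n) (rho (p ^+ n) v0) = v0.
  by rewrite rhoM ?invr_neq0 // mulVf // rho1 hil_n_l ?invr_neq0 // scale1r.
move: h; rewrite heta rhoZ ?invr_neq0 // => h.
by rewrite -{2}h scalerA mulVf ?scale1r // eta_neq0.
Qed.

Lemma w0_per : rho (p ^- n) w0 = eta^-1 *: w0.
Proof.
have pn : p ^+ n != 0 by rewrite expf_neq0.
have pni : p ^- n != 0 by rewrite invr_neq0.
have pi0 : p ^+ i0 != 0 by rewrite expf_neq0.
rewrite /w0 rhoM // mulrC rhoMV // pVn_v0 rhoZ // !scalerA; congr (_ *: _).
rewrite hilVr // hilVl // hil_n_r // hil_n_l // invr1 invr1 !mul1r //.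
Qed.

Lemma Psi2_per x : x != 0 -> Psi2 (p ^- n * x) = eta^-1 *: Psi2 x.
Proof.
move=> x0; have pn : p ^+ n != 0 by rewrite expf_neq0.
have pni : p ^- n != 0 by rewrite invr_neq0.
rewrite /Psi2 hilMr ?n1F // hilVr ?n1F // hil_n_r ?n1F // invr1 mul1r.
rewrite mulrC rhoMV // w0_per rhoZ // !scalerA; congr (_ *: _).
by rewrite hilVl // hil_n_l // !invr1 ?mul1r ?mulr1 mulrC.
Qed.

Lemma Psi2_lc : b -> loc_const 0 Psi2.
Proof.
move=> hb x x0; exists (v x + a) => y hy.
have h := unit_quot x0 hy; have h1 : inP 1 (y / x - 1) by apply: inP_le h.
have [u0 vu] := unit1P (lexx _) h1.
rewrite -(divfK x0 y) Psi2_unit // omega_unit1 //.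
by rewrite exp1rz expr1n divff ?oner_neq0 // scale1r.
Qed.

(** The second operator leads back to [v0] without a sign: the symbols combine to (-1, p)^(i0 +
    i0^2), whose exponent is even. *)
Lemma Psi2_i0 : Psi2 (p ^- i0) = v0.
Proof.
have pi0 : p ^+ i0 != 0 by rewrite expf_neq0.
rewrite /Psi2 /w0 rhoM ?invr_neq0 // mulVf // rho1 scalerA hilVr ?n1F // invrK.
rewrite hilVr // hilXr ?n1F // hilXl // hilXr // hil_self //.
have -> : H p (-1) = H (-1) p.
  have hs := hilm1_sq iota hn hpn p0.
  rewrite (hilC iota hn hpn p0 (n1F F)); apply: (mulfI (hil_neq0 iota hn (-1) p)).
  by rewrite hs divff // hil_neq0.
have hs := hilm1_sq iota hn hpn p0.
have hiv : (H (-1) p)^-1 = H (-1) p.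
  by apply: (mulfI (hil_neq0 iota hn (-1) p)); rewrite hs divff // hil_neq0.
rewrite -exprVn -exprVn hiv -exprM -exprD.
have : exists k, (i0 + i0 * i0 = k + k)%N.
  elim: (i0) => [|k [j hj]]; first by exists 0%N.
  by exists (j + k + 1)%N; lia.
by case=> k ->; rewrite exprD -exprMn hs expr1n scale1r.
Qed.

Lemma shell_Psi2_integral : b -> exists s0 : R, forall s : C, s0 < complex.Re s ->
  has_integral mu (shellJV Psi2 (qs F s))
    ((kap * qs F s ^+ i0 / (1 - eta^-1 * qs F s ^+ n)) *: v0).
Proof.
move=> hb.
have [||||s0 hs0] := @shellJV_integral Psi2 eta^-1
   (fun i => if b && (i == i0) then v0 else 0).
- exact: Psi2_lc.
- exact: Psi2_per.
- move=> r x r0 vr x0; exists (om r ^ (- v x) / om r ^+ i0); last exact: Psi2_unit.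
  by rewrite normcM normcV normcX omega_normc expr1n invr1 mulr1 normcXz // omega_normc.
- move=> i iN; rewrite hb /=; case: eqP => [->|/eqP ii0]; [left=> r r0 vr|right].
    have [q1 q2] := pX0 p0 vp i0.
    rewrite Psi2_unit // q2 opprK divff ?scale1r; first exact: Psi2_i0.
    by rewrite expf_neq0 // omega_neq0.
  split=> //; have [r [r0 vr hr]] := gen iN ii0.
  exists r, (om r ^+ i / om r ^+ i0); split=> //.
    apply: contraNneq hr => e; apply/eqP.
    by rewrite -[RHS]mul1r -e divfK // expf_neq0 // omega_neq0.
  by move=> x x0 vx; rewrite Psi2_unit // vx opprK.
exists s0 => s hs; have := hs0 s hs.
rewrite (sum_one_residue _ (fun=> v0)) scalerA hb mul1r.
by congr has_integral; congr (_ *: _); ring.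
Qed.

(** For j < a the minimality of [a] gives a 1-unit on which chi0 is non-trivial, and the integral
    vanishes. This is why the inner cell of [secG] is the ball v(c/d) >= a. *)
Lemma unit_ball_character_integral (j : int) : 1 <= j ->
  has_integral mu (fun t => (indb R (1 : F) j t / chi0 t) *: v0)
    ((if a <= j then q%:R ^ (- j) * vol' else 0) *: v0).
Proof.
move=> j1; have [i1 e1'] := cint_indb hmu 1 j.
have fE t : indb R (1 : F) j t / chi0 t = if inP j (t - 1) then (chi0 t)^-1 else 0.
  by rewrite /indb; case: ifP => _; rewrite ?mul1r ?mul0r.
have fi : cintegrable mu (fun t => indb R (1 : F) j t / chi0 t).
  apply: (@cintegrable_dom _ _ _ 0 _ (\1_(pball 1 j))); last 2 first.
  - exact: pball_integrable hmu _ _.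
  - move=> t; rewrite fE indicE; case: ifPn => h; last by rewrite normc0.
    have [t0 vt] := unit1P j1 h.
    by rewrite normcV chi0_normc // invr1 mem_set.
  move=> x x0; exists (`|j|%N + `|a|%N + `|v x|%N)%N%:Z => y hy.
  have hj : inP j (y - x) by apply: inP_le hy; move: (v x) => w; lia.
  rewrite !fE (_ : y - 1 = (y - x) + (x - 1)); last by ring.
  rewrite (inPDl _ hj); case: ifP => // h.
  have [_ vx] := unit1P j1 h; congr (_^-1).
  have hu : inP a (y / x - 1).
    by apply: unit_quot => //; rewrite vx add0r; apply: inP_le hy; move: (v x) => w; lia.
  have hu1 : inP 1 (y / x - 1) by apply: inP_le hu.
  have [u0 vu] := unit1P (lexx _) hu1.
  by rewrite -{1}(divfK x0 y) chi0M // cond_a // mul1r.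
case: ifP => haj.
  apply: has_integral_vec => //; rewrite -e1'; congr cintegral; apply: funext => t.
  rewrite fE /indb; case: ifP => // h; rewrite cond_a ?invr1 //.
  by apply: inP_le h.
have ja : j < a by rewrite ltNge haj.
have [r hr cr] := cond_min j1 ja.
have [r0 vr] := unit1P j1 hr.
apply: has_integral_vec => //.
apply: (unit_absorb hmu r0 vr (z := (chi0 r)^-1)) => //.
  by rewrite invr_eq1.
move=> t; rewrite !fE.
have -> : inP j (r * t - 1) = inP j (t - 1).
  rewrite (_ : r * t - 1 = r * (t - 1) + (r - 1)); last by ring.
  by rewrite addrC (inPDl _ hr) inP_divl.
case: ifP => h; last by rewrite mulr0.
by have [t0 vt] := unit1P j1 h; rewrite chi0M // invfM.
Qed.

Lemma hilm1C u : u != 0 -> H u (-1) = H (-1) u.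
Proof.
move=> u0; rewrite (hilC iota hn hpn u0 (n1F F)).
apply: (mulfI (hil_neq0 iota hn (-1) u)).
by rewrite (hilm1_sq iota hn hpn u0) divff // hil_neq0.
Qed.

Lemma fac_neg (X : C) (k : int) : X != 0 -> k <= 0 -> fac F X k = (X / q%:R) ^+ `|k|.
Proof.
move=> X0 k0; rewrite /fac (_ : - k = `|k|%N%:Z); last by clear -k0; lia.
rewrite (_ : k = - `|k|%N%:Z) ?abszN ?absz_nat; last by clear -k0; lia.
by rewrite -exprnN -exprnP expr_div_n mulrC.
Qed.

Lemma wn_row (x : F) : sval (SL2_mul (SL2_w F) (SL2_n x)) 1 0 = -1 /\
  sval (SL2_mul (SL2_w F) (SL2_n x)) 1 1 = - x.
Proof. by rewrite !SL2_mulE sval_w sval_n !mat2E; split; ring. Qed.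

Lemma wn_g (g : G) (x : F) : let g' := cm (cm (sec iota (SL2_w F)) (sec iota (SL2_n x))) g in
  let u := sval g.1 0 0 + x * sval g.1 1 0 in
  [/\ sval g'.1 1 0 = - u, sval g'.1 1 1 = - (sval g.1 0 1 + x * sval g.1 1 1) &
      u != 0 -> sval g'.2 = H u (- u / xSL g.1) * sval g.2].
Proof.
move=> g' u; have [r0 r1] := wn_row x.
have cE : sval g'.1 1 0 = - u.
  rewrite [sval g'.1]/(sval (SL2_mul (SL2_mul (SL2_w F) (SL2_n x)) g.1)) SL2_mulE r0 r1 /u; ring.
split=> //.
  rewrite [sval g'.1]/(sval (SL2_mul (SL2_mul (SL2_w F) (SL2_n x)) g.1)) SL2_mulE r0 r1; ring.
move=> u0.
have xg' : xSL (SL2_mul (SL2_mul (SL2_w F) (SL2_n x)) g.1) = - u.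
  have cE' : sval (SL2_mul (SL2_mul (SL2_w F) (SL2_n x)) g.1) 1 0 = - u by exact: cE.
  by rewrite /xSL cE' oppr_eq0 u0.
have xwn : xSL (SL2_mul (SL2_w F) (SL2_n x)) = -1.
  by rewrite /xSL r0 oppr_eq0 oner_eq0.
have e : sval g'.2 = cocyc iota (SL2_mul (SL2_w F) (SL2_n x)) g.1 *
   (cocyc iota (SL2_w F) (SL2_n x) * sval e1 * sval e1) * sval g.2 by [].
rewrite e e1E !mulr1 (cocycE iota (SL2_w F)) xwn xSL_w xSL_n divff ?n1F // hil1l ?mulr1; last first.
- by rewrite invr1 mulr1 n1F.
- exact: hpn.
- exact: hn.
by rewrite cocycE xg' xwn invrN invr1 mulrN1 opprK.
Qed.

Lemma continuation_geometric (Phi : C -> F -> V) s (K e : C) (k : int) (u : V) :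
  1 - e * qs F s ^+ n != 0 ->
  (exists s0 : R, forall s', s0 < complex.Re s' ->
     has_integral mu (Phi s') ((K * qs F s' ^ k / (1 - e * qs F s' ^+ n)) *: u)) ->
  continuation_value mu Phi s ((K * qs F s ^ k / (1 - e * qs F s ^+ n)) *: u).
Proof.
move=> h0 [s0 hs0].
(* As [k] may be negative, numerator and denominator are both multiplied by X^|k| to obtain
   polynomials. *)
pose m := `|k|%N; pose m' := `|(m%:Z + k)%R|%N.
pose N : {poly C} := K%:P * 'X^m'; pose D : {poly C} := 'X^m * (1 - e%:P * 'X^n).
have DE X : D.[X] = X ^+ m * (1 - e * X ^+ n) by rewrite /D !hornerE.
have ND s' : N.[qs F s'] / D.[qs F s'] = K * qs F s' ^ k / (1 - e * qs F s' ^+ n).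
  rewrite DE /N !hornerE.
  have X0 := qs_neq0 F s'.
  have -> : qs F s' ^+ m' = qs F s' ^+ m * qs F s' ^ k.
    by rewrite exprnP (exprnP _ m) -expfzDr //; congr (_ ^ _); rewrite /m' /m; clear; lia.
  have Xm : qs F s' ^+ m != 0 by rewrite expf_neq0.
  by rewrite mulrCA -mulf_div divff // mul1r.
rewrite -ND; apply: continuation_rat.
  by exists s0 => s' hs'; rewrite ND; exact: hs0.
by rewrite DE mulf_neq0 // expf_neq0 // qs_neq0.
Qed.

(** The symbols in the integrand split into a factor depending on g alone and the multiplier of
    rho(-c) rho(1/(-cu)). The integrand is then rho(-c) applied to a function of t = -c u. *)
Lemma hil_u_const u c : u != 0 -> c != 0 ->
  H u (- u / c) / H (-1) u = (H (-1) (- c))^-1 * H ((- c * u)^-1) (- c).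
Proof.
move=> u0 c0; have n1 := n1F F; have nc : - c != 0 by rewrite oppr_eq0.
have nu : - u != 0 by rewrite oppr_eq0.
have ci : c^-1 != 0 by rewrite invr_neq0.
have hu : H u (- c) = H (-1) u * H u c.
  by rewrite -{1}[c]mul1r -mulNr (hilMr iota hn hpn u0 n1 c0) hilm1C.
rewrite (hilMr iota hn hpn u0 nu ci) (hilN iota hn hpn u0) mul1r (hilVr iota hn hpn u0 c0).
rewrite (hilVl iota hn hpn (mulf_neq0 nc u0) nc) (hilMl iota hn hpn nc u0 nc).
rewrite (hil_self iota hn hpn nc) (hilm1C nc) hu.
have := hilm1_sq iota hn hpn nc.
move: (H (-1) (- c)) (H u c) (H (-1) u) => z x y zz.
by transitivity ((z * z * (y * x))^-1); [rewrite zz mul1r invfM mulrC|rewrite !invfM; ring].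
Qed.


End Compute.

(** * The intertwining operators on explicit sections *)

Section First.
Context (R : realType) (F : padicField) (n : nat) (iota : root_ident R F n).
Hypotheses (hn : (0 < n)%N) (hpn : coprime (res_char F) n).
Local Notation C := R[i].
Local Notation v := (@pf_v F).
Local Notation q := (res_card F).
Local Notation H := (hil iota).
Local Notation G := (coverSL2 R F n).
Local Notation cm := (cmul iota).
Local Notation om := (omega iota).
Local Notation T := (borelF F).
Context (mu : {measure set T -> \bar R}) (hmu : is_haar mu).
Context (V : lmodType C).
Context (tau : G -> V -> V) (rho : F -> V -> V) (pr : proj_rep iota tau rho).
Context (a : int) (a1 : 1 <= a) (v0 : V).
Local Notation vol' := ((vol mu)%:C%C : C).

Lemma secG0 (Y : C) (Rv : V) (g : G) : Y != 0 ->
  secG iota rho a Rv 0 Y g =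
  if (sval g.1 1 0 != 0) && inP (v (sval g.1 1 0)) (sval g.1 1 1) then
    (fac F Y (v (sval g.1 1 0)) * sval g.2 / H (-1) (- sval g.1 1 0)) *: rho (- (sval g.1 1 0)^-1) Rv
  else 0.
Proof.
move=> Y0; rewrite /secG; case: ifP => // _.
by case: ifP => // /andP[d0 _]; rewrite (proj_rep0 pr) ?scaler0 // invr_neq0.
Qed.

(** Change of variable t = -c u with u = A + x c, where (A, B) is the top row of g. The determinant
    gives c (B + x d) = d u - 1; as v(d) >= v(c), the support condition v(u) <= v(B + x d) becomes
    v(t) <= 0. *)
Lemma w_integrand_big_cell (X : C) (g : G) (x : F) : X != 0 -> sval g.1 1 0 != 0 ->
  inP (v (sval g.1 1 0)) (sval g.1 1 1) ->
  (fac F X (- v (sval g.1 1 0)) * sval g.2 / H (-1) (- sval g.1 1 0)) *: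
     rho (- sval g.1 1 0) (shellJV (Psi1 rho v0) X
        (- (sval g.1 1 0 * sval g.1 1 0) * x + - (sval g.1 1 0 * sval g.1 0 0))) =
  secG iota rho a v0 0 X (cm (cm (sec iota (SL2_w F)) (sec iota (SL2_n x))) g).
Proof.
move=> X0 c0 hd; rewrite secG0 //.
have [] := wn_g iota hn hpn g x.
have := SL2_det g.1; move: c0 hd.
have : xSL g.1 = sval g.1 1 0 \/ sval g.1 1 0 = 0.
  by rewrite /xSL; case: eqVneq; [right|left].
move: (cm _ g) => g'; move: (sval g'.1 1 0) (sval g'.1 1 1) (sval g'.2) (xSL g.1) => c' d' e' xg.
move: (sval g.1 1 0) (sval g.1 1 1) (sval g.1 0 0) (sval g.1 0 1) (sval g.2) => c d A B ee.
clear g g' => xgE c0 hd det.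
have {xgE} -> : xg = c by case: xgE => // h; rewrite h eqxx in c0.
have [u uE] : exists u, u = A + x * c by exists (A + x * c).
rewrite -uE => -> -> eE.
have nc : - c != 0 by rewrite oppr_eq0.
have tE : - (c * c) * x + - (c * A) = - c * u by rewrite uE; ring.
rewrite tE /shellJV inPN pvN !oppr_eq0.
have [uz|u0] := eqVneq u 0.
  by rewrite uz mulr0 eqxx /= (proj_rep0 pr nc) scaler0.
rewrite mulf_neq0 // pvM // pvN /= eE // opprK invrN opprK.
have -> : inP (v u) (B + x * d) = (v c + v u <= 0).
  rewrite -(inP_scale _ _ c0) [_ + v c]addrC (_ : c * (B + x * d) = - 1 + d * u); last first.
    by rewrite -det uE; ring.
  have [hv|hv] := leP (v c + v u) 0.
    apply: inPD; first by rewrite inPN inPE ?oner_eq0 // pv1.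
    by apply: inPM => //; rewrite inPE.
  apply/negbTE; apply: contraL hv => h; rewrite -leNgt.
  have : inP (v c + v u) (-1 : F).
    rewrite -(addrK (d * u) (-1)); apply: inPB => //.
    by apply: inPM => //; rewrite inPE.
  by rewrite inPN inPE ?oner_eq0 // pv1.
case: ifP => hv; last by rewrite (proj_rep0 pr nc) scaler0.
rewrite /Psi1 (proj_repZ _ _ pr nc) (rhoM pr) ?invr_neq0 ?mulf_neq0 // !scalerA.
rewrite (_ : - c * (- c * u)^-1 = u^-1); last by field; rewrite ?u0 ?c0 ?nc ?mulf_neq0 ?oppr_eq0.
congr (_ *: _).
have hc := hil_u_const iota hn hpn u0 c0.
have hf : fac F X (- v c) * fac F X (v c) = 1.
  by rewrite -facD // addNr /fac oppr0 !expr0z mulr1.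
rewrite -(pvN c) -fac_neg // ?pvN // facD //.
move: hc hf; move: (fac F X (v c)) (fac F X (- v c)) (fac F X (v u)) (H u _) (H (-1) u) (H (-1) (- c)) (H (- c * u)^-1 (- c)).
clear => f f' fu h1 h2 h3 h4 hc hf.
transitivity ((f' * f) * fu * ee * (h3^-1 * h4)); first by ring.
by rewrite hf -hc; ring.
Qed.

(** The Jacobian q^(2 v(c)) and [fac] at -v(c) combine to q^(v(c)) X^(v(c)), which is [fac] at v(c)
    for 1/X: the parameter passes from s to -s. *)
Lemma w_integral_big_cell (eta kk : C) (i0 : nat) (w0 : V) (Wv : V) s (g : G) :
  (exists s0 : R, forall s : C, s0 < complex.Re s ->
    has_integral mu (shellJV (Psi1 rho v0) (qs F s))
      ((kk * qs F s ^+ i0 / (1 - eta * qs F s ^+ n)) *: w0)) ->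
  sval g.1 1 0 != 0 -> inP (v (sval g.1 1 0)) (sval g.1 1 1) ->
  1 - eta * qs F s ^+ n != 0 ->
  continuation_value mu (fun s' x => secG iota rho a v0 0 (qs F s')
     (cm (cm (sec iota (SL2_w F)) (sec iota (SL2_n x))) g)) s
   (secG iota (fun x => rho x^-1) a ((kk * qs F s ^+ i0 / (1 - eta * qs F s ^+ n)) *: w0)
      Wv (qs F (- s)) g).
Proof.
move=> J1 c0 hd h0.
have nc : - sval g.1 1 0 != 0 by rewrite oppr_eq0.
have [_ rlin _ _] := pr.
have -> : secG iota (fun x => rho x^-1) a ((kk * qs F s ^+ i0 / (1 - eta * qs F s ^+ n)) *: w0) Wv (qs F (- s)) g =
   ((q%:R ^ v (sval g.1 1 0) * sval g.2 / H (-1) (- sval g.1 1 0) * kk) * qs F s ^ (v (sval g.1 1 0) + i0%:Z) /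
     (1 - eta * qs F s ^+ n)) *: rho (- sval g.1 1 0) w0.
  rewrite /secG c0 hd /= invrN invrK (proj_repZ _ _ pr nc) scalerA; congr (_ *: _).
  rewrite /fac qsN exprz_inv opprK expfzDr ?qs_neq0 // -exprnP.
  move: (1 - eta * qs F s ^+ n) => t1; move: (qs F s ^+ i0) => t2; move: (qs F s ^ v _) => t3.
  move: (q%:R ^ _) (H _ _) (sval g.2) => *; ring.
apply: continuation_geometric => //.
have [s0 hs0] := J1; exists s0 => s' hs'; have {hs0} := hs0 s' hs'.
have X0 := qs_neq0 F s'; set X := qs F s' in X0 *.
move=> hJ.
have al0 : - (sval g.1 1 0 * sval g.1 1 0) != 0 by rewrite oppr_eq0 mulf_neq0.
have := has_integralZ (fac F X (- v (sval g.1 1 0)) * sval g.2 / H (-1) (- sval g.1 1 0))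
  (has_integral_linear (fun c u w => rlin _ nc c u w)
     (has_integral_affine hmu (- (sval g.1 1 0 * sval g.1 0 0)) al0 hJ)).
apply: has_integral_ext => [x|]; first exact: w_integrand_big_cell.
rewrite !(proj_repZ _ _ pr nc) !scalerA; congr (_ *: _).
rewrite /fac pvN pvM // !expfzDr ?qC_neq0 // opprK -exprnP.
have h : q%:R ^ (- v (sval g.1 1 0)) * q%:R ^ v (sval g.1 1 0) = 1 :> C by rewrite -expfzDr ?qC_neq0 // addNr expr0z.
move: (1 - eta * X ^+ n) => t7; move: (X ^+ i0) (X ^ v _) => t4 t3.
move: h; move: (q%:R ^ (- v _)) (q%:R ^ v _) (H _ _) (sval g.2).
clear => t1 t2 t5 t6 h.
transitivity ((t1 * t2) * (t2 * t6 / t5 * kk * (t3 * t4) / t7)); first by ring.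
by rewrite h mul1r.
Qed.

(** For c = 0 the entry u = A = 1/d is constant and the support condition cuts out a ball of index
    -2 v(d) in [x]. *)
Lemma w_integrand_borel (X : C) (g : G) (x : F) : X != 0 -> sval g.1 1 0 = 0 ->
  (indb R (- (sval g.1 0 1 / sval g.1 1 1)) (- v (sval g.1 1 1) - v (sval g.1 1 1)) x) *:
    ((fac F X (- v (sval g.1 1 1)) * sval g.2) *: rho (sval g.1 1 1) v0) =
  secG iota rho a v0 0 X (cm (cm (sec iota (SL2_w F)) (sec iota (SL2_n x))) g).
Proof.
move=> X0 c0; rewrite secG0 //.
have [] := wn_g iota hn hpn g x.
have := SL2_det g.1; move: c0.
have : sval g.1 1 0 = 0 -> xSL g.1 = sval g.1 1 1 by rewrite /xSL => ->; rewrite eqxx.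
move: (cm _ g) => g'; move: (sval g'.1 1 0) (sval g'.1 1 1) (sval g'.2) (xSL g.1) => c' d' e' xg.
move: (sval g.1 1 0) (sval g.1 1 1) (sval g.1 0 0) (sval g.1 0 1) (sval g.2) => c d A B ee.
clear g g' => xgE c0; rewrite (xgE c0) c0 mulr0 subr0 mulr0 addr0 => det -> -> eE.
have A0 : A != 0 by apply: contra_eqN det => /eqP->; rewrite mul0r eq_sym oner_eq0.
have d0 : d != 0 by apply: contra_eqN det => /eqP->; rewrite mulr0 eq_sym oner_eq0.
have vA : v A = - v d by apply/eqP; rewrite -addr_eq0 -pvM // det pv1.
have dA : A^-1 = d by apply: (mulfI A0); rewrite divff.
rewrite eE // !oppr_eq0 A0 inPN pvN invrN !opprK dA vA /=.
have -> : inP (- v d) (B + x * d) = inP (- v d - v d) (x - - (B / d)).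
  by rewrite -[in RHS](inP_scale _ _ d0) subrK; congr inP; field.
rewrite /indb; case: ifP => _; last by rewrite scale0r.
rewrite scale1r; congr (_ *: _).
have -> : - A / d = (- A) * A by rewrite -dA invrK.
rewrite (hilMr iota hn hpn A0) ?oppr_eq0 // (hilN iota hn hpn A0) mul1r (hil_self iota hn hpn A0) (hilm1C iota hn hpn A0).
by field; exact: hil_neq0.
Qed.

(** With t = d u the determinant gives c (B + x d) = t - 1. As v(d) < v(c), the support condition
    forces v(t) = 0 and then reads v(t - 1) >= v(c) - v(d) >= 1. On the support [t] is a 1-unit, so
    every symbol involving it is trivial. *)
Lemma w_integrand_small_cell (chi0 : F -> C) (X : C) (g : G) (x : F) : X != 0 ->
  (forall r, r != 0 -> v r = 0 -> rho r v0 = chi0 r *: v0) ->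
  (forall r, r != 0 -> v r = 0 -> chi0 r * chi0 r^-1 = 1) ->
  sval g.1 1 0 != 0 -> sval g.1 1 1 != 0 -> v (sval g.1 1 1) < v (sval g.1 1 0) ->
  (fac F X (- v (sval g.1 1 1)) * sval g.2 / H (sval g.1 1 0 / sval g.1 1 1) (sval g.1 1 1)) *:
    rho (sval g.1 1 1) ((indb R (1 : F) (v (sval g.1 1 0) - v (sval g.1 1 1))
       (sval g.1 1 1 * sval g.1 1 0 * x + sval g.1 1 1 * sval g.1 0 0) /
       chi0 (sval g.1 1 1 * sval g.1 1 0 * x + sval g.1 1 1 * sval g.1 0 0)) *: v0) =
  secG iota rho a v0 0 X (cm (cm (sec iota (SL2_w F)) (sec iota (SL2_n x))) g).
Proof.
move=> X0 hchi0 chi0V c0 d0 vdc; rewrite secG0 //.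
have [] := wn_g iota hn hpn g x.
have := SL2_det g.1; move: c0 d0 vdc.
have : xSL g.1 = sval g.1 1 0 \/ sval g.1 1 0 = 0.
  by rewrite /xSL; case: eqVneq; [right|left].
move: (cm _ g) => g'; move: (sval g'.1 1 0) (sval g'.1 1 1) (sval g'.2) (xSL g.1) => c' d' e' xg.
move: (sval g.1 1 0) (sval g.1 1 1) (sval g.1 0 0) (sval g.1 0 1) (sval g.2) => c d A B ee.
clear g g' => xgE c0 d0 vdc det.
have {xgE} -> : xg = c by case: xgE => // h; rewrite h eqxx in c0.
have [u uE] : exists u, u = A + x * c by exists (A + x * c).
rewrite -uE => -> -> eE.
have [t tE] : exists t, t = d * c * x + d * A by exists (d * c * x + d * A).
rewrite -tE inPN pvN !oppr_eq0.
have tu : t = d * u by rewrite tE uE; ring.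
have key : (u != 0) && inP (v u) (B + x * d) = inP (v c - v d) (t - 1).
  have -> : inP (v u) (B + x * d) = inP (v u + v c) (t - 1).
    rewrite -(inP_scale _ _ c0); congr inP.
    by rewrite tE -det; ring.
  have [uz|u0] := eqVneq u 0.
    rewrite tu uz mulr0 sub0r inPN inPE ?oner_eq0 // pv1 /=.
    by apply/esym/negbTE; rewrite inPN inPE ?oner_eq0 // pv1 -ltNge; move: vdc; clear; lia.
  have t0 : t != 0 by rewrite tu mulf_neq0.
  have vt : v t = v d + v u by rewrite tu pvM.
  apply/idP/idP => /= h.
    have vt0 : v t = 0.
      have [hp|hp|//] := ltgtP (v t) 0.
        have [_ h2] : t - 1 != 0 /\ v (t - 1) = v t by apply: pvD_lt; rewrite // inPN inPE ?oner_eq0 // pv1; move: hp; clear; lia.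
        move: h; have : t - 1 != 0 by apply/eqP => h3; move: hp; rewrite (subr0_eq h3) pv1.
        move=> t1; rewrite inPE // h2; move: vt vdc; clear; lia.
      have [h1 h2] : -1 + t != 0 /\ v (-1 + t) = v (-1).
        by apply: pvD_lt; rewrite ?n1F // pvN pv1 inPE //; move: hp; clear; lia.
      move: h; rewrite [t - 1]addrC inPE // h2 pvN pv1; move: vt vdc hp; clear; lia.
    by apply: inP_le h; move: vt vt0 vdc; clear; lia.
  have h1 : inP 1 (t - 1) by apply: inP_le h; move: vdc; clear; lia.
  have [_ vt0] := unit1P (lexx _) h1.
  by apply: inP_le h; move: vt vt0 vdc; clear; lia.
rewrite key /indb; case: ifPn => h; last by rewrite mul0r scale0r (proj_rep0 pr d0) scaler0.
have u0 : u != 0 by move: h; rewrite -key => /andP[].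
have h1 : inP 1 (t - 1) by apply: inP_le h; move: vdc; clear; lia.
have [t0 vt0] := unit1P (lexx _) h1.
have vti : v t^-1 = 0 by rewrite pvV // vt0 oppr0.
have ti : t^-1 != 0 by rewrite invr_neq0.
have vu : v u = - v d by apply/eqP; rewrite -addr_eq0 addrC -pvM // -tu vt0.
have ut : u = d^-1 * t by rewrite tu mulKf.
have ci : chi0 t^-1 = (chi0 t)^-1.
  have e := chi0V t t0 vt0.
  have ct : chi0 t != 0 by apply: contra_eqN e => /eqP->; rewrite mul0r eq_sym oner_eq0.
  by apply: (mulfI ct); rewrite e divff.
rewrite eE // opprK invrN opprK vu mul1r.
have -> : u^-1 = d * t^-1 by rewrite tu; field; rewrite u0 d0.
have hti := unit1V (lexx (1 : int)) h1.
rewrite (rhoMV hn pr _ d0 ti) (hil_unit1l iota hn hpn _ hti).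
rewrite invr1 scale1r hchi0 // ci; congr (_ *: _).
have di : d^-1 != 0 by rewrite invr_neq0.
have cd0 : - (c * d) != 0 by rewrite oppr_eq0 mulf_neq0.
have -> : - u / c = (- (c * d))^-1 * t by rewrite ut invrN invfM; ring.
rewrite ut !(hilMl iota hn hpn di t0) ?mulf_neq0 ?invr_neq0 // (hil_unit1l iota hn hpn _ h1).
rewrite (hilMr iota hn hpn (n1F F) di t0) (hil_unit1r iota hn hpn _ h1).
rewrite (hilMr iota hn hpn di _ t0) ?invr_neq0 // (hil_unit1r iota hn hpn _ h1).
rewrite (hilVr iota hn hpn (n1F F) d0) (hilVl iota hn hpn d0) ?invr_neq0 // (hilVr iota hn hpn d0 cd0) invrK.
have -> : - (c * d) = - d * c by ring.
rewrite (hilMr iota hn hpn d0) ?oppr_eq0 // (hilN iota hn hpn d0).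
rewrite (hilMl iota hn hpn c0 di d0) (hilVl iota hn hpn d0 d0) (hil_self iota hn hpn d0) (hilm1C iota hn hpn d0).
rewrite (hilC iota hn hpn d0 c0).
have h2 := hil_neq0 iota hn c d; have h3 := hil_neq0 iota hn (-1) d.
by rewrite !(mul1r, mulr1, invrK) !invfM invrK; ring.
Qed.
Lemma fac_qsN s (k : int) : fac F (qs F (- s)) k = q%:R ^ k * qs F s ^ k :> C.
Proof. by rewrite /fac qsN exprz_inv opprK. Qed.

Lemma w_integral_borel (eta : C) (Rv : V) s (g : G) :
  sval g.1 1 0 = 0 -> 
  continuation_value mu (fun s' x => secG iota rho a v0 0 (qs F s')
     (cm (cm (sec iota (SL2_w F)) (sec iota (SL2_n x))) g)) s
   (secG iota (fun x => rho x^-1) a Rv (vol' *: v0) (qs F (- s)) g).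
Proof.
move=> c0.
have d0 : sval g.1 1 1 != 0.
  by have := xSL_neq0 g.1; rewrite /xSL c0 eqxx.
have -> : secG iota (fun x => rho x^-1) a Rv (vol' *: v0) (qs F (- s)) g =
   ((q%:R ^ v (sval g.1 1 1) * sval g.2 * vol') * qs F s ^ (v (sval g.1 1 1)) /
     (1 - 0 * qs F s ^+ n)) *: rho (sval g.1 1 1) v0.
  rewrite /secG c0 eqxx d0 inP0 /= invrK (proj_repZ _ _ pr d0) scalerA; congr (_ *: _).
  rewrite fac_qsN mul0r subr0 invr1 mulr1.
  move: (_ ^ _) (qs F s ^ _) (sval g.2) => t1 t2 t3; ring.
apply: continuation_geometric => //; first by rewrite mul0r subr0 oner_neq0.
exists 0 => s' _.
have X0 := qs_neq0 F s'; set X := qs F s' in X0 *.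
have [i1 e1] := cint_indb hmu (- (sval g.1 0 1 / sval g.1 1 1)) (- v (sval g.1 1 1) - v (sval g.1 1 1)).
have := has_integral_vec ((fac F X (- v (sval g.1 1 1)) * sval g.2) *: rho (sval g.1 1 1) v0) i1 e1.
apply: has_integral_ext => [x|]; first exact: w_integrand_borel.
rewrite scalerA; congr (_ *: _).
rewrite /fac mul0r subr0 invr1 mulr1 opprB opprK expfzDr ?qC_neq0 //.
have h : q%:R ^ (- v (sval g.1 1 1)) * q%:R ^ v (sval g.1 1 1) = 1 :> C by rewrite -expfzDr ?qC_neq0 // addNr expr0z.
move: h; move: (q%:R ^ (- v _)) (q%:R ^ v _) (X ^ v _) (sval g.2) => t1 t2 t3 t4 h.
transitivity ((t1 * t2) * (t2 * t4 * vol' * t3)); first by ring.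
by rewrite h mul1r.
Qed.

(** The character integral with j = v(c) - v(d) vanishes unless j >= a, which is the condition
    defining the inner cell of the target section. *)
Lemma w_integral_small_cell (chi0 : F -> C) (Rv : V) s (g : G) :
  (forall r, r != 0 -> v r = 0 -> rho r v0 = chi0 r *: v0) ->
  (forall r, r != 0 -> v r = 0 -> chi0 r * chi0 r^-1 = 1) ->
  (forall j : int, 1 <= j ->
    has_integral mu (fun t => (indb R (1 : F) j t / chi0 t) *: v0)
      ((if a <= j then q%:R ^ (- j) * vol' else 0) *: v0)) ->
  sval g.1 1 0 != 0 -> ~~ inP (v (sval g.1 1 0)) (sval g.1 1 1) ->
  continuation_value mu (fun s' x => secG iota rho a v0 0 (qs F s')
     (cm (cm (sec iota (SL2_w F)) (sec iota (SL2_n x))) g)) s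
   (secG iota (fun x => rho x^-1) a Rv (vol' *: v0) (qs F (- s)) g).
Proof.
move=> hchi0 chi0V J3 c0 hd; have [_ rlin _ _] := pr.
have d0 : sval g.1 1 1 != 0 by apply: contraNneq hd => ->; rewrite inP0.
have vdc : v (sval g.1 1 1) < v (sval g.1 1 0) by rewrite ltNge -inPE.
have -> : secG iota (fun x => rho x^-1) a Rv (vol' *: v0) (qs F (- s)) g =
   ((q%:R ^ v (sval g.1 1 1) * sval g.2 / H (sval g.1 1 0 / sval g.1 1 1) (sval g.1 1 1) *
      (if a <= v (sval g.1 1 0) - v (sval g.1 1 1) then vol' else 0)) * qs F s ^ (v (sval g.1 1 1)) /
     (1 - 0 * qs F s ^+ n)) *: rho (sval g.1 1 1) v0.
  rewrite /secG c0 d0 /= (negbTE hd) inPE // lerBrDl (negbTE c0).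
  case: ifP => _; last by rewrite mulr0 !mul0r scale0r.
  rewrite invrK (proj_repZ _ _ pr d0) scalerA; congr (_ *: _).
  rewrite fac_qsN mul0r subr0 invr1 mulr1.
  move: (_ ^ _) (qs F s ^ _) (sval g.2) (H _ _) => t1 t2 t3 t4; ring.
apply: continuation_geometric => //; first by rewrite mul0r subr0 oner_neq0.
exists 0 => s' _.
have X0 := qs_neq0 F s'; set X := qs F s' in X0 *.
have al0 : sval g.1 1 1 * sval g.1 1 0 != 0 by rewrite mulf_neq0.
have j1 : 1 <= v (sval g.1 1 0) - v (sval g.1 1 1) by move: vdc; clear; lia.
have := has_integralZ (fac F X (- v (sval g.1 1 1)) * sval g.2 / H (sval g.1 1 0 / sval g.1 1 1) (sval g.1 1 1))
  (has_integral_linear (fun c u w => rlin _ d0 c u w)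
     (has_integral_affine hmu (sval g.1 1 1 * sval g.1 0 0) al0 (J3 _ j1))).
apply: has_integral_ext => [x|]; first exact: w_integrand_small_cell.
rewrite !(proj_repZ _ _ pr d0) !scalerA; congr (_ *: _).
rewrite pvM // mul0r subr0 invr1 mulr1; case: ifP => _; last by rewrite !(mulr0, mul0r).
rewrite /fac opprK opprB !expfzDr ?qC_neq0 //.
have h x : q%:R ^ (- v x) * q%:R ^ v x = 1 :> C by rewrite -expfzDr ?qC_neq0 // addNr expr0z.
move: (h (sval g.1 1 1)) (h (sval g.1 1 0)); clear h.
move: (q%:R ^ (- v (sval g.1 1 1))) (q%:R ^ v (sval g.1 1 1)) (q%:R ^ (- v (sval g.1 1 0))) (q%:R ^ v (sval g.1 1 0)).
move: (X ^ v _) (H _ _) (sval g.2) => t3 t4 t5 t1 t2 t6 t7 h h'.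
transitivity ((t1 * t2) * (t6 * t7) * (t2 * t5 / t4 * vol' * t3)); first by ring.
by rewrite h h' !mul1r.
Qed.

Hypothesis sep : forall u : V, (forall l : {scalar V}, l u = 0) -> u = 0.

Lemma intertwining_w_secG (eta kk : C) (i0 : nat) (w0 : V) (chi0 : F -> C) s :
  (forall r, inP a (r - 1) -> rho r v0 = v0) ->
  (exists s0 : R, forall s : C, s0 < complex.Re s ->
    has_integral mu (shellJV (Psi1 rho v0) (qs F s))
      ((kk * qs F s ^+ i0 / (1 - eta * qs F s ^+ n)) *: w0)) ->
  (forall r, r != 0 -> v r = 0 -> rho r v0 = chi0 r *: v0) ->
  (forall r, r != 0 -> v r = 0 -> chi0 r * chi0 r^-1 = 1) ->
  (forall j : int, 1 <= j ->
    has_integral mu (fun t => (indb R (1 : F) j t / chi0 t) *: v0)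
      ((if a <= j then q%:R ^ (- j) * vol' else 0) *: v0)) ->
  1 - eta * qs F s ^+ n != 0 ->
  intertwining iota mu (SL2_w F) tau s (secG iota rho a v0 0 (qs F s)) =
  secG iota (fun x => rho x^-1) a
    ((kk * qs F s ^+ i0 / (1 - eta * qs F s ^+ n)) *: w0) (vol' *: v0) (qs F (- s)).
Proof.
move=> fix0 J1 hchi0 chi0V J3 h0; apply: funext => g.
have fI : in_I iota tau s (secG iota rho a v0 0 (qs F s)).
  apply: (secG_in_I hn hpn pr a1 a1 fix0) => r hr.
  have [r0 _] := unit1P a1 hr; exact: (proj_rep0 pr).
apply: (intertwining_eq hn hpn pr sep fI).
under [fun s' x => _]eq_fun do under eq_fun do rewrite ext_secG.
have [c0|c0] := eqVneq (sval g.1 1 0) 0; first exact: w_integral_borel.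
case: (boolP (inP (v (sval g.1 1 0)) (sval g.1 1 1))) => hd.
  exact: w_integral_big_cell.
exact: (w_integral_small_cell _ _ hchi0 chi0V J3 c0 hd).
Qed.

(** At the point w every cocycle factor has the form (1, y) or (y, -y), hence is trivial. *)
Lemma winv_n_w (x : F) :
  let g' := cm (cm (sec iota (SL2_inv (SL2_w F))) (sec iota (SL2_n x))) (sec iota (SL2_w F)) in
  [/\ sval g'.1 1 0 = - x, sval g'.1 1 1 = 1 & sval g'.2 = 1].
Proof.
move=> g'.
have r0 : sval (SL2_mul (SL2_inv (SL2_w F)) (SL2_n x)) 1 0 = 1.
  by rewrite !SL2_mulE sval_winv sval_n !mat2E; ring.
have r1 : sval (SL2_mul (SL2_inv (SL2_w F)) (SL2_n x)) 1 1 = x.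
  by rewrite !SL2_mulE sval_winv sval_n !mat2E; ring.
have cE : sval g'.1 1 0 = - x.
  rewrite [sval g'.1]/(sval (SL2_mul (SL2_mul (SL2_inv (SL2_w F)) (SL2_n x)) (SL2_w F))).
  by rewrite SL2_mulE r0 r1 sval_w !mat2E; ring.
have dE : sval g'.1 1 1 = 1.
  rewrite [sval g'.1]/(sval (SL2_mul (SL2_mul (SL2_inv (SL2_w F)) (SL2_n x)) (SL2_w F))).
  by rewrite SL2_mulE r0 r1 sval_w !mat2E; ring.
split=> //.
have e : sval g'.2 = cocyc iota (SL2_mul (SL2_inv (SL2_w F)) (SL2_n x)) (SL2_w F) *
   (cocyc iota (SL2_inv (SL2_w F)) (SL2_n x) * sval (root_pow iota 0) * sval (root_pow iota 0)) * sval (root_pow iota 0) by [].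
have xwn : xSL (SL2_mul (SL2_inv (SL2_w F)) (SL2_n x)) = 1 by rewrite /xSL r0 oner_neq0.
have xwi : xSL (SL2_inv (SL2_w F)) = 1 by rewrite /xSL sval_winv !mat2E oner_neq0.
rewrite e e1E !mulr1 !cocycE xwn xwi xSL_n xSL_w !invr1 !mulr1.
rewrite (hil1l iota hn hpn (oner_neq0 _)) mulr1 invrN invr1 mulrN1.
rewrite /xSL cE dE oppr_eq0; have [x0|x0] := eqVneq x 0.
  by rewrite /= (hil1l iota hn hpn) // n1F.
by rewrite /= (hilN iota hn hpn) // oppr_eq0.
Qed.

(** For the bottom row (-x, 1) the two cells are v(x) <= 0 and v(x) >= a, disjoint because a >= 1;
    the integrand is therefore a sum of two pieces. *)
Lemma winv_integrand (Rv Wv : V) (X : C) (x : F) : X != 0 ->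
  shellJV (fun y => (H (-1) y)^-1 *: rho y Rv) X x + indb R (0 : F) a x *: Wv =
  secG iota (fun y => rho y^-1) a Rv Wv X
    (cm (cm (sec iota (SL2_inv (SL2_w F))) (sec iota (SL2_n x))) (sec iota (SL2_w F))).
Proof.
move=> X0; have [cE dE eE] := winv_n_w x; rewrite /secG cE dE eE /shellJV /indb subr0.
have -> : inP (v (- x)) (1 : F) = (v x <= 0) by rewrite pvN inPE ?oner_eq0 // pv1.
have -> : - (- x)^-1 = x^-1 by rewrite invrN opprK.
rewrite oppr_eq0 pvN opprK oner_eq0 /= pv1 add0r inPN mulr1 !invr1 invrK.
have [x0|x0] := eqVneq x 0.
  by rewrite x0 inP0 /= add0r scale1r /fac oppr0 !expr0z ?invr1 !mulr1 ?invr1 ?(rho1 pr) scale1r.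
rewrite /=; case: (leP (v x) 0) => vx.
  rewrite (_ : inP a x = false) ?scale0r ?addr0 ?fac_neg //; last first.
    by apply/negbTE; rewrite inPE // -ltNge; move: vx a1; clear; lia.
  by rewrite scalerA.
rewrite add0r mulr1 (hil1r iota hn hpn) ?mulr1 ?oppr_eq0 //.
case: ifP => _; last by rewrite scale0r.
by rewrite (rho1 pr) scale1r /fac oppr0 !expr0z ?invr1 !mulr1 ?invr1 scale1r.
Qed.

(** The second summand comes from the ball of index [a], of volume q^-a vol, on which the section is
    constantly vol v0. *)
Lemma intertwining_winv_secG (k2 e2 : C) (i0 : nat) (Rv : V) s :
  (forall r, inP a (r - 1) -> rho r v0 = v0) ->
  (forall r, inP a (r - 1) -> rho r Rv = Rv) ->
  (exists s0 : R, forall s : C, s0 < complex.Re s ->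
    has_integral mu (shellJV (fun x => (H (-1) x)^-1 *: rho x Rv) (qs F s))
      ((k2 * qs F s ^+ i0 / (1 - e2 * qs F s ^+ n)) *: v0)) ->
  1 - e2 * qs F s ^+ n != 0 ->
  intertwining iota mu (SL2_inv (SL2_w F)) (tau_w iota tau) s
    (secG iota (fun x => rho x^-1) a Rv (vol' *: v0) (qs F s)) (sec iota (SL2_w F)) =
  (k2 * qs F s ^+ i0 / (1 - e2 * qs F s ^+ n) + q%:R ^ (- a) * vol' * vol') *: v0.
Proof.
move=> fix0 fixR J2 h0; have pr' := tauw_proj hn hpn pr.
have fixV r : inP a (r - 1) -> inP a (r^-1 - 1) by exact: unit1V.
have fI : in_I iota (tau_w iota tau) s (secG iota (fun x => rho x^-1) a Rv (vol' *: v0) (qs F s)).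
  apply: (secG_in_I hn hpn pr' a1 a1) => r hr; first by rewrite fixR // fixV.
  have [r0 _] := unit1P a1 hr.
  by rewrite (proj_repZ _ _ pr) ?invr_neq0 // fix0 // fixV.
apply: (intertwining_eq hn hpn pr' sep fI).
under [fun s' x => _]eq_fun do under eq_fun do rewrite ext_secG.
pose N : {poly C} := k2%:P * 'X^i0 + (q%:R ^ (- a) * vol' * vol')%:P * (1 - e2%:P * 'X^n).
pose D : {poly C} := 1 - e2%:P * 'X^n.
have DE X : D.[X] = 1 - e2 * X ^+ n by rewrite /D !hornerE.
have NE X : N.[X] = k2 * X ^+ i0 + (q%:R ^ (- a) * vol' * vol') * (1 - e2 * X ^+ n).
  by rewrite /N !hornerE.
have ND X : 1 - e2 * X ^+ n != 0 ->
   k2 * X ^+ i0 / (1 - e2 * X ^+ n) + q%:R ^ (- a) * vol' * vol' = N.[X] / D.[X].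
  by move=> hX; rewrite NE DE [RHS]mulrDl mulfK.
rewrite ND //; apply: continuation_rat; last by rewrite DE.
have [s0 hs0] := J2; have [s1 hs1] := qs_half_plane F (Num.max 1 (normc e2)).
exists (Num.max s0 s1) => s'; rewrite gt_max => /andP[l0 l1].
have XB := hs1 _ l1.
have hX : 1 - e2 * qs F s' ^+ n != 0.
  by apply: (half_plane_neq0 hn) XB; rewrite le_max lexx ?orbT.
rewrite -ND //.
have [i1 e1] := cint_indb hmu 0 a.
have := has_integralD (hs0 _ l0) (has_integral_vec (vol' *: v0) i1 e1).
apply: has_integral_ext => [x|]; first by rewrite winv_integrand // qs_neq0.
by rewrite scalerA -scalerDl.
Qed.

End First.

(** * The composite of the two operators at one point *)

Section MuValue.
Context (R : realType) (F : padicField) (n : nat) (iota : root_ident R F n).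
Hypotheses (hn : (0 < n)%N) (hpn : coprime (res_char F) n).
Local Notation C := R[i].
Local Notation v := (@pf_v F).
Local Notation q := (res_card F).
Local Notation H := (hil iota).
Local Notation e1 := (root_pow iota 0).
Local Notation G := (coverSL2 R F n).
Local Notation cm := (cmul iota).
Local Notation om := (omega iota).
Local Notation T := (borelF F).
Context (mu : {measure set T -> \bar R}) (hmu : is_haar mu).
Context (V : lmodType C).
Hypothesis sep : forall u : V, (forall l : {scalar V}, l u = 0) -> u = 0.
Context (tau : G -> V -> V) (rho : F -> V -> V) (pr : proj_rep iota tau rho).
Context (p : F) (p0 : p != 0) (vp : v p = 1).
Context (v0 : V) (v0n : v0 != 0) (chi0 : F -> C) (eta : C).
Hypotheses (hchi0 : forall r, r != 0 -> v r = 0 -> rho r v0 = chi0 r *: v0)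
  (heta : rho (p ^+ n) v0 = eta *: v0).
Context (a : int) (a1 : 1 <= a).
Hypotheses (cond_a : forall r, inP a (r - 1) -> chi0 r = 1)
  (cond_min : forall j, 1 <= j -> j < a -> exists2 r, inP j (r - 1) & chi0 r != 1).
Context (b : bool) (i0 : nat) (i0n : (i0 < n)%N).
Hypothesis good : forall i, (i < n)%N ->
  if b && (i == i0) then forall r, r != 0 -> v r = 0 -> chi0 r = om r ^+ i
  else exists r, [/\ r != 0, v r = 0 & chi0 r != om r ^+ i].

Local Notation vol' := ((vol mu)%:C%C : C).
Local Notation kap := ((1 - q%:R^-1) * vol' : C).


Hypothesis gen : forall i, (i < n)%N -> i != i0 ->
  exists r, [/\ r != 0, v r = 0 & om r ^+ i != om r ^+ i0].

(** Both cases at once: when [b] is false the first operator leaves nothing on the big cell, and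
    only the ball term of the second will survive. *)
Lemma shell_scaled_Psi2_integral (c : C) : exists s0 : R, forall s : C, s0 < complex.Re s ->
  has_integral mu (shellJV (fun x => (H (-1) x)^-1 *: rho x ((b%:R * c) *: w0 rho p v0 i0)) (qs F s))
    ((b%:R * c * kap * qs F s ^+ i0 / (1 - eta^-1 * qs F s ^+ n)) *: v0).
Proof.
case: (boolP b) => hb; last first.
  exists 0 => s _; rewrite !mul0r !scale0r.
  have h0 := @has_integral0 R F mu V; apply: has_integral_ext h0 => [x|//].
  rewrite /shellJV; case: ifP => // /andP[x0 _].
  by rewrite (proj_rep0 pr x0) !scaler0.
have [s0 hs0] := shell_Psi2_integral hn hpn hmu pr p0 vp v0n hchi0 heta a1 i0n good gen hb.
exists s0 => s hs; have := has_integralZ c (hs0 s hs).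
apply: has_integral_ext => [x|]; last by rewrite scalerA mul1r !mulrA.
rewrite /shellJV; case: ifP => [/andP[x0 _]|_]; last by rewrite scaler0.
by rewrite mul1r (proj_repZ _ _ pr x0) /Psi2 !scalerA; congr (_ *: _); move: (_ ^+ _) (H _ _) => t1 t2; ring.
Qed.

Lemma mu_value s : 1 - eta * qs F s ^+ n != 0 -> 1 - eta^-1 * qs F s ^- n != 0 ->
  exists f : G -> V, [/\ in_I iota tau s f, f (sec iota (SL2_w F)) = v0 &
    intertwining iota mu (SL2_inv (SL2_w F)) (tau_w iota tau) (- s)
      (intertwining iota mu (SL2_w F) tau s f) (sec iota (SL2_w F)) =
    (vol' ^+ 2 * (q%:R ^ (- a) + b%:R * (1 - q%:R^-1) ^+ 2 /
       ((1 - eta * qs F s ^+ n) * (1 - eta^-1 * qs F s ^- n)))) *: v0].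
Proof.
move=> h1 h2.
have fix0 r : inP a (r - 1) -> rho r v0 = v0 by move=> hr; apply: (fix_v0 hchi0 a1 cond_a).
have fixw r : inP a (r - 1) -> rho r (w0 rho p v0 i0) = w0 rho p v0 i0.
  exact: (w0_fix hn hpn pr p0 hchi0 a1 cond_a).
exists (secG iota rho a v0 0 (qs F s)); split.
- apply: (secG_in_I hn hpn pr a1 a1 fix0) => r hr.
  have [r0 _] := unit1P a1 hr; exact: (proj_rep0 pr).
- have eE : sval (sec iota (SL2_w F)).2 = 1 := e1E iota.
  rewrite /secG eE sval_w !mat2E oppr_eq0 oner_eq0 inP0 /= pvN pv1 opprK.
  rewrite /fac oppr0 !expr0z (hil1r iota hn hpn (n1F F)) !mulr1 ?invr1.
  by rewrite invrN invr1 opprK (rho1 pr) mulr1 scale1r.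
rewrite (intertwining_w_secG hn hpn hmu pr a1 sep (eta := eta) (kk := b%:R * kap) (i0 := i0)
    (w0 := w0 rho p v0 i0) (chi0 := chi0) fix0 _ hchi0) //; last 3 first.
- exact: (shell_Psi1_integral hn hpn hmu pr p0 vp v0n hchi0 heta a1 cond_a i0n good).
- exact: (chi0V hn hpn pr v0n hchi0 cond_a).
- move=> j j1; exact: (unit_ball_character_integral hn hpn hmu pr p0 vp v0n hchi0 a1 cond_a cond_min i0n j1).
have -> : b%:R * kap * qs F s ^+ i0 / (1 - eta * qs F s ^+ n) =
    b%:R * (kap * qs F s ^+ i0 / (1 - eta * qs F s ^+ n)) :> C by rewrite !mulrA.
rewrite (intertwining_winv_secG hn hpn hmu pr a1 sep fix0 _ (shell_scaled_Psi2_integral _)).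
(* The second operator acts at -s, so its factor X^(-i0) cancels the X^i0 of the first: the value no
   longer depends on [i0]. *)
- congr (_ *: _); rewrite qsN !exprVn.
  have X0 : qs F s ^+ i0 != 0 by rewrite expf_neq0 // qs_neq0.
  move: X0 h1 h2; move: (qs F s ^+ i0) (1 - eta * _) (1 - eta^-1 * _) (q%:R ^ _) => t1 t2 t3 t4 X0 h1 h2.
  have Q0 := qC_neq0 R F.
  by field; rewrite ?X0 ?h1 ?h2 ?Q0.
- by move=> r hr; have [r0 _] := unit1P a1 hr; rewrite (proj_repZ _ _ pr r0) fixw.
- by rewrite qsN exprVn.
Qed.

End MuValue.

(** * The inducing character *)

Section Ind.
Context (R : realType) (F : padicField) (n : nat) (iota : root_ident R F n).
Hypotheses (hn : (0 < n)%N) (hpn : coprime (res_char F) n).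
Local Notation C := R[i].
Local Notation v := (@pf_v F).
Local Notation H := (hil iota).
Local Notation e1 := (root_pow iota 0).
Local Notation G := (coverSL2 R F n).
Local Notation cm := (cmul iota).
Local Notation d := (n %/ gcdn n 2)%N.
Context (V : lmodType C) (tau : G -> V -> V) (E : F -> C).
Let etaE (g : G) : C := sval g.2 * E (sval g.1 0 0).
Hypothesis iso : iso_to_ind iota (cover_H R F n) tau (cover_Hd R F n) etaE.

(** The model embeds [V] in a space of functions, on which evaluation at a point is a functional. *)
Lemma iso_to_ind_separated (u : V) : (forall l : {scalar V}, l u = 0) -> u = 0.
Proof.
have [T [Tlin Tinj _ _]] := iso => hu; apply: Tinj; apply: funext => g.
have hs : scalar (fun u => T u g) by move=> c x y; exact: Tlin.
by rewrite -(mk_scalarE hs u) hu -(mk_scalarE hs 0) linear0.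
Qed.

Lemma SL2_h_mul (a b : F) (a0 : a != 0) (b0 : b != 0) (ab0 : a * b != 0) :
  SL2_mul (SL2_h a0) (SL2_h b0) = SL2_h ab0.
Proof.
apply: SL2_eq; apply: mat2_inj; rewrite SL2_mulE !sval_h !mat2E ?mulr0 ?mul0r ?addr0 ?add0r //.
by rewrite invfM.
Qed.

Lemma cm_h (a b : F) (a0 : a != 0) (b0 : b != 0) (ab0 : a * b != 0) (e e' e'' : mu_n R n) :
  sval e'' = H b a * sval e * sval e' ->
  cm (SL2_h a0, e) (SL2_h b0, e') = (SL2_h ab0, e'').
Proof.
move=> he; apply: cover_eq; last by rewrite cmul2 he coc_hh.
exact: (congr1 (fun g : SL2 F => sval g) (SL2_h_mul a0 b0 ab0)).
Qed.

Lemma SL2_h_inj (a b : F) (a0 : a != 0) (b0 : b != 0) : SL2_h a0 = SL2_h b0 -> a = b.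
Proof. by move=> /(congr1 (fun g : SL2 F => sval g 0 0)); rewrite !sval_h !mat2E. Qed.

Lemma cover_HdE (a : F) (a0 : a != 0) (e : mu_n R n) :
  cover_Hd R F n (SL2_h a0, e) <-> (d%:Z %| v a)%Z.
Proof.
split=> [[b [b0 [hb]]]|h]; last by exists a, a0.
by move=> /SL2_h_inj ->.
Qed.

Lemma cover_HP (g : G) : cover_H R F n g -> exists (a : F) (a0 : a != 0) e, g = (SL2_h a0, e).
Proof. by case: g => g e [a [a0 /= ->]]; exists a, a0, e. Qed.

Lemma cover_Hh (a : F) (a0 : a != 0) (e : mu_n R n) : cover_H R F n (SL2_h a0, e).
Proof. by exists a, a0. Qed.

Lemma etaE_h (a : F) (a0 : a != 0) (e : mu_n R n) : etaE (SL2_h a0, e) = sval e * E a.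
Proof. by rewrite /etaE sval_h mat2E. Qed.

Hypothesis V0 : exists u : V, u != 0.

(** The properties of [E] are obtained by evaluating the equivariance of [f] near such a point and
    cancelling the non-zero value. *)
Lemma ind_nonzero : exists f (a : F) (a0 : a != 0) (e : mu_n R n),
  ind_space iota (cover_H R F n) (cover_Hd R F n) etaE f /\ f (SL2_h a0, e) != 0.
Proof.
have [T [Tlin Tinj Trange _]] := iso; have [u u0] := V0.
have T0 g : T 0 g = 0.
  have hs : scalar (fun u => T u g) by move=> c x y; exact: Tlin.
  by rewrite -(mk_scalarE hs 0) linear0.
have hT : ind_space iota (cover_H R F n) (cover_Hd R F n) etaE (T u).
  by rewrite -Trange; exists u.
have [g hg] : exists g, T u g != 0.
  apply: contrapT => h; case/eqP: u0; apply: Tinj; apply: funext => g.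
  by rewrite T0; apply/eqP; apply: contra_notT h => h; exists g.
have [a [a0 [e ge]]] : exists (a : F) (a0 : a != 0) e, g = (SL2_h a0, e).
  apply: cover_HP; apply: contrapT => h; case: hT => h1 _ _.
  by rewrite h1 // eqxx in hg.
by exists (T u), a, a0, e; rewrite -ge.
Qed.

Lemma ind_char1 : E 1 = 1.
Proof.
have [f [a [a0 [e [[_ h2 _] h]]]]] := ind_nonzero; have o0 := oner_neq0 F.
have hd : cover_Hd R F n (SL2_h o0, e1) by apply/cover_HdE; rewrite pv1 dvdz0.
have := h2 _ _ hd (cover_Hh a0 e); rewrite etaE_h e1E mul1r.
have a10 : 1 * a != 0 by rewrite mul1r.
rewrite (cm_h o0 a0 a10 (e'' := e)); last by rewrite (hil1r iota hn hpn a0) e1E !mul1r.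
have -> : (SL2_h a10, e) = (SL2_h a0, e).
  by apply: cover_eq => //; apply: mat2_inj; rewrite !sval_h !mat2E ?mul1r.
by move=> h3; apply: (mulIf h); rewrite -h3 mul1r.
Qed.

Definition hmu_n (x : C) (hx : x ^+ n == 1) : mu_n R n := exist _ x hx.

Lemma hil_root a b : H a b ^+ n == 1.
Proof. by rewrite /hil; exact: (svalP (hilbert iota a b)). Qed.

(** Translating [f] on the left by h(b') and then h(b), or by (h(b b'), (b', b)) in one step, gives
    the same value. *)
Lemma ind_char_mul (b b' : F) : b != 0 -> b' != 0 -> (d%:Z %| v b)%Z -> (d%:Z %| v b')%Z ->
  H b' b * E (b * b') = E b * E b'.
Proof.
move=> b0 b'0 hb hb'.
have [f [a [a0 [e [[_ h2 _] h]]]]] := ind_nonzero.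
have bb0 : b * b' != 0 by rewrite mulf_neq0.
have ba0 : b' * a != 0 by rewrite mulf_neq0.
have bba0 : b * b' * a != 0 by rewrite mulf_neq0.
have bba0' : b * (b' * a) != 0 by rewrite mulf_neq0.
pose ee := hmu_n (hil_root b' b).
pose ee' := mu_mul (mu_mul (hilbert iota a b') e1) e.
pose e3 := mu_mul (mu_mul (hilbert iota a (b * b')) ee) e.
have e'E : sval ee' = H a b' * sval e1 * sval e by [].
have e3E : sval e3 = H a (b * b') * H b' b * sval e by [].
have hd (c : F) (c0 : c != 0) u : (d%:Z %| v c)%Z -> cover_Hd R F n (SL2_h c0, u) by move=> ?; apply/cover_HdE.
have q1 := h2 _ _ (hd _ bb0 ee _) (cover_Hh a0 e).
rewrite etaE_h (cm_h bb0 a0 bba0 (e'' := e3)) // in q1.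
have q2 := h2 _ _ (hd _ b0 e1 hb) (cover_Hh ba0 ee').
rewrite etaE_h e1E mul1r (cm_h b0 ba0 bba0' (e'' := e3)) in q2; last first.
  rewrite e3E e'E e1E (hilMl iota hn hpn b'0 a0 b0) (hilMr iota hn hpn a0 b0 b'0); ring.
have q3 := h2 _ _ (hd _ b'0 e1 hb') (cover_Hh a0 e).
rewrite etaE_h e1E mul1r (cm_h b'0 a0 ba0 (e'' := ee')) // in q3.
apply: (mulIf h); rewrite -[RHS]mulrA -q3 -q2 -[H b' b]/(sval ee) -q1; last by rewrite pvM // rpredD.
congr f; apply: cover_eq => //; apply: mat2_inj; rewrite !sval_h !mat2E ?mulrA //.
Qed.

Lemma ind_char_neq0 b : b != 0 -> (d%:Z %| v b)%Z -> E b != 0.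
Proof.
move=> b0 hb; have bi : b^-1 != 0 by rewrite invr_neq0.
have hbi : (d%:Z %| v b^-1)%Z by rewrite pvV // rpredN.
have := ind_char_mul b0 bi hb hbi; rewrite divff // ind_char1 mulr1 => h.
by apply: contraTneq (hil_neq0 iota hn b^-1 b) => Eb; rewrite h Eb mul0r negbK.
Qed.

(** Symbols with a 1-unit are trivial, so right translation by h(r), which fixes [f], coincides with
    left translation, which multiplies it by E(r). *)
Lemma ind_char_smooth : exists2 m, (0 < m)%N & forall r, inP m%:Z (r - 1) -> E r = 1.
Proof.
have [f [a [a0 [e [[_ h2 [m m0 hm]] h]]]]] := ind_nonzero.
exists m => // r hr; have m1 : 1 <= m%:Z by move: m0; clear; lia.
have hr1 : inP 1 (r - 1) by exact: inP_le hr.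
have [r0 vr] := unit1P m1 hr.
have hk : congrK m (SL2_h r0).
  move=> i j; rewrite sval_h !mxE; case: (ord2 i) => ->; case: (ord2 j) => -> /=;
    rewrite ?mulr1n ?mulr0n ?subrr ?inP0 //; exact: unit1V.
have ar0 : a * r != 0 by rewrite mulf_neq0.
have ra0 : r * a != 0 by rewrite mulf_neq0.
have := hm _ _ hk (cover_Hh r0 e1) (cover_Hh a0 e).
rewrite (cm_h a0 r0 ar0 (e'' := e)); last by rewrite (hil_unit1l iota hn hpn) // e1E mul1r mulr1.
have hd : cover_Hd R F n (SL2_h r0, e1) by apply/cover_HdE; rewrite vr dvdz0.
have := h2 _ _ hd (cover_Hh a0 e); rewrite etaE_h e1E mul1r.
rewrite (cm_h r0 a0 ra0 (e'' := e)); last by rewrite (hil_unit1r iota hn hpn) // e1E !mul1r.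
have -> : (SL2_h ra0, e) = (SL2_h ar0, e).
  by apply: cover_eq => //; apply: mat2_inj; rewrite !sval_h !mat2E // mulrC.
by move=> -> h3; apply: (mulIf h); rewrite h3 mul1r.
Qed.

(* The function supported on the inducing subgroup, whose preimage in [V] is an
   eigenvector of that subgroup. *)
Definition ind_char_section (g : G) : C := if `[< cover_Hd R F n g >] then etaE g else 0.

Lemma ind_char_section_h (a : F) (a0 : a != 0) (e : mu_n R n) :
  ind_char_section (SL2_h a0, e) = if (d%:Z %| v a)%Z then sval e * E a else 0.
Proof.
rewrite /ind_char_section etaE_h; case: (boolP (d%:Z %| v a)%Z) => h.
  by rewrite asboolT //; apply/cover_HdE.
by rewrite asboolF // => /cover_HdE; rewrite (negbTE h).
Qed.

(** The inducing subgroup is abelian, so left and right translation by it agree on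
    [ind_char_section]; this is what makes its preimage in [V] an eigenvector. *)
Lemma ind_char_section_mul (a b : F) (a0 : a != 0) (b0 : b != 0) (e e' : mu_n R n) : (d%:Z %| v b)%Z ->
  ind_char_section (cm (SL2_h a0, e) (SL2_h b0, e')) = sval e' * E b * ind_char_section (SL2_h a0, e) /\
  ind_char_section (cm (SL2_h b0, e') (SL2_h a0, e)) = sval e' * E b * ind_char_section (SL2_h a0, e).
Proof.
move=> hb; have ab0 : a * b != 0 by rewrite mulf_neq0.
have ba0 : b * a != 0 by rewrite mulf_neq0.
rewrite (cm_h a0 b0 ab0 (e'' := mu_mul (mu_mul (hilbert iota b a) e) e')) //.
rewrite (cm_h b0 a0 ba0 (e'' := mu_mul (mu_mul (hilbert iota a b) e') e)) //.
rewrite !ind_char_section_h !pvM // rpredDr // rpredDl //; case: ifP => ha; last by rewrite mulr0.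
have q1 := ind_char_mul a0 b0 ha hb; have q2 := ind_char_mul b0 a0 hb ha; split.
  by transitivity (sval e * sval e' * (H b a * E (a * b))); [move: (E (a * b)) => t; rewrite /= -/(H b a); ring|rewrite q1; ring].
by transitivity (sval e * sval e' * (H a b * E (b * a))); [move: (E (b * a)) => t; rewrite /= -/(H a b); ring|rewrite q2; ring].
Qed.

Lemma ind_char_section_in : ind_space iota (cover_H R F n) (cover_Hd R F n) etaE ind_char_section.
Proof.
split=> [g hg|b g hb /cover_HP [a [a0 [e ->]]]|].
- rewrite /ind_char_section asboolF // => [[a [a0 [_ ga]]]]; apply: hg; by exists a, a0.
- have [c [c0 [e' be]]] : exists (c : F) (c0 : c != 0) e', b = (SL2_h c0, e').
    by apply: cover_HP; case: hb => c [c0 [_ bc]]; exists c, c0.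
  move: hb; rewrite be => /cover_HdE hc.
  by rewrite etaE_h; have [_ ->] := ind_char_section_mul a0 c0 e e' hc.
have [m m0 hm] := ind_char_smooth; exists m => // k g hk [r [r0 /= kr]] /cover_HP [a [a0 [e ->]]].
have hr : inP m%:Z (r - 1) by have := hk 0 0; rewrite kr sval_h !mxE.
have m1 : 1 <= m%:Z by move: m0; clear; lia.
have [_ vr] := unit1P m1 hr.
have hd : (d%:Z %| v r)%Z by rewrite vr dvdz0.
have [q _] := ind_char_section_mul a0 r0 e e1 hd.
by rewrite /sec kr q e1E hm // !mul1r.
Qed.

Lemma ind_eigenvector : exists2 v0 : V, v0 != 0 &
  forall b : F, b != 0 -> (d%:Z %| v b)%Z -> tau (hh b, e1) v0 = E b *: v0.
Proof.
have [T [Tlin Tinj Trange Teq]] := iso.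
have : [set ind_char_section] `<=` range T by rewrite Trange => f ->; exact: ind_char_section_in.
move=> /(_ ind_char_section erefl) [v0 _ Tv0]; exists v0.
  apply/eqP => h; have o0 := oner_neq0 F.
  have : T v0 (SL2_h o0, e1) = 1 by rewrite Tv0 ind_char_section_h pv1 dvdz0 e1E ind_char1 mulr1.
  have hs : scalar (fun u => T u (SL2_h o0, e1)) by move=> c x y; exact: Tlin.
  by rewrite h -(mk_scalarE hs 0) linear0 => /eqP; rewrite eq_sym oner_eq0.
move=> b b0 hb; apply: Tinj; apply: funext => g.
have hs : scalar (fun u => T u g) by move=> c x y; exact: Tlin.
rewrite -[RHS](mk_scalarE hs) [RHS]linearZ /=.
case: (pselect (cover_H R F n g)) => hg.
  rewrite (hhE b0) Teq //; last by exists b, b0.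
  move/cover_HP: hg => [a [a0 [e ->]]]; rewrite Tv0.
  by have [-> _] := ind_char_section_mul a0 b0 e e1 hb; rewrite e1E mul1r.
have out w : T w g = 0.
  have : ind_space iota (cover_H R F n) (cover_Hd R F n) etaE (T w) by rewrite -Trange; exists w.
  by case=> h _ _; exact: h.
by rewrite !out mulr0.
Qed.

(** The elements over h(x^d) are central, because (a, x^d)^2 = (a, x)^(2d) = 1, [n] dividing 2d.
    They act by the inducing character on all of [V]. *)
Lemma ind_central (x : F) (u : V) : x != 0 ->
  tau (hh (x ^+ d), e1) u = E (x ^+ d) *: u.
Proof.
move=> x0; have [T [Tlin Tinj Trange Teq]] := iso.
have b0 : x ^+ d != 0 by rewrite expf_neq0.
have hb : (d%:Z %| v (x ^+ d))%Z by rewrite pvX // -mulr_natl natz dvdz_mulr.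
have hT : ind_space iota (cover_H R F n) (cover_Hd R F n) etaE (T u) by rewrite -Trange; exists u.
case: (hT) => out h2 _.
apply: Tinj; apply: funext => g.
have hs : scalar (fun u => T u g) by move=> c z y; exact: Tlin.
rewrite -[RHS](mk_scalarE hs) [RHS]linearZ /=.
case: (pselect (cover_H R F n g)) => hg; last first.
  rewrite out // mulr0.
  have : ind_space iota (cover_H R F n) (cover_Hd R F n) etaE (T (tau (hh (x ^+ d), e1) u)).
    by rewrite -Trange; exists (tau (hh (x ^+ d), e1) u).
  by case=> h _ _; exact: h.
rewrite (hhE b0) Teq //; last by exists (x ^+ d), b0.
move/cover_HP: hg => [a [a0 [e ->]]].
have ab0 : a * x ^+ d != 0 by rewrite mulf_neq0.
have ba0 : x ^+ d * a != 0 by rewrite mulf_neq0.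
have hd : cover_Hd R F n (SL2_h b0, e1) by apply/cover_HdE.
have <- : T u (cm (SL2_h b0, e1) (SL2_h a0, e)) = E (x ^+ d) * T u (SL2_h a0, e).
  by rewrite h2 ?etaE_h ?e1E ?mul1r //; exact: cover_Hh.
congr (T u _).
rewrite (cm_h a0 b0 ab0 (e'' := mu_mul (mu_mul (hilbert iota (x ^+ d) a) e) e1)) //.
rewrite (cm_h b0 a0 ba0 (e'' := mu_mul (mu_mul (hilbert iota a (x ^+ d)) e1) e)) //.
apply: cover_eq; first by apply: mat2_inj; rewrite !sval_h !mat2E // mulrC.
transitivity (H (x ^+ d) a * sval e * sval e1) => //.
transitivity (H a (x ^+ d) * sval e1 * sval e) => //.
rewrite e1E !mulr1; congr (_ * _).
rewrite (hilC iota hn hpn b0 a0).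
apply: (mulfI (hil_neq0 iota hn a (x ^+ d))); rewrite divff ?hil_neq0 //.
rewrite (hilXr iota hn hpn _ a0 x0) -expr2 -exprM.
have -> : (d * 2 = n * (2 %/ gcdn n 2))%N.
  by rewrite muln_divA ?dvdn_gcdr // divn_mulAC ?dvdn_gcdl.
by rewrite exprM hiln expr1n.
Qed.
End Ind.

(** * Characters killed by n, and the Weil factor at n-th powers *)

Section Final.
Context (R : realType) (F : padicField) (n : nat) (iota : root_ident R F n).
Hypotheses (hn : (0 < n)%N) (hpn : coprime (res_char F) n).
Local Notation C := R[i].
Local Notation v := (@pf_v F).
Local Notation q := (res_card F).
Local Notation H := (hil iota).
Local Notation om := (omega iota).
Local Notation e1 := (root_pow iota 0).
Local Notation G := (coverSL2 R F n).
Local Notation d := (n %/ gcdn n 2)%N.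

Section CharPow.
Context (c0 : F -> C).
Hypotheses (c0M : forall r r', r != 0 -> v r = 0 -> r' != 0 -> v r' = 0 ->
    c0 (r * r') = c0 r * c0 r') (c01 : c0 1 = 1).

Lemma charX r k : r != 0 -> v r = 0 -> c0 (r ^+ k) = c0 r ^+ k.
Proof.
move=> r0 vr; elim: k => [|k ih]; first by rewrite !expr0 c01.
by rewrite !exprS c0M ?expf_neq0 // ?ih // pvX // vr mul0rn.
Qed.

(* On the pro-p-group [1 + P^m] a character killed by [n], prime to [p], is trivial. *)
Lemma char_trivial_unit1 (m : int) (M : nat) : 1 <= m ->
  (forall r, inP M%:Z (r - 1) -> c0 r = 1) ->
  (forall r, inP m (r - 1) -> c0 r ^+ n = 1) ->
  forall r, inP m (r - 1) -> c0 r = 1.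
Proof.
move=> m1 hM hm r hr; have [r0 vr] := unit1P m1 hr.
have hr1 : inP 1 (r - 1) by exact: inP_le hr.
have h1 : c0 r ^+ (res_char F ^ M) = 1.
  rewrite -charX //; apply: hM; apply: inP_le (unit1_powpX M hr1); clear; lia.
have h2 := hm r hr.
have cp : coprime (res_char F ^ M) n by rewrite coprimeXl.
have N0 : (0 < res_char F ^ M)%N by rewrite expn_gt0 prime_gt0 // pf_res_char_prime.
case: (egcdnP n N0) => km kn e _; rewrite (eqP cp) in e.
have : c0 r ^+ (km * res_char F ^ M) = c0 r ^+ (kn * n + 1) by rewrite e.
by rewrite exprD mulnC exprM h1 expr1n mulnC exprM h2 expr1n mul1r expr1.
Qed.
End CharPow.

Lemma one_sub_geometric_roots (e : C) : exists S : seq C, forall x, x \notin S -> 1 - e * x ^+ n != 0.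
Proof.
pose P : {poly C} := 1 - e%:P * 'X^n.
have PE x : P.[x] = 1 - e * x ^+ n by rewrite /P !hornerE.
have P0 : P != 0.
  apply/eqP => /(congr1 (horner^~ 0)); rewrite PE horner0 expr0n gtn_eqF // mulr0 subr0.
  by move/eqP; rewrite oner_eq0.
have [S PS] := closed_field_poly_normal P.
exists S => x hx; rewrite -PE; apply: contra hx => h.
have : root P x by [].
rewrite PS rootZ ?lead_coef_eq0 // root_prod_XsubC //.
Qed.

Context (varpi : F) (p0 : varpi != 0) (vp : v varpi = 1).
Context (dx : (F -> C) -> {measure set (borelF F) -> \bar R}) (hdx : self_dual_family dx).
Context (psi : F -> C) (hpsi : nontrivial_add_char psi).
Local Notation xi' := (xi dx n varpi psi).

Lemma even_d : ~~ odd n -> (n = 2 * d)%N.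
Proof.
move=> ne; have -> : gcdn n 2 = 2%N by apply/eqP; rewrite -/(_ == _) gcdnC; apply/eqP/gcdn_idPl; rewrite dvdn2.
by rewrite mulnC divnK // dvdn2.
Qed.

(** For even [n] the condition at 1 encodes the non-vanishing of the Weil index: were it 0, its
    quotient by itself would be 0 by convention, and so would [xi] at 1. *)
Lemma xi_sq (a b : F) (j : nat) : xi' 1 = 1 -> b != 0 -> v b = j%:Z ->
  (~~ odd n -> beta_varpi d varpi a = b ^+ 2) -> xi' a = 1.
Proof.
rewrite /xi; case: ifPn => // ne x1 b0 vb /(_ isT) ->; move: x1.
have -> : beta_varpi d varpi 1 = 1 by rewrite /beta_varpi pv1 div0z subr0 expr0z mulr1.
rewrite /weil_gamma (weil_index_sq hdx hpsi b0 vb) => h.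
have w0 : weil_index dx psi != 0.
  by apply: contra_eqN h => /eqP ->; rewrite invr0 mulr0 invr0 eq_sym oner_eq0.
by rewrite divff // invr1.
Qed.

Lemma xi_unit r : xi' 1 = 1 -> r != 0 -> v r = 0 -> xi' (r ^+ n) = 1.
Proof.
move=> x1 r0 vr; apply: (xi_sq (b := r ^+ d) (j := 0%N)) => //; first by rewrite expf_neq0.
  by rewrite pvX // vr mul0rn.
move=> ne; rewrite /beta_varpi pvX // vr mul0rn div0z subr0 expr0z mulr1 -exprM.
by rewrite mulnC -even_d.
Qed.

Lemma xi_varpi : xi' 1 = 1 -> xi' (varpi ^+ n) = 1.
Proof.
move=> x1; apply: (xi_sq (b := varpi) (j := 1%N)) => // ne.
rewrite /beta_varpi pvX // vp -mulr_natr mul1r natz.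
have d0 : d != 0%N by apply: contraTneq hn => d0; rewrite (even_d ne) d0.
rewrite {2}(even_d ne) PoszM mulzK // exprnP -expfzDr // exprnP; congr (_ ^ _).
by rewrite addrC subrK.
Qed.
End Final.

(** * From the inducing data to the value of the composite *)

Section Main.
Context (R : realType) (F : padicField) (n : nat) (iota : root_ident R F n).
Hypotheses (hn : (0 < n)%N) (hpn : coprime (res_char F) n).
Local Notation C := R[i].
Local Notation v := (@pf_v F).
Local Notation q := (res_card F).
Local Notation H := (hil iota).
Local Notation om := (omega iota).
Local Notation e1 := (root_pow iota 0).
Local Notation G := (coverSL2 R F n).
Local Notation d := (n %/ gcdn n 2)%N.
Context (varpi : F) (p0 : varpi != 0) (vp : v varpi = 1).
Context (dx : (F -> C) -> {measure set (borelF F) -> \bar R}) (hdx : self_dual_family dx).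
Context (psi : F -> C) (hpsi : nontrivial_add_char psi).
Local Notation xi' := (xi dx n varpi psi).
Context (V : lmodType C) (tau : G -> V -> V).
Hypotheses (hrep : is_rep iota (cover_H R F n) tau) (hgen : genuine tau).
Hypothesis (V0 : exists u : V, u != 0).

Lemma is_i_chi_iso chi : is_i_chi iota dx varpi psi chi tau ->
  iso_to_ind iota (cover_H R F n) tau (cover_Hd R F n)
    (fun g => sval g.2 * (chi (sval g.1 0 0) * xi' (sval g.1 0 0))).
Proof.
rewrite /is_i_chi; congr iso_to_ind; apply: funext => g; rewrite /chi_gen mulrA //.
Qed.

Lemma mul_char1 (chi : F -> C) : mul_char chi -> chi 1 = 1.
Proof. by case=> _ _ [m _ h]; apply: h; rewrite subrr inP0. Qed.

Lemma mul_charX (chi : F -> C) x k : mul_char chi -> x != 0 -> chi (x ^+ k) = chi x ^+ k.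
Proof.
move=> hchi x0; case: (hchi) => hM _ _; elim: k => [|k ih]; first by rewrite !expr0 mul_char1.
by rewrite !exprS hM ?expf_neq0 // ih.
Qed.

(** Obtained from E(1) = 1, that is, from the non-vanishing of the induced space. *)
Lemma xi1 chi : mul_char chi -> is_i_chi iota dx varpi psi chi tau -> xi' 1 = 1.
Proof.
move=> hchi /is_i_chi_iso iso.
have := ind_char1 hn hpn (E := fun x => chi x * xi' x) iso V0.
by rewrite (mul_char1 hchi) mul1r.
Qed.

(** The central element over h(x^d) acts by chi(x)^d xi(x^d) for every chi presenting tau. As xi is
    the same, chi(x)^d is determined, and [d] divides [n]. *)
Lemma chi_n_invariant chi chi' x : mul_char chi -> is_i_chi iota dx varpi psi chi tau ->
  mul_char chi' -> is_i_chi iota dx varpi psi chi' tau -> x != 0 ->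
  chiX chi' n x = chiX chi n x.
Proof.
move=> hchi h hchi' h' x0.
have iso := is_i_chi_iso h; have iso' := is_i_chi_iso h'; have [u u0] := V0.
have b0 : x ^+ d != 0 by rewrite expf_neq0.
have hb : (d%:Z %| v (x ^+ d))%Z by rewrite pvX // -mulr_natl natz dvdz_mulr.
have c1 := ind_central hn hpn (E := fun x => chi x * xi' x) iso u x0.
have c2 := ind_central hn hpn (E := fun x => chi' x * xi' x) iso' u x0.
have E0 := ind_char_neq0 hn hpn (E := fun x => chi x * xi' x) iso V0 b0 hb.
have : chi' x ^+ d = chi x ^+ d.
  move: c1 E0; rewrite c2 /= mulf_eq0 => /eqP; rewrite -subr_eq0 -scalerBl scaler_eq0 (negbTE u0) orbF.
  rewrite negb_or subr_eq0 => /eqP c /andP[_ x1].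
  by rewrite -!mul_charX //; apply: (mulIf x1).
move=> e; rewrite /chiX -!exprnP.
have -> : n = (d * gcdn n 2)%N by rewrite divnK // dvdn_gcdl.
by rewrite !exprM e.
Qed.

Context (chi : F -> C) (hchi : mul_char chi) (hi : is_i_chi iota dx varpi psi chi tau).
Let iso := is_i_chi_iso hi.
Let E x := chi x * xi' x.

Lemma E_unit_mul r r' : r != 0 -> v r = 0 -> r' != 0 -> v r' = 0 -> E (r * r') = E r * E r'.
Proof.
move=> r0 vr r'0 vr'.
rewrite -(ind_char_mul hn hpn (E := E) iso V0 r0 r'0) ?vr ?vr' ?dvdz0 //.
by rewrite (hil_units iota hn hpn) // mul1r.
Qed.

Lemma E_unit_n r : r != 0 -> v r = 0 -> E r ^+ n = chi r ^+ n.
Proof.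
move=> r0 vr; rewrite -(charX E_unit_mul (ind_char1 hn hpn (E := E) iso V0)) //.
by rewrite /E (xi_unit hdx hpsi (xi1 hchi hi)) // mulr1 mul_charX.
Qed.

Lemma E_varpi_n : E (varpi ^+ n) = chi varpi ^+ n.
Proof. by rewrite /E (xi_varpi hn p0 vp hdx hpsi (xi1 hchi hi)) mulr1 mul_charX. Qed.

Lemma least_uniq (P : set int) k : is_least P k -> xget 0 (is_least P) = k.
Proof.
move=> [Pk kmin]; apply: xget_unique => // j [Pj jmin].
by apply/eqP; rewrite eq_le kmin // jmin.
Qed.

Lemma unramified_n : unramified (chiX chi n) <-> forall r, r != 0 -> v r = 0 -> E r ^+ n = 1.
Proof.
split=> h r r0 vr; first by rewrite E_unit_n // -(h r r0 vr) /chiX -exprnP.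
by rewrite /chiX -exprnP -E_unit_n // h.
Qed.

(** If chi^n is unramified, [E] on units is killed by [n], hence trivial on 1 + P, hence a power of
    [omega], whose value at a generator is a primitive root. Otherwise [E] is no power of [omega],
    all of these being killed by [n], and [E] has the conductor of chi^n since a character killed by
    [n] is trivial on 1-units. *)
Lemma conductor_data : exists (a : int) (b : bool) (i0 : nat),
  [/\ 1 <= a /\ (i0 < n)%N, (forall r, inP a (r - 1) -> E r = 1) /\
      (forall j, 1 <= j -> j < a -> exists2 r, inP j (r - 1) & E r != 1),
      forall i, (i < n)%N ->
        if b && (i == i0) then forall r, r != 0 -> v r = 0 -> E r = om r ^+ i
        else exists r, [/\ r != 0, v r = 0 & E r != om r ^+ i],
      forall i, (i < n)%N -> i != i0 ->
        exists r, [/\ r != 0, v r = 0 & om r ^+ i != om r ^+ i0] &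
      if `[< unramified (chiX chi n) >] then a = 1 /\ b
      else a = cond_mul (chiX chi n) /\ ~~ b].
Proof.
have [g [g0 vg gp ggen]] := omega_gen iota hn hpn.
have [M M0 hM] := ind_char_smooth hn hpn (E := E) iso V0.
have E1' := ind_char1 hn hpn (E := E) iso V0.
have gsep i i0 : (i < n)%N -> (i0 < n)%N -> i != i0 -> om g ^+ i != om g ^+ i0.
  by move=> iN i0N; apply: contra; rewrite (eq_prim_root_expr gp) !modn_small.
case: asboolP => hu.
  have hEn := unramified_n.1 hu.
  have E_1 r : inP 1 (r - 1) -> E r = 1.
    apply: (char_trivial_unit1 hpn E_unit_mul E1' (lexx _) hM) => x hx.
    by have [x0 vx] := unit1P (lexx (1 : int)) hx; exact: hEn.
  have /(prim_rootP gp) [i0 hi0] := hEn g g0 vg.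
  have hE r : r != 0 -> v r = 0 -> E r = om r ^+ i0.
    move=> r0 vr; have [i hr] := ggen r r0 vr.
    have gi0 : g ^+ i != 0 by rewrite expf_neq0.
    have vgi : v (g ^+ i) = 0 by rewrite pvX // vg mul0rn.
    have hu1 : inP 1 (r / g ^+ i - 1).
      rewrite (_ : _ - 1 = (g ^+ i)^-1 * (r - g ^+ i)); last by field.
      by rewrite inP_scale' ?invr_neq0 // pvV // vgi oppr0 subr0.
    have [u0 vu] := unit1P (lexx (1 : int)) hu1.
    have -> : r = r / g ^+ i * g ^+ i by rewrite divfK.
    rewrite E_unit_mul // E_1 // mul1r (charX E_unit_mul E1') // hi0.
    rewrite (omegaM iota hn hpn u0 vu gi0 vgi) (omega_unit1 iota hn hpn hu1) mul1r.
    rewrite [g ^+ i]exprnP (omegaXz iota hn hpn _ g0 vg) -exprnP -!exprM mulnC //.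
  exists 1, true, i0; split=> //.
  - by split=> // j j1; rewrite ltNge j1.
  - move=> i iN /=; case: eqP => [->|/eqP ii]; first exact: hE.
    by exists g; rewrite g0 vg hE // gsep // eq_sym.
  - by move=> i iN ii; exists g; rewrite g0 vg gsep.
pose Q : set int := [set m | 1 <= m /\ forall r, inP m (r - 1) -> E r = 1].
have QM : Q M%:Z by split=> //; move: M0; clear; lia.
have [a [[a1 ha] amin]] := int_least QM (fun k (h : Q k) => h.1).
(* With [b] false the index 0 is a placeholder. *)
exists a, false, 0%N; split=> //.
- split=> // j j1 ja; apply: contrapT => h.
  suff : a <= j by rewrite leNgt ja.
  apply: amin; split=> // r hr; apply/eqP; apply: contra_notT h => Er; by exists r.
- move=> i iN /=; apply: contrapT => h; apply: hu; apply/unramified_n => r r0 vr.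
  have -> : E r = om r ^+ i.
    by apply/eqP; apply: contra_notT h => Er; exists r.
  by rewrite -exprM mulnC exprM omegan expr1n.
- by move=> i iN ii; exists g; rewrite g0 vg gsep.
split=> //; rewrite /cond_mul asboolF //; symmetry; apply: least_uniq; split.
  split=> // r hr; have [r0 vr] := unit1P a1 hr.
  by rewrite /chiX -exprnP -E_unit_n // ha // expr1n.
move=> m [m1 hm]; apply: amin; split=> //.
apply: (char_trivial_unit1 hpn E_unit_mul E1' m1 hM) => r hr.
have [r0 vr] := unit1P m1 hr.
by rewrite E_unit_n // -(hm r hr) /chiX -exprnP.
Qed.

(** The vector does not depend on s and is the value of [f] at w, so evaluating there turns the
    defining relation of mu into an identity of scalars. *)
Lemma intertwining_value : exists2 v0 : V, v0 != 0 & forall s : C,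
  1 - chi varpi ^+ n * qs F s ^+ n != 0 -> 1 - (chi varpi ^+ n)^-1 * qs F s ^- n != 0 ->
  exists f : G -> V, [/\ in_I iota tau s f, f (sec iota (SL2_w F)) = v0 &
    intertwining iota (dx psi) (SL2_inv (SL2_w F)) (tau_w iota tau) (- s)
      (intertwining iota (dx psi) (SL2_w F) tau s f) (sec iota (SL2_w F)) =
    (q%:R ^ cond_add psi * (if `[< unramified (chiX chi n) >]
       then q%:R^-1 + (1 - q%:R^-1) ^+ 2 /
         ((1 - chi varpi ^+ n * qs F s ^+ n) * (1 - (chi varpi ^+ n)^-1 * qs F s ^- n))
       else q%:R ^ (- cond_mul (chiX chi n)))) *: v0].
Proof.
have [a [b [i0 [[a1 i0n] [ha hamin] good gen hab]]]] := conductor_data.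
have pr := rep_proj hn hpn hrep hgen.
have [v0 v0n hv0] := ind_eigenvector hn hpn (E := E) iso V0.
have hmu : is_haar (dx psi) by case: (hdx hpsi).
exists v0 => // s h1 h2.
have hchi0 r : r != 0 -> v r = 0 -> tau (hh r, e1) v0 = E r *: v0.
  by move=> r0 vr; apply: hv0; rewrite ?vr ?dvdz0.
have heta : tau (hh (varpi ^+ n), e1) v0 = (chi varpi ^+ n) *: v0.
  rewrite hv0 ?expf_neq0 ?[X in X *: _]E_varpi_n // pvX // vp -mulr_natr mul1r natz.
  by apply: dvdn_div; exact: dvdn_gcdl.
have [f [f1 f2 f3]] := mu_value hn hpn hmu (iso_to_ind_separated (E := E) iso) pr p0 vp v0n hchi0 heta a1 ha hamin i0n good gen h1 h2.
exists f; split=> //; rewrite f3; congr (_ *: _).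
have vol2 : (vol (dx psi))%:C%C ^+ 2 = q%:R ^ cond_add psi :> C.
  have [ac ex] := hpsi; have [c1 c2] := cond_addP ac ex.
  rewrite -rmorphXn (self_dual_vol ac (hdx hpsi) c1 c2) fmorphXz rmorph_nat //.
rewrite vol2; congr (_ * _); move: hab; case: asboolP => hu [-> hb].
  by rewrite hb mul1r exprN1.
by rewrite (negbTE hb) !mul0r addr0.
Qed.
End Main.

(** * The final formula *)

Section LFactor.
Context (R : realType) (F : padicField).
Local Notation C := R[i].
Local Notation q := (res_card F).

Lemma cpow_qs_n n (s : C) : cpow (q%:R : R) (- (n%:R * s)) = qs F s ^+ n.
Proof. exact: qs_Mn. Qed.

Lemma cpow_1D (z : C) : cpow (q%:R : R) (- (1 + z)) = q%:R^-1 * cpow q%:R (- z).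
Proof.
rewrite opprD cpowDr ?qR_gt0 //; congr (_ * _).
by rewrite cpowN ?qR_gt0 // (cpow1r (qR_gt0 R F)) rmorph_nat.
Qed.

Lemma chiXN chi n : chiX (R := R) (F := F) chi (- n%:Z) = fun x => (chi x ^+ n)^-1.
Proof. by apply: funext => x; rewrite /chiX exprnN. Qed.

Lemma unramifiedN (chi : F -> C) n :
  `[< unramified (chiX chi (- n%:Z)) >] = `[< unramified (chiX chi n) >].
Proof.
by apply: asbool_equiv_eq; split=> h x x0 vx; have := h x x0 vx;
  rewrite /chiX -exprnN -exprnP => h1; [rewrite -[LHS]invrK h1|rewrite h1]; rewrite invr1.
Qed.

(* Partial fractions: [(1-t)^2 + t (1-Y)(1-1/Y) = (1-tY)(1-t/Y)]. *)
Lemma plancherel_id (t Y : C) : Y != 0 -> 1 - Y != 0 -> 1 - Y^-1 != 0 ->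
  t + (1 - t) ^+ 2 / ((1 - Y) * (1 - Y^-1)) =
  (1 - Y)^-1 * (1 - Y^-1)^-1 / ((1 - t * Y^-1)^-1 * (1 - t * Y)^-1).
Proof.
move=> Y0 h1 h2; rewrite -[_ * (1 - t * Y)^-1]invfM invrK -[(1 - Y)^-1 * _]invfM.
have h3 : Y - 1 != 0 by apply: contraNneq h1 => h; rewrite -opprB h oppr0.
by field; rewrite Y0 h1 h3.
Qed.
End LFactor.

Theorem theorem6p1 (R : realType) (F : padicField) (n : nat)
    (hn : (0 < n)%N) (hpn : coprime (res_char F) n)
    (iota : root_ident R F n)
    (varpi : F) (hvarpi0 : varpi != 0) (hvarpi : pf_v varpi = 1)
    (dx : (F -> R[i]) -> {measure set (borelF F) -> \bar R})
    (hdx : self_dual_family dx)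
    (psi : F -> R[i]) (hpsi : nontrivial_add_char psi)
    (V : lmodType R[i]) (tau : coverSL2 R F n -> V -> V)
    (htau_rep : is_rep iota (cover_H R F n) tau)
    (htau_gen : genuine tau)
    (htau_smooth : smooth iota (cover_H R F n) tau)
    (htau_adm : admissible iota (cover_H R F n) tau)
    (htau_irr : irreducible (cover_H R F n) tau)
    (chi : F -> R[i]) (hchi : mul_char chi)
    (htau : is_i_chi iota dx varpi psi chi tau) :
  (forall chi' : F -> R[i], mul_char chi' ->
     is_i_chi iota dx varpi psi chi' tau ->
     forall x : F, x != 0 -> chiX chi' n x = chiX chi n x) /\
  (forall mu : R[i] -> R[i], is_mu iota (dx psi) tau mu ->
     almost_all_s F (fun s : R[i] =>
       (mu s)^-1 =
       (res_card F)%:R ^ (cond_add psi - cond_mul (chiX chi n)) *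
       ((L_factor varpi (n%:R * s) (chiX chi n) *
         L_factor varpi (- (n%:R * s)) (chiX chi (- n%:Z))) /
        (L_factor varpi (1 - n%:R * s) (chiX chi (- n%:Z)) *
         L_factor varpi (1 + n%:R * s) (chiX chi n))))).
Proof.
have V0 := htau_irr.1; split.
  by move=> chi' hchi' h' x x0; exact: (chi_n_invariant hn hpn V0 hchi htau hchi' h' x0).
move=> mu [_ [S hS]].
have [v0 v0n val] := intertwining_value hn hpn hvarpi0 hvarpi hdx hpsi htau_rep htau_gen V0 hchi htau.
have [S' hS'] := one_sub_geometric_roots hn (chi varpi ^+ n).
(* [S] comes from the definition of mu, and [S'] excludes the zeros of 1 - Y with Y = chi^n(varpi)
   q^(-ns); the other denominator 1 - 1/Y vanishes at the same points. *)
exists (S ++ S') => s; rewrite mem_cat negb_or => /andP[/hS hs /hS' h1].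
have e0 : chi varpi ^+ n != 0 by case: hchi => _ c0 _; rewrite expf_neq0 // c0.
have X0 : qs F s ^+ n != 0 by rewrite expf_neq0 // qs_neq0.
have Y0 : chi varpi ^+ n * qs F s ^+ n != 0 by rewrite mulf_neq0.
have h2 : 1 - (chi varpi ^+ n * qs F s ^+ n)^-1 != 0.
  apply: contraNneq h1 => /subr0_eq h; apply/eqP.
  by rewrite -[X in 1 - X]invrK -h invr1 subrr.
have h3 : 1 - (chi varpi ^+ n)^-1 * qs F s ^- n != 0 by rewrite -invfM.
have [f [f1 f2 f3]] := val s h1 h3.
(* Both expressions for the composite at w are multiples of v0 <> 0, so the scalars agree. *)
move: f3; rewrite hs // f2 => /eqP; rewrite -subr_eq0 -scalerBl scaler_eq0 (negbTE v0n) orbF subr_eq0 => /eqP ->.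
rewrite expfzDr ?qC_neq0 // -[RHS]mulrA; congr (_ * _).
(* In the ramified case every L-factor is 1 and only the power of q remains. Otherwise the conductor
   of chi^n is 0 and [plancherel_id] applies with t = 1/q. *)
rewrite /L_factor unramifiedN /cond_mul; case: asboolP => hu; last by rewrite !mulr1 ?invr1 ?divff ?oner_neq0 ?mulr1.
rewrite oppr0 expr0z mul1r chiXN /chiX -!exprnP.
rewrite !cpow_1D !cpowN ?qR_gt0 // -[(cpow _ (n%:R * s))^-1]cpowN ?qR_gt0 // cpow_qs_n.
by rewrite ![_ * ((res_card F)%:R^-1 * _)]mulrCA -invfM plancherel_id // invfM.
Qed.
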